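(* Let $\Gamma$ be a crystal such that $\mathcal{H}_\Gamma$ has Lipschitz continuous Floquet matrix elements $h_{ij}$ on $\mathbb{T}^d$. Let $\nu'(\theta)$ be the number of distinct eigenvalues of $H(\theta)$, let $\mathcal{J}\subset\mathbb{T}^d$ be the set of discontinuity points of $\nu'$, and assume that $\overline{\mathcal{J}}$ has Lebesgue measure zero. Then $\mathcal{H}_\Gamma$ exhibits ballistic transport along at least one layer: there exists $i\in\{1,\dots,\nu\}$ such that $$\lim_{t\to\infty}\frac{\|x e^{-it\mathcal{H}_\Gamma}\delta_w\|^2}{t^2}\neq 0$$ for every vertex $w$ in the layer $L_i=\{v_i+k_{\mathfrak a}:k\in\mathbb{Z}^d\}$.
   Context: A crystal ($\mathbb{Z}^d$-periodic graph with finite fundamental cell) $\Gamma=(w,Q)$ consists of: a countable vertex set $V\subset\mathbb{R}^d$ and linearly independent $\mathfrak{a}_1,\dots,\mathfrak{a}_d\in\mathbb{R}^d$ such that, with $k_{\mathfrak a}=\sum_i k_i\mathfrak{a}_i$ for $k\in\mathbb{Z}^d$, every $v\in V$ is uniquely $v=v_0+k_{\mathfrak a}$ with $v_0\in V_0=\{v_1,\dots,v_\nu\}$ (finite), $k\in\mathbb{Z}^d$, and all such points are in $V$; a weight function $w:V\times V\to[0,\infty)$ with $w(v,v')=w(v',v)$, $w(v,v)=0$, $\sum_{v'}w(v,v')<\infty$, $w(v+k_{\mathfrak a},v'+k_{\mathfrak a})=w(v,v')$; a potential $Q:V\to\mathbb{R}$ with $Q(v+k_{\mathfrak a})=Q(v)$;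 the graph with edges $\{w(v,v')>0\}$ being connected. Put $w_{ij}(k)=w(v_i,v_j+k_{\mathfrak a})$, $Q_i=Q(v_i)$, $\mathbb{T}^d=\mathbb{R}^d/\mathbb{Z}^d$. On $\ell^2(V)$, $(\mathcal{H}_\Gamma\psi)(v)=\sum_{v'}w(v,v')\psi(v')+Q(v)\psi(v)$. The Floquet matrix is $H(\theta)=(h_{ij}(\theta))_{i,j=1}^\nu$, $h_{ij}(\theta)=\sum_{k\in\mathbb{Z}^d}w_{ij}(k)e^{2\pi i\theta\cdot k}+\delta_{ij}Q_i$. Identify $\ell^2(V)\cong\ell^2(\mathbb{Z}^d)^\nu$ via $\psi_i(k)=\psi(v_i+k_{\mathfrak a})$. The operator $x$: $(x\psi)(k)=(k_1\psi(k),\dots,k_d\psi(k))$, so $\|x\psi\|^2=\sum_{k\in\mathbb{Z}^d}\sum_{p=1}^\nu|k|_2^2|\psi_p(k)|^2$. In the claim, $\delta_w$ is the indicator of the vertex $w$ (not to be confused with the weight function). *)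

(* Defs.v *)
From HB Require Import structures.
From mathcomp Require Import all_boot all_order all_algebra finmap.
From mathcomp Require Import complex.
From mathcomp Require Import all_classical all_reals all_analysis.
Import Order.TTheory GRing.Theory Num.Theory.
Import numFieldNormedType.Exports.

Set Implicit Arguments.
Unset Strict Implicit.
Unset Printing Implicit Defensive.

Local Open Scope classical_set_scope.
Local Open Scope ring_scope.
Local Open Scope complex_scope.

(* [k_a = \sum_i k_i a_i], where the period [a_i] is the [i]-th row of [a]. *)
Definition lattice_vec (R : realType) (d : nat) (a : 'M[R]_d) (k : 'rV[int]_d)
  : 'rV[R]_d := \sum_(i < d) (k ord0 i)%:~R *: row i a.

(* [weight] and [potential] live on the vertex set only (the set [vertices]
   coerces to the type of its elements), so a translate [v + k_a] of a vertex is
   referred to through any vertex having this position. *)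
Record crystal (R : realType) (d : nat) := Crystal {
  vertices : set 'rV[R]_d;
  vertices_countable : countable vertices;
  period : 'M[R]_d;
  period_free : row_free period;
  nu : nat;
  nu_gt0 : (0 < nu)%N;
  cell : 'I_nu -> 'rV[R]_d;
  cell_vertices : forall v,
    vertices v <-> exists i k, v = cell i + lattice_vec period k;
  cell_unique : forall i j k l,
    cell i + lattice_vec period k = cell j + lattice_vec period l ->
    i = j /\ k = l;
  weight : vertices -> vertices -> R;
  weight_ge0 : forall u v, 0 <= weight u v;
  weight_sym : forall u v, weight u v = weight v u;
  weight_diag : forall v, weight v v = 0;
  weight_summable : forall v,
    (\esum_(u in [set: vertices]) (weight v u)%:E < +oo)%E;
  weight_periodic : forall (k : 'rV[int]_d) (u u' v v' : vertices),
    \val u' = \val u + lattice_vec period k ->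
    \val v' = \val v + lattice_vec period k ->
    weight u' v' = weight u v;
  potential : vertices -> R;
  potential_periodic : forall (k : 'rV[int]_d) (v v' : vertices),
    \val v' = \val v + lattice_vec period k -> potential v' = potential v;
  crystal_connected : forall u v : vertices,
    exists p : seq vertices,
      path (fun x y => 0 < weight x y) u p /\ last u p = v
}.

(* Unconditional sum of a complex family, as the limit of its finite partial
   sums along the directed set of finite subsets of [I]. *)
Definition csum (R : realType) (I : choiceType) (f : I -> R[i]) : R[i] :=
  lim ((fun A : {fset I} => (\sum_(i <- A) f i : R[i]^o)) @
       filter_from [set: {fset I}] (fun A => [set B | (A `<=` B)%fset])).

Definition cis (R : realType) (x : R) : R[i] := cos x +i* sin x.

Section CrystalOperators.
Variables (R : realType) (d : nat) (G : crystal R d).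

Lemma vertex_subproof (i : 'I_(nu G)) (k : 'rV[int]_d) :
  cell i + lattice_vec (period G) k \in vertices G.
Proof. by apply/mem_set/cell_vertices; exists i, k. Qed.

Definition vertex (i : 'I_(nu G)) (k : 'rV[int]_d) : vertices G :=
  exist _ (cell i + lattice_vec (period G) k) (vertex_subproof i k).

Definition layer (i : 'I_(nu G)) : set (vertices G) := range (vertex i).

Definition hamiltonian (psi : vertices G -> R[i]) (v : vertices G) : R[i] :=
  csum (fun u => (weight v u)%:C * psi u) + (potential v)%:C * psi v.

(* [e^{-itH} psi] through the exponential series; [H] is bounded on [l^2(V)], so
   for [psi] in [l^2(V)] the series converges in [l^2(V)], hence at each vertex,
   which is how its sum is computed here. *)
Definition propagator (t : R) (psi : vertices G -> R[i]) (v : vertices G)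
  : R[i] :=
  lim ((fun N : nat => (\sum_(0 <= n < N)
    (0 -i* t) ^+ n / n`!%:R * iter n hamiltonian psi v : R[i]^o)) @ \oo).

Definition delta (w v : vertices G) : R[i] := (v == w)%:R.

(* [||x psi||^2] in the coordinates [psi_p(k) = psi (v_p + k_a)]; it is [+oo]
   when [psi] is not in the domain of [x]. *)
Definition position_norm2 (psi : vertices G -> R[i]) : \bar R :=
  \esum_(k in [set: 'rV[int]_d])
    (\sum_(p < nu G) (\sum_(j < d) ((k ord0 j)%:~R : R) ^+ 2) *
       (Normc.normc (psi (vertex p k))) ^+ 2)%:E.

(* Functions on the torus [R^d / Z^d] are represented by their [Z^d]-periodic
   lifts to [R^d]. *)
Definition floquet (theta : 'rV[R]_d) : 'M[R[i]]_(nu G) :=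
  \matrix_(i, j)
    (csum (fun k : 'rV[int]_d => (weight (vertex i 0) (vertex j k))%:C *
       cis (2 * pi * \sum_(l < d) theta ord0 l * (k ord0 l)%:~R))
     + (i == j)%:R * (potential (vertex i 0))%:C).

Definition num_eigenvalues (theta : 'rV[R]_d) : nat :=
  #|` fset_set [set a : R[i] | eigenvalue (floquet theta) a] |%fset.

(* The preimage in [R^d] of the discontinuity set in [R^d / Z^d]: the covering
   map being a local homeomorphism, continuity at a point may be tested on the
   lift, and closures and null sets correspond to those of the preimage. *)
Definition discontinuities : set 'rV[R]_d :=
  [set theta | ~ {for theta, continuous num_eigenvalues}].

End CrystalOperators.

Definition torus_dist (R : realType) (d : nat) (x y : 'rV[R]_d) : R :=
  inf [set `|x - y + map_mx intr k| | k in [set: 'rV[int]_d]].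

Definition torus_lipschitz (R : realType) (d : nat) (f : 'rV[R]_d -> R[i])
  : Prop :=
  exists L : R, forall x y, Normc.normc (f x - f y) <= L * torus_dist x y.

(* Lebesgue outer measure on [R^d], by countable covers by closed boxes. *)
Definition lebesgue_outer (R : realType) (d : nat) (A : set 'rV[R]_d) : \bar R :=
  ereal_inf [set s | exists lo hi : nat -> 'rV[R]_d,
    [/\ forall n j, lo n ord0 j <= hi n ord0 j,
        A `<=` \bigcup_n [set x | forall j, lo n ord0 j <= x ord0 j <= hi n ord0 j]
      & s = (\sum_(0 <= n <oo)
               (\prod_(j < d) (hi n ord0 j - lo n ord0 j))%:E)%E]].

(* Main.v *)
(* Write [x_j] for the [j]-th coordinate and [D_j B = [x_j, B]], a derivation on periodic
   kernels.  The Lipschitz condition, tested along the [j]-th axis of the torus with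
   Parseval's identity on finite grids, gives [\sum_k k_j^2 w_pq(k)^2 < oo], so that the
   columns of [D_j H], hence those of [D_j e^{-itH}], are square summable.

   As [e^{inH} D_j e^{-inH}] is the [n]-th Birkhoff sum of the isometry
   [B |-> e^{iH} B e^{-iH}] of the Hilbert space of periodic kernels with square summable
   columns, F. Riesz' mean ergodic theorem gives a limit of [|D_j e^{-itH} delta_v| / t],
   that is, of [|x_j e^{-itH} delta_v| / t], for every vertex [v].

   If the limit vanished for every layer, then, writing [tr_k] for the sum over the cell of
   the entries at displacement [k], cyclicity of this trace would give, for [s > 0],
   [k_j tr_k (e^{-isH}) = tr_k (D_j e^{-isH}) = tr_k (e^{i(n-1)sH} D_j e^{-insH}) / n -> 0].
   All powers of [H], hence of [H + c], would then have [tr_k = 0] whenever [k_j <> 0]; but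
   for large [c] the entries of [H + c] are nonnegative, and positive along
   edges, and connectedness provides a path from [v] to its translate by [k]. *)

Require Import Defs.
From HB Require Import structures.
From mathcomp Require Import all_boot all_order all_algebra finmap.
From mathcomp Require Import complex.
From mathcomp Require Import all_classical all_reals all_analysis.
From mathcomp Require Import zify ring lra.
Import Order.TTheory GRing.Theory Num.Theory.
Import numFieldNormedType.Exports.

Set Implicit Arguments.
Unset Strict Implicit.
Unset Printing Implicit Defensive.

Local Open Scope fset_scope.
Local Open Scope classical_set_scope.
Local Open Scope complex_scope.
Local Open Scope ring_scope.

(** * Unconditional sums *)

(** The Lipschitz condition makes the columns of [deriv x h] square summable, which need not make
    them summable, and this shapes the estimates. In each product one factor has summable rows or
    columns ([kpow h n], [kexp h t]), while the other is measured by the square sum of its columns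
    over one cell, a Hilbert-Schmidt norm per unit cell that [kexp h t] does not increase from
    either side.

    The ergodic theorem is stated as a Cauchy estimate, so the space of kernels needs no
    completeness: only real column norms pass to a limit. Integer times suffice because the drift
    varies by a bounded amount over a unit of time.

    The trace argument uses one fixed direction [j] and the drifts of all layers together, by
    Cauchy-Schwarz. Hence a layer found for one direction is enough: the other directions add
    squares to the limit. Passing from exponentials to powers of [H] compares Taylor coefficients as
    [t] tends to 0. *)

Notation nc := Normc.normc.

(** * Modulus of complex numbers *)

Section Modulus.
Variable R : realType.
Implicit Types x y z : R[i].

Lemma nc0 : nc (0 : R[i]) = 0.
Proof. exact: Normc.normc0. Qed.

Lemma nc1 : nc (1 : R[i]) = 1.
Proof. exact: Normc.normc1. Qed.

Lemma ncM x y : nc (x * y) = nc x * nc y.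
Proof. exact: Normc.normcM. Qed.

Lemma ncX x n : nc (x ^+ n) = nc x ^+ n.
Proof. by elim: n => [|n IH]; rewrite ?nc1 // !exprS ncM IH. Qed.

Lemma ncD x y : nc (x + y) <= nc x + nc y.
Proof. exact: le_normcD. Qed.

Lemma ncN x : nc (- x) = nc x.
Proof. exact: normcN. Qed.

Lemma ncB x y : nc (x - y) = nc (y - x).
Proof. by rewrite -ncN opprB. Qed.

Lemma nc_ge0 x : 0 <= nc x.
Proof. by case: x => a b; rewrite sqrtr_ge0. Qed.

Lemma ncE x : (nc x)%:C = `|x|.
Proof. by case: x => a b; rewrite normc_def. Qed.

Lemma nc_real (r : R) : nc r%:C = `|r|.
Proof. by rewrite /= expr0n /= addr0 sqrtr_sqr. Qed.

Lemma nc_conj x : nc x^*%C = nc x.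
Proof. by case: x => a b /=; rewrite sqrrN. Qed.

Lemma conjcM x y : (x * y)^*%C = x^*%C * y^*%C.
Proof. exact: rmorphM. Qed.

Lemma nc_sqr x : ((nc x) ^+ 2)%:C = x^*%C * x.
Proof. by rewrite rmorphXn /= ncE sqr_normc mulrC. Qed.

Lemma nc_nat n : nc (n%:R : R[i]) = n%:R.
Proof. by rewrite -(rmorph_nat (real_complex R)) nc_real ger0_norm. Qed.

Lemma nc_inv x : nc x^-1 = (nc x)^-1.
Proof. exact: Normc.normcV. Qed.

Lemma nc_sum (I : Type) (s : seq I) (P : pred I) (f : I -> R[i]) :
  nc (\sum_(i <- s | P i) f i) <= \sum_(i <- s | P i) nc (f i).
Proof.
elim/big_rec2: _ => [|i x y _ le_yx]; first by rewrite nc0.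
by apply: le_trans (ncD _ _) _; rewrite lerD2l.
Qed.

Lemma nc_Re x : `|complex.Re x| <= nc x.
Proof. by have := normc_ge_Re x; rewrite -ncE lecR. Qed.

Lemma nc_Im x : `|complex.Im x| <= nc x.
Proof.
case: x => a b /=; rewrite -sqrtr_sqr ler_sqrt ?lerDr ?sqr_ge0 //.
by rewrite addr_ge0 ?sqr_ge0.
Qed.

Lemma nc_le_ReIm x : nc x <= `|complex.Re x| + `|complex.Im x|.
Proof.
have {1}-> : x = (complex.Re x)%:C + 'i%C * (complex.Im x)%:C.
  by case: x => a b; simpc.
apply: le_trans (ncD _ _) _; rewrite ncM !nc_real.
have -> : nc ('i%C : R[i]) = 1 by rewrite /= expr0n expr1n add0r sqrtr1.
by rewrite mul1r.
Qed.

Lemma eq0_nc x : (nc x <= 0) = (x == 0).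
Proof.
apply/idP/eqP => [x0|->]; last by rewrite nc0.
by apply: Normc.eq0_normc; apply/eqP; rewrite eq_le x0 nc_ge0.
Qed.

End Modulus.

(** * Sums over finite subsets *)

Section FsetSums.
Variables (R : numDomainType) (I : choiceType).
Implicit Types (A B : {fset I}) (f : I -> R).

Lemma fsetU_sum (V : zmodType) (f : I -> V) A B : (A `<=` B)%fset ->
  \sum_(i <- B) f i = \sum_(i <- A) f i + \sum_(i <- (B `\` A)%fset) f i.
Proof.
move=> sAB; rewrite (big_fsetID _ (mem A) B f) /=; congr (_ + _).
  have -> : [fset x in B | x \in A] = A; last by [].
  by apply/fsetP => i; rewrite !inE /= andbC; case: (boolP (i \in A)) => // /(fsubsetP sAB) ->.
have -> : [fset x in B | x \notin A] = (B `\` A)%fset; last by [].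
by apply/fsetP => i; rewrite !inE /= andbC.
Qed.

Lemma le_fset_sum f A B : (A `<=` B)%fset -> (forall i, 0 <= f i) ->
  \sum_(i <- A) f i <= \sum_(i <- B) f i.
Proof. by move=> sAB f0; rewrite (fsetU_sum f sAB) lerDl sumr_ge0. Qed.

Lemma le_fset_sum1 f A i : i \in A -> (forall i, 0 <= f i) ->
  f i <= \sum_(i <- A) f i.
Proof.
move=> iA f0; rewrite -(big_seq_fset1 +%R i f).
by apply: le_fset_sum => //; apply/fsubsetP => j; rewrite inE => /eqP ->.
Qed.

Lemma le_sum_fin (J : finType) (f : J -> R) (A : {fset J}) : (forall i, 0 <= f i) ->
  \sum_(i <- A) f i <= \sum_i f i.
Proof.
move=> f0; rewrite big_uniq ?fset_uniq //= [leRHS](bigID (fun i => i \in A)) /=.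
by rewrite lerDl sumr_ge0.
Qed.

End FsetSums.

(* [usum], like [kexp] and [nrm] below, is sealed: conversion tests must not unfold the
   limit along the filter. *)
HB.lock Definition usum (R : realType) (I : choiceType) (f : I -> R[i]) : R[i] :=
  csum f.

(** * Absolute and unconditional summability *)

Section Sums.
Variable R : realType.

(** Absolute summability with an explicit bound, so that constants can be followed through products
    and exchanged sums. *)
Definition abs_le (I : choiceType) (f : I -> R[i]) (M : R) :=
  forall A : {fset I}, \sum_(i <- A) nc (f i) <= M.

Definition has_sum (I : choiceType) (f : I -> R[i]) (s : R[i]) :=
  forall e : R, 0 < e -> exists A : {fset I}, forall B : {fset I},
    (A `<=` B)%fset -> nc (\sum_(i <- B) f i - s) <= e.

Section OneIndex.
Variable I : choiceType.
Implicit Types (f g : I -> R[i]) (s t : R[i]) (M N : R) (A B : {fset I}).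

Lemma usum_has_sum f s : has_sum f s -> usum f = s.
Proof.
rewrite usum.unlock => fs; have FF : ProperFilter (filter_from [set: {fset I}]
    (fun A => [set B | (A `<=` B)%fset])).
  apply: filter_from_proper; last by move=> A _; exists A => /=.
  apply: filter_from_filter; first by exists fset0.
  move=> A B _ _; exists (A `|` B)%fset => // D /=.
  by rewrite fsubUset => /andP[].
apply: (@cvg_lim R[i]^o _ _ _ FF); first exact: norm_hausdorff.
apply/cvgrPdist_le => /= e e0.
(* Positivity in [R[i]] entails being real, so the complex tolerance [e] is the image of a real
   one. *)
have er : e = (complex.Re e)%:C by rewrite RRe_real // gtr0_real.
have [|A hA] := fs (complex.Re e); first by rewrite -ltcR -er.
exists A => // B /= AB.
by rewrite -ncE er lecR ncB hA.
Qed.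

Lemma abs_le_ge0 f M : abs_le f M -> 0 <= M.
Proof. by move/(_ fset0); rewrite big_seq_fset0. Qed.

Lemma abs_leW f M N : M <= N -> abs_le f M -> abs_le f N.
Proof. by move=> MN fM A; exact: le_trans (fM A) MN. Qed.

Lemma abs_le_tail f M e : abs_le f M -> 0 < e ->
  exists A, forall B, [disjoint A & B]%fset -> \sum_(i <- B) nc (f i) <= e.
Proof.
move=> fM e0; pose S := [set \sum_(i <- A) nc (f i) | A in [set: {fset I}]].
have supS : has_sup S.
  split; first by exists (\sum_(i <- fset0) nc (f i)), fset0.
  by exists M => _ [A _ <-]; exact: fM.
have [_ [A _ <-] ltA] := sup_adherent e0 supS.
exists A => B dAB; have : \sum_(i <- (A `|` B)%fset) nc (f i) <= sup S.
  by apply: ub_le_sup; [case: supS | exists ((A `|` B)%fset)].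
rewrite (fsetU_sum _ (fsubsetUl A B)).
have -> : ((A `|` B) `\` A)%fset = B.
  by rewrite fsetDUl fsetDv fset0U; apply/fsetDidPl; rewrite fdisjoint_sym.
by lra.
Qed.

(** Real and imaginary parts are each written as the difference of the nonnegative families
    [|g| + g] and [|g|], whose finite sums increase to their supremum. *)
Lemma abs_le_has_sum f M : abs_le f M -> exists s, has_sum f s.
Proof.
have real_case (g : I -> R) N : (forall A, \sum_(i <- A) `|g i| <= N) ->
    exists s : R, forall e : R, 0 < e -> exists A, forall B, (A `<=` B)%fset ->
      `|\sum_(i <- B) g i - s| <= e.
  move=> gN.
  have pos_case (u : I -> R) P : (forall i, 0 <= u i) ->
      (forall A, \sum_(i <- A) u i <= P) ->
      exists s : R, forall e : R, 0 < e -> exists A, forall B, (A `<=` B)%fset ->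
        `|\sum_(i <- B) u i - s| <= e.
    move=> u0 uP; pose S := [set \sum_(i <- A) u i | A in [set: {fset I}]].
    have supS : has_sup S.
      split; first by exists (\sum_(i <- fset0) u i), fset0.
      by exists P => _ [A _ <-]; exact: uP.
    exists (sup S) => e e0.
    have [_ [A _ <-] ltA] := sup_adherent e0 supS.
    exists A => B AB; have leB : \sum_(i <- B) u i <= sup S.
      by apply: ub_le_sup; [case: supS | exists B].
    by have := le_fset_sum AB u0; rewrite ler_norml; lra.
  have [||s hs] := pos_case (fun i => `|g i| + g i) (N + N).
  - by move=> i; have := ler_norm (- g i); rewrite normrN; lra.
  - move=> A; rewrite big_split /=; apply: lerD; first exact: gN.
    apply: le_trans (gN A); apply: ler_sum => i _; exact: ler_norm.
  have [||t ht] := pos_case (fun i => `|g i|) N => //.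
  exists (s - t) => e e0.
  have [A hA] := hs _ (divr_gt0 e0 (ltr0Sn R 1)).
  have [B hB] := ht _ (divr_gt0 e0 (ltr0Sn R 1)).
  exists ((A `|` B)%fset) => D; rewrite fsubUset => /andP[/hA + /hB].
  rewrite big_split /= !ler_norml; lra.
move=> fM.
have [|x hx] := real_case (fun i => complex.Re (f i)) M.
  by move=> A; apply: le_trans (fM A); apply: ler_sum => i _; exact: nc_Re.
have [|y hy] := real_case (fun i => complex.Im (f i)) M.
  by move=> A; apply: le_trans (fM A); apply: ler_sum => i _; exact: nc_Im.
exists (x +i* y) => e e0.
have [A hA] := hx _ (divr_gt0 e0 (ltr0Sn R 1)).
have [B hB] := hy _ (divr_gt0 e0 (ltr0Sn R 1)).
exists (A `|` B)%fset => D; rewrite fsubUset => /andP[/hA h1 /hB h2].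
apply: le_trans (nc_le_ReIm _) _; rewrite !raddfB !raddf_sum /=.
lra.
Qed.

Lemma usumP f M : abs_le f M -> has_sum f (usum f).
Proof. by move=> /abs_le_has_sum[s fs]; rewrite (usum_has_sum fs). Qed.

Lemma eq_usum f g : f =1 g -> usum f = usum g.
Proof. by move=> /funext ->. Qed.

Lemma has_sumD f g s t : has_sum f s -> has_sum g t ->
  has_sum (fun i => f i + g i) (s + t).
Proof.
move=> fs gt e e0.
have [A hA] := fs _ (divr_gt0 e0 (ltr0Sn R 1)).
have [B hB] := gt _ (divr_gt0 e0 (ltr0Sn R 1)).
exists ((A `|` B)%fset) => D; rewrite fsubUset => /andP[/hA h1 /hB h2].
rewrite big_split /= opprD addrACA; apply: le_trans (ncD _ _) _; lra.
Qed.

Lemma has_sumZ f s c : has_sum f s -> has_sum (fun i => c * f i) (c * s).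
Proof.
move=> fs e e0; have c1 : 0 < nc c + 1 by have := nc_ge0 c; lra.
have [A hA] := fs _ (divr_gt0 e0 c1).
exists A => B AB; rewrite -mulr_sumr -mulrBr ncM.
apply: le_trans (ler_wpM2l (nc_ge0 c) (hA B AB)) _.
by rewrite mulrA ler_pdivrMr // mulrC ler_wpM2l ?ltW //; lra.
Qed.

Lemma has_sum0 : has_sum (fun _ : I => 0 : R[i]) 0.
Proof. by move=> e e0; exists fset0 => B _; rewrite big1 // subr0 nc0 ltW. Qed.

Lemma has_sum_sum (J : Type) (r : seq J) (f : J -> I -> R[i]) (s : J -> R[i]) :
  (forall j, has_sum (f j) (s j)) ->
  has_sum (fun i => \sum_(j <- r) f j i) (\sum_(j <- r) s j).
Proof.
move=> fs; elim: r => [|j r IH].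
  by rewrite big_nil; under eq_fun do rewrite big_nil; exact: has_sum0.
by rewrite big_cons; under eq_fun do rewrite big_cons; exact: has_sumD.
Qed.

Lemma has_sum_finite f A : (forall i, i \notin A -> f i = 0) ->
  has_sum f (\sum_(i <- A) f i).
Proof.
move=> f0 e e0; exists A => B AB; rewrite (fsetU_sum f AB) addrAC subrr add0r.
rewrite big_seq big1 ?nc0 ?ltW // => i; rewrite inE => /andP[iA _]; exact: f0.
Qed.

Lemma has_sum1 f i : (forall j, j != i -> f j = 0) -> has_sum f (f i).
Proof.
move=> f0; have := @has_sum_finite f [fset i]; rewrite big_seq_fset1; apply.
by move=> j; rewrite inE; exact: f0.
Qed.

Lemma has_sum_le f s M : has_sum f s -> abs_le f M -> nc s <= M.
Proof.
move=> fs fM; apply/ler_addgt0Pr => e e0; have [A /(_ A (fsubset_refl A)) hA] := fs e e0.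
have -> : s = \sum_(i <- A) f i - (\sum_(i <- A) f i - s) by ring.
apply: le_trans (ncD _ _) _; rewrite ncN; apply: lerD => //.
exact: le_trans (nc_sum _ _ _) (fM A).
Qed.

Lemma usum_le f M : abs_le f M -> nc (usum f) <= M.
Proof. by move=> fM; exact: has_sum_le (usumP fM) fM. Qed.

Lemma has_sum_ge0 f s : has_sum f s -> (forall i, 0 <= f i) -> 0 <= s.
Proof.
move=> fs f0.
have S0 A : 0 <= \sum_(i <- A) f i by rewrite sumr_ge0.
rewrite lecE /=; apply/andP; split.
  suff : `|complex.Im s| <= 0 by rewrite normr_le0.
  apply/ler_addgt0Pr => e e0; rewrite add0r.
  have [A /(_ A (fsubset_refl A)) hA] := fs e e0.
  have := le_trans (nc_Im _) hA; rewrite raddfB /=.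
  have := S0 A; rewrite lecE /= => /andP[/eqP -> _].
  by rewrite sub0r normrN.
apply/ler_addgt0Pr => e e0.
have [A /(_ A (fsubset_refl A)) hA] := fs e e0.
have := le_trans (nc_Re _) hA; rewrite raddfB /= ler_norml.
have := S0 A; rewrite lecE /= => /andP[_]; lra.
Qed.

Lemma has_sum_ge_term f s i : has_sum f s -> (forall i, 0 <= f i) -> f i <= s.
Proof.
move=> fs f0; rewrite -subr_ge0.
have h : has_sum (fun j => f j + (-1) * (if j == i then f i else 0)) (s + (-1) * f i).
  apply: has_sumD => //; apply: has_sumZ.
  have := @has_sum1 (fun j => if j == i then f i else 0) i; rewrite eqxx; apply.
  by move=> j /negPf ->.
rewrite -mulN1r; apply: has_sum_ge0 h _ => j.
by rewrite mulN1r; case: eqP => [->|_]; rewrite ?subrr // subr0.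
Qed.

Lemma abs_leM f g M c : (forall i, nc (g i) <= c * nc (f i)) -> 0 <= c ->
  abs_le f M -> abs_le g (c * M).
Proof.
move=> gf c0 fM A; apply: le_trans (ler_sum _ (fun i _ => gf i)) _.
by rewrite -mulr_sumr ler_wpM2l.
Qed.

Lemma abs_leZ f M c : abs_le f M -> abs_le (fun i => c * f i) (nc c * M).
Proof. by move=> fM; apply: (abs_leM _ (nc_ge0 c) fM) => i; rewrite ncM. Qed.

Lemma abs_leD f g M N : abs_le f M -> abs_le g N ->
  abs_le (fun i => f i + g i) (M + N).
Proof.
move=> fM gN A; apply: le_trans (lerD (fM A) (gN A)).
by rewrite -big_split; apply: ler_sum => i _; exact: ncD.
Qed.

Lemma usumD f g M N : abs_le f M -> abs_le g N ->
  usum (fun i => f i + g i) = usum f + usum g.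
Proof. by move=> /usumP fs /usumP gs; exact: usum_has_sum (has_sumD fs gs). Qed.

Lemma usumZ f M c : abs_le f M -> usum (fun i => c * f i) = c * usum f.
Proof. by move=> /usumP fs; exact: usum_has_sum (has_sumZ c fs). Qed.

Lemma usum0 : usum (fun _ : I => 0 : R[i]) = 0.
Proof. exact: usum_has_sum has_sum0. Qed.

Lemma usum1 f i : (forall j, j != i -> f j = 0) -> usum f = f i.
Proof. by move=> f0; exact: usum_has_sum (has_sum1 f0). Qed.

Lemma abs_le_bounded_mul f g M c : abs_le f M -> 0 <= c ->
  (forall i, nc (g i) <= c) -> abs_le (fun i => f i * g i) (c * M).
Proof.
move=> fM c0 gc; apply: (abs_leM _ c0 fM) => i.
by rewrite ncM mulrC ler_wpM2r ?nc_ge0.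
Qed.

End OneIndex.

Lemma has_sum_reindex (I J : choiceType) (p : J -> I) (q : I -> J)
    (f : I -> R[i]) s :
  cancel p q -> cancel q p -> has_sum f s -> has_sum (fun j => f (p j)) s.
Proof.
move=> pK qK fs e e0; have [A hA] := fs e e0.
exists (q @` A)%fset => B AB.
have pinj : {in B &, injective p} by move=> x y _ _; exact: (can_inj pK).
have := hA (p @` B)%fset; rewrite big_imfset //=; apply.
apply/fsubsetP => i iA; apply/imfsetP; exists (q i); rewrite ?qK //=.
by apply: (fsubsetP AB); apply/imfsetP; exists i.
Qed.

Lemma abs_le_inj (I J : choiceType) (p : J -> I) (f : I -> R[i]) M :
  injective p -> abs_le f M -> abs_le (fun j => f (p j)) M.
Proof.
move=> pinj fM A; have := fM (p @` A)%fset; rewrite big_imfset //= => x y _ _; exact: pinj.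
Qed.

Lemma usum_reindex (I J : choiceType) (p : J -> I) (q : I -> J)
    (f : I -> R[i]) M :
  cancel p q -> cancel q p -> abs_le f M -> usum f = usum (fun j => f (p j)).
Proof.
move=> pK qK /usumP fs; exact/esym/usum_has_sum/(has_sum_reindex pK qK fs).
Qed.

Section TwoIndices.
Variables I J : choiceType.
Implicit Types (f : I -> J -> R[i]) (M : R).

Definition abs_le2 f M := abs_le (fun p : I * J => f p.1 p.2) M.

Lemma sum_fsetX (V : zmodType) (g : I -> J -> V) (A : {fset I}) (B : {fset J}) :
  \sum_(p <- (A `*` B)%fset) g p.1 p.2 = \sum_(i <- A) \sum_(j <- B) g i j.
Proof.
have -> : \sum_(i <- A) \sum_(j <- B) g i j =
    \sum_(p <- [seq (i, j) | i <- A, j <- B]) g p.1 p.2 by rewrite big_allpairs.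
apply/perm_big/uniq_perm; first exact: fset_uniq.
  by rewrite allpairs_uniq ?fset_uniq // => -[i j] [i' j'].
move=> [i j]; rewrite in_fsetM /=; apply/idP/idP.
  by move=> /andP[iA jB]; apply/allpairsP; exists (i, j).
by move=> /allpairsP[[i' j'] /= [iA jB [-> ->]]]; rewrite iA.
Qed.

Lemma sub_fsetX (D : {fset I * J}) :
  (D `<=` (fst @` D) `*` (snd @` D))%fset.
Proof.
apply/fsubsetP => -[i j] D_ij; rewrite in_fsetM /=; apply/andP.
by split; apply/imfsetP; exists (i, j).
Qed.

Lemma abs_le2_bound f (m : I -> R) M : (forall i, abs_le (f i) (m i)) ->
  (forall A : {fset I}, \sum_(i <- A) m i <= M) -> abs_le2 f M.
Proof.
move=> fm mM D; apply: le_trans (le_fset_sum (sub_fsetX D) (fun p => nc_ge0 _)) _.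
rewrite (sum_fsetX (fun i j => nc (f i j))); apply: le_trans (mM _).
by apply: ler_sum => i _; exact: fm.
Qed.

Lemma abs_le2_row f M i : abs_le2 f M -> abs_le (f i) M.
Proof. by move=> fM; apply: (abs_le_inj (p := pair i)) fM => j j' []. Qed.

(** For a finite set [A] of rows, one finite [B] brings all row sums within an equal share of [e],
    and the bound on the rectangle of [A] and [B] applies. The [+ 1] in the share covers an empty
    [A]. *)
Lemma abs_le2_usum f M : abs_le2 f M -> abs_le (fun i => usum (f i)) M.
Proof.
move=> fM A; apply/ler_addgt0Pr => e e0.
have c0 : 0 < #|` A|%:R + 1 :> R by rewrite ltr_wpDl.
have [B hB] : exists B : {fset J}, forall i, i \in A ->
    nc (usum (f i)) <= \sum_(j <- B) nc (f i j) + e / (#|` A|%:R + 1).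
  have : forall i, exists B : {fset J}, forall B' : {fset J}, (B `<=` B')%fset ->
      nc (usum (f i)) <= \sum_(j <- B') nc (f i j) + e / (#|` A|%:R + 1).
    move=> i; have [B hB] := usumP (abs_le2_row i fM) (divr_gt0 e0 c0).
    exists B => B' /hB h; have -> : usum (f i) =
        \sum_(j <- B') f i j - (\sum_(j <- B') f i j - usum (f i)) by ring.
    apply: le_trans (ncD _ _) _; rewrite ncN; apply: lerD => //; exact: nc_sum.
  move=> /choice[b hb]; exists (\bigcup_(i <- A) b i)%fset => i iA; apply: hb.
  exact: bigfcup_sup.
apply: (@le_trans _ _ (\sum_(i <- A) (\sum_(j <- B) nc (f i j) + e / (#|` A|%:R + 1)))).
  by rewrite big_seq [leRHS]big_seq; apply: ler_sum => i /hB.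
rewrite big_split /= -(sum_fsetX (fun i j => nc (f i j))); apply: lerD; first exact: fM.
rewrite big_const_seq count_predT iter_addr_0.
by rewrite -[leLHS]mulr_natl mulrA ler_pdivrMr // mulrC ler_pM2l // lerDl.
Qed.

(** A rectangle over [B], wide enough both to contain [A] and to approximate the rows of [B], has a
    sum close to [s] and to the sum of [g] over [B]. *)
Lemma has_sum_fubini f s (g : I -> R[i]) :
  has_sum (fun p : I * J => f p.1 p.2) s ->
  (forall i, has_sum (f i) (g i)) -> has_sum g s.
Proof.
move=> fs fg e e0.
have [A hA] := fs _ (divr_gt0 e0 (ltr0Sn R 1)).
exists (fst @` A)%fset => B AB.
have [C hC] := has_sum_sum B fg (divr_gt0 e0 (ltr0Sn R 1)).
have := hC _ (fsubsetUl C (snd @` A)%fset).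
rewrite exchange_big -(sum_fsetX f) => h1.
have := hA (B `*` (C `|` snd @` A))%fset; set x := \sum_(i <- _) _ in h1 *.
have sub : (A `<=` (B `*` (C `|` snd @` A)))%fset.
  apply: fsubset_trans (sub_fsetX A) _; apply/fsubsetP => -[i j].
  rewrite !in_fsetM /= inE => /andP[/(fsubsetP AB) -> ->]; exact: orbT.
move=> /(_ sub) h2.
have -> : \sum_(i <- B) g i - s = (x - s) - (x - \sum_(i <- B) g i) by ring.
by apply: le_trans (ncD _ _) _; rewrite ncN; lra.
Qed.

End TwoIndices.

Lemma abs_le2_swap (I J : choiceType) (f : I -> J -> R[i]) M :
  abs_le2 f M -> abs_le2 (fun j i => f i j) M.
Proof.
move=> fM; apply: (abs_le_inj (p := fun q : J * I => (q.2, q.1))) fM.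
by move=> [i j] [i' j'] [-> ->].
Qed.

Lemma usum_pair (I J : choiceType) (f : I -> J -> R[i]) M : abs_le2 f M ->
  usum (fun p : I * J => f p.1 p.2) = usum (fun i => usum (f i)).
Proof.
move=> fM; apply/esym/usum_has_sum/(has_sum_fubini (f := f)).
  exact: usumP fM.
by move=> i; apply: usumP (abs_le2_row i fM).
Qed.

Lemma usum_exchange (I J : choiceType) (f : I -> J -> R[i]) M : abs_le2 f M ->
  usum (fun i => usum (f i)) = usum (fun j => usum (fun i => f i j)).
Proof.
move=> fM; rewrite -(usum_pair fM) -(usum_pair (abs_le2_swap fM)).
by apply: (usum_reindex (p := fun q : J * I => (q.2, q.1)) (q := fun q => (q.2, q.1)) _ _ fM) => -[].
Qed.

Lemma has_sum_fin (I : finType) (f : I -> R[i]) : has_sum f (\sum_i f i).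
Proof.
have := @has_sum_finite _ f [fset i | i in I]%fset.
rewrite big_imfset //= -big_enum /=; apply => i /imfsetP[].
by exists i.
Qed.

Lemma usum_fin (I : finType) (f : I -> R[i]) : usum f = \sum_i f i.
Proof. exact/usum_has_sum/has_sum_fin. Qed.

Lemma has_sum_series (f : nat -> R[i]) s : has_sum f s ->
  lim ((fun n => \sum_(0 <= i < n) f i : R[i]^o) @ \oo) = s.
Proof.
move=> fs; apply: (@cvg_lim R[i]^o); first exact: norm_hausdorff.
apply/cvgrPdist_le => /= e e0.
have er : e = (complex.Re e)%:C by rewrite RRe_real // gtr0_real.
have [|A hA] := fs (complex.Re e); first by rewrite -ltcR -er.
exists (\max_(n <- A) n).+1 => // n /= le_n.
rewrite -ncE er lecR ncB; have := hA [fset nat_of_ord i | i in 'I_n]%fset.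
rewrite big_imfset /=; last by move=> i j _ _ /val_inj.
rewrite big_enum /= big_mkord; apply; apply/fsubsetP => m mA; apply/imfsetP.
have lt_mn : (m < n)%N by apply: leq_trans le_n; rewrite ltnS; apply: leq_bigmax_seq.
by exists (Ordinal lt_mn).
Qed.

(** Transfers unconditional sums to the extended real sums in which [position_norm2] is
    expressed. *)
Lemma esum_has_sum (I : choiceType) (f : I -> R) s : (forall i, 0 <= f i) ->
  has_sum (fun i => (f i)%:C) s%:C -> (\esum_(i in [set: I]) (f i)%:E)%E = s%:E.
Proof.
move=> f0 fs.
have le_s (A : {fset I}) : \sum_(i <- A) f i <= s.
  apply/ler_addgt0Pr => e /fs[B /(_ (A `|` B)%fset (fsubsetUr A B))].
  rewrite -rmorph_sum -rmorphB nc_real ler_norml => /andP[_ h].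
  have := le_fset_sum (fsubsetUl A B) f0; lra.
apply/eqP; rewrite eq_le; apply/andP; split.
  apply: ge_ereal_sup => _ [A [finA _] <-].
  by rewrite fsbig_finite //= sumEFin lee_fin.
apply/lee_addgt0Pr => e /fs[A /(_ A (fsubset_refl A))].
rewrite -rmorph_sum -rmorphB nc_real ler_norml => /andP[h _].
apply: (@le_trans _ _ ((\sum_(i <- A) f i)%:E + e%:E)%E).
  by rewrite -EFinD lee_fin; move: h; set S := \sum_(i <- A) f i; lra.
apply: leeD => //; apply: ereal_sup_ubound; exists [set` A] => //.
by rewrite fsbig_finite //= set_fsetK sumEFin.
Qed.

Lemma le_esum_fset (I : choiceType) (f : I -> R) (A : {fset I}) :
  ((\sum_(i <- A) f i)%:E <= \esum_(i in [set: I]) (f i)%:E)%E.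
Proof.
apply: ereal_sup_ubound; exists [set` A] => //.
by rewrite fsbig_finite //= set_fsetK sumEFin.
Qed.

End Sums.

(** * Kernels and their exponentials *)

Section Operations.
Variable R : realType.

Definition kmul (Y Z : Type) (X : choiceType) (A : Y -> X -> R[i])
  (B : X -> Z -> R[i]) (v : Y) (w : Z) : R[i] := usum (fun u => A v u * B u w).

Definition kid (X : choiceType) (v w : X) : R[i] := (v == w)%:R.

End Operations.

Fixpoint kpow (R : realType) (X : choiceType) (h : X -> X -> R[i]) n : X -> X -> R[i] :=
  if n is n'.+1 then kmul h (kpow h n') else @kid R X.

Definition ecoef (R : realType) (t : R) (n : nat) : R[i] := (0 -i* t) ^+ n / n`!%:R.

HB.lock Definition kexp (R : realType) (X : choiceType) (h : X -> X -> R[i]) (t : R)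
  (v w : X) : R[i] := usum (fun n => ecoef t n * kpow h n v w).

Section Kernels.
Variable R : realType.
Implicit Types (a b c M N : R).

(** Only the scaled family is assumed summable: when [c] is zero nothing is known about [f], but
    both sides vanish. *)
Lemma usumZ_abs (I : choiceType) (f : I -> R[i]) (c : R[i]) M :
  abs_le (fun i => c * f i) M -> usum (fun i => c * f i) = c * usum f.
Proof.
have [->|c0] := eqVneq c 0.
  move=> _; rewrite mul0r; under eq_fun do rewrite mul0r; exact: usum0.
move=> cfM; apply: (@usumZ _ _ _ (nc c^-1 * M)).
by have := abs_leZ c^-1 cfM; under eq_fun do rewrite mulrA mulVf // mul1r.
Qed.

Definition krow (Y : Type) (X : choiceType) (A : Y -> X -> R[i]) M :=
  forall v, abs_le (A v) M.

Definition kcol (X : choiceType) (Z : Type) (A : X -> Z -> R[i]) M :=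
  forall w, abs_le (A^~ w) M.

Definition kbd (Y Z : Type) (A : Y -> Z -> R[i]) c :=
  forall v w, nc (A v w) <= c.

Definition ktr (Y Z : Type) (A : Y -> Z -> R[i]) : Z -> Y -> R[i] :=
  fun v w => A w v.

Definition ksym (X : Type) (A : X -> X -> R[i]) := forall v w, A v w = A w v.

Lemma krow_bd (Y : Type) (X : choiceType) (A : Y -> X -> R[i]) M :
  krow A M -> kbd A M.
Proof. by move=> AM v w; have := AM v [fset w]%fset; rewrite big_seq_fset1. Qed.

Lemma ksym_col (X : choiceType) (A : X -> X -> R[i]) M :
  ksym A -> krow A M -> kcol A M.
Proof. by move=> symA AM w F; under eq_bigr do rewrite symA; exact: AM. Qed.

(** * Products of kernels and their associativity *)

Section Products.
Variables (Y Z : Type) (X : choiceType).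

Lemma kmul_summable (A : Y -> X -> R[i]) (B : X -> Z -> R[i]) a b v w :
  krow A a -> 0 <= b -> kbd B b -> abs_le (fun u => A v u * B u w) (b * a).
Proof. by move=> Aa b0 Bb; apply: abs_le_bounded_mul. Qed.

Lemma kmul_summable_col (A : Y -> X -> R[i]) (B : X -> Z -> R[i]) a b v w :
  0 <= a -> kbd A a -> kcol B b -> abs_le (fun u => A v u * B u w) (a * b).
Proof.
move=> a0 Aa Bb; have := abs_le_bounded_mul (Bb w) a0 (Aa v).
by under eq_fun do rewrite mulrC.
Qed.

Lemma kmul_bd (A : Y -> X -> R[i]) (B : X -> Z -> R[i]) a b :
  krow A a -> 0 <= b -> kbd B b -> kbd (kmul A B) (b * a).
Proof. by move=> Aa b0 Bb v w; apply: usum_le; apply: kmul_summable. Qed.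

Lemma kmul_tr (A : Y -> X -> R[i]) (B : X -> Z -> R[i]) :
  kmul (ktr B) (ktr A) = ktr (kmul A B).
Proof.
by apply/funext => v; apply/funext => w; apply: eq_usum => u; rewrite mulrC.
Qed.

Lemma kmulDr (A : Y -> X -> R[i]) (B C : X -> Z -> R[i]) a b c :
  krow A a -> 0 <= b -> kbd B b -> 0 <= c -> kbd C c ->
  kmul A (fun u w => B u w + C u w) = fun v w => kmul A B v w + kmul A C v w.
Proof.
move=> Aa b0 Bb c0 Cc; apply/funext => v; apply/funext => w.
rewrite -(usumD (kmul_summable v w Aa b0 Bb) (kmul_summable v w Aa c0 Cc)).
by apply: eq_usum => u; rewrite mulrDr.
Qed.

End Products.

Section Associativity.
Variables (Y Z : Type) (X X' : choiceType).

Lemma kmul_assoc_at (A : Y -> X -> R[i]) (B : X -> X' -> R[i])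
    (C : X' -> Z -> R[i]) M v w :
  abs_le2 (fun u u' => A v u * B u u' * C u' w) M ->
  kmul A (kmul B C) v w = kmul (kmul A B) C v w.
Proof.
move=> abcM; transitivity (usum (fun u => usum (fun u' => A v u * B u u' * C u' w))).
  apply: eq_usum => u; rewrite -(usumZ_abs (M := M)).
    by apply: eq_usum => u'; rewrite mulrA.
  by have := abs_le2_row u abcM; under eq_fun do rewrite -mulrA.
rewrite (usum_exchange abcM); apply: eq_usum => u'; rewrite mulrC -(usumZ_abs (M := M)).
  by apply: eq_usum => u; rewrite mulrC.
by have := abs_le2_row u' (abs_le2_swap abcM); under eq_fun do rewrite mulrC.
Qed.

(** The triple sum converges absolutely because the outer factors are summable towards the middle
    one, which may then be merely bounded. This is the case of a derivation between two
    exponentials. *)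
Lemma kmul_assoc_rbc (A : Y -> X -> R[i]) (B : X -> X' -> R[i])
    (C : X' -> Z -> R[i]) a b c :
  krow A a -> 0 <= b -> kbd B b -> kcol C c ->
  kmul A (kmul B C) = kmul (kmul A B) C.
Proof.
move=> Aa b0 Bb Cc; apply/funext => v; apply/funext => w.
apply: (@kmul_assoc_at _ _ _ (a * (b * c))).
have c0 : 0 <= c := abs_le_ge0 (Cc w).
apply: (@abs_le2_bound _ _ _ _ (fun u => nc (A v u) * (b * c))).
  move=> u; rewrite mulrA; apply: (@abs_leM _ _ (C^~ w)) (Cc w) => [u'|].
    by rewrite !ncM ler_wpM2r ?nc_ge0 // ler_wpM2l ?nc_ge0.
  by rewrite mulr_ge0 ?nc_ge0.
move=> F; rewrite -mulr_suml ler_wpM2r ?mulr_ge0 //; exact: Aa.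
Qed.

Lemma kmul_assoc_rrb (A : Y -> X -> R[i]) (B : X -> X' -> R[i])
    (C : X' -> Z -> R[i]) a b c :
  krow A a -> 0 <= b -> krow B b -> 0 <= c -> kbd C c ->
  kmul A (kmul B C) = kmul (kmul A B) C.
Proof.
move=> Aa b0 Bb c0 Cc; apply/funext => v; apply/funext => w.
apply: (@kmul_assoc_at _ _ _ (a * (c * b))).
apply: (@abs_le2_bound _ _ _ _ (fun u => nc (A v u) * (c * b))).
  move=> u; have := abs_leZ (A v u) (kmul_summable u w Bb c0 Cc).
  by under eq_fun do rewrite mulrA.
by move=> F; rewrite -mulr_suml ler_wpM2r ?mulr_ge0 //; exact: Aa.
Qed.

End Associativity.

Lemma krow_kmul (Y : Type) (X Z : choiceType) (A : Y -> X -> R[i])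
    (B : X -> Z -> R[i]) a b :
  krow A a -> 0 <= b -> krow B b -> krow (kmul A B) (a * b).
Proof.
move=> Aa b0 Bb v; apply: (abs_le2_usum (f := fun w u => A v u * B u w)).
apply: abs_le2_swap; apply: (@abs_le2_bound _ _ _ _ (fun u => nc (A v u) * b)).
  by move=> u; apply: abs_leZ.
by move=> F; rewrite -mulr_suml ler_wpM2r //; exact: Aa.
Qed.

Lemma kmul1l (X : choiceType) (Z : Type) (B : X -> Z -> R[i]) : kmul (@kid R X) B = B.
Proof.
apply/funext => v; apply/funext => w; rewrite /kmul (@usum1 _ _ _ v).
  by rewrite /kid eqxx mul1r.
by move=> u; rewrite eq_sym /kid => /negPf ->; rewrite mul0r.
Qed.

Lemma kmul1r (X : choiceType) (Y : Type) (B : Y -> X -> R[i]) : kmul B (@kid R X) = B.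
Proof.
apply/funext => v; apply/funext => w; rewrite /kmul (@usum1 _ _ _ w).
  by rewrite /kid eqxx mulr1.
by move=> u; rewrite /kid => /negPf ->; rewrite mulr0.
Qed.

Lemma krow_kid (X : choiceType) : krow (@kid R X) 1.
Proof.
move=> v F; have [vF|vF] := boolP (v \in F).
  rewrite (big_fsetD1 v) //= /kid eqxx nc1 big_seq big1 ?addr0 //.
  by move=> u; rewrite !inE eq_sym => /andP[/negPf -> _]; rewrite nc0.
rewrite big_seq big1 // => u uF; rewrite /kid; case: eqP => [e|_]; last by rewrite nc0.
by rewrite e uF in vF.
Qed.

Lemma sum_exp_le (x : R) (F : {fset nat}) : 0 <= x ->
  \sum_(n <- F) x ^+ n / n`!%:R <= expR x.
Proof.
move=> x0; pose K := (\max_(n <- F) n).+1.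
have sub : (F `<=` [fset nat_of_ord i | i in 'I_K])%fset.
  apply/fsubsetP => n nF; apply/imfsetP.
  have lt_nK : (n < K)%N by rewrite ltnS; apply: leq_bigmax_seq.
  by exists (Ordinal lt_nK).
apply: le_trans (le_fset_sum sub _) _.
  by move=> n; rewrite mulr_ge0 ?invr_ge0 ?exprn_ge0.
rewrite big_imfset /=; last by move=> i j _ _; exact: val_inj.
rewrite big_enum /= (_ : \sum_(i in 'I_K) _ = series (exp_coeff x) K); last first.
  by rewrite /series /= big_mkord.
apply: nondecreasing_cvgn_le; last exact: is_cvg_series_exp_coeff.
apply: nondecreasing_series => n _ _; exact: exp_coeff_ge0.
Qed.

(** * Powers and exponential of a kernel with summable rows *)

Section Powers.
Variables (X : choiceType) (h : X -> X -> R[i]) (M : R).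
Hypotheses (h_row : krow h M) (M_ge0 : 0 <= M) (h_sym : ksym h).
Local Notation kpow := (kpow h).
Local Notation kexp := (kexp h).

Lemma krow_kpow n : krow (kpow n) (M ^+ n).
Proof.
elim: n => [|n IH]; first exact: krow_kid.
by rewrite exprS; apply: krow_kmul; rewrite ?exprn_ge0.
Qed.

Lemma kmul_kpow m n : kmul (kpow m) (kpow n) = kpow (m + n).
Proof.
elim: m => [|m IH]; first by rewrite kmul1l.
rewrite /= -IH; apply/esym/(kmul_assoc_rrb h_row _ (krow_kpow m)).
- by rewrite exprn_ge0.
- exact: (exprn_ge0 n M_ge0).
- exact/krow_bd/krow_kpow.
Qed.

Lemma kpow_sym n : ksym (kpow n).
Proof.
suff : ktr (kpow n) = kpow n by move=> e v w; rewrite -{1}e.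
have htr : ktr h = h by apply/funext => v; apply/funext => w; exact: h_sym.
elim: n => [|n IH].
  by apply/funext => v; apply/funext => w; rewrite /ktr /= /kid eq_sym.
rewrite [RHS](_ : _ = kmul (kpow n) (kpow 1)); last by rewrite kmul_kpow addn1.
have -> : kpow 1 = h by exact: kmul1r.
by rewrite -[X in kmul X _]IH -[X in kmul _ X]htr kmul_tr.
Qed.

Lemma nc_ecoef (t : R) n : nc (ecoef t n) = `|t| ^+ n / n`!%:R.
Proof.
rewrite /ecoef ncM ncX nc_inv nc_nat; congr (_ ^+ _ / _).
by rewrite /= expr0n add0r sqrrN sqrtr_sqr.
Qed.

Lemma kexpE t v w : kexp t v w = usum (fun n => ecoef t n * kpow n v w).
Proof. by rewrite kexp.unlock. Qed.

Lemma ecoefD (s t : R) n :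
  ecoef (s + t) n = \sum_(i < n.+1) ecoef s (n - i) * ecoef t i.
Proof.
rewrite /ecoef (_ : 0 -i* (s + t) = (0 -i* s) + (0 -i* t)); last first.
  by apply/eqP; rewrite eq_complex /= addr0 opprD !eqxx.
rewrite exprDn mulr_suml; apply: eq_bigr => i _.
have le_in : (i <= n)%N by rewrite -ltnS.
have fne k : k`!%:R != 0 :> R[i] by rewrite pnatr_eq0 -lt0n fact_gt0.
rewrite -mulr_natr -(bin_fact le_in) !natrM !invfM.
have bne : 'C(n, i)%:R != 0 :> R[i] by rewrite pnatr_eq0 -lt0n bin_gt0.
by field; rewrite !fne bne.
Qed.

Definition kexpM (t : R) := expR (`|t| * M).

Lemma kexpM_ge0 t : 0 <= kexpM t.
Proof. exact: expR_ge0. Qed.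

Lemma ecoef_le t (F : {fset nat}) :
  \sum_(n <- F) nc (ecoef t n) * M ^+ n <= kexpM t.
Proof.
rewrite (eq_bigr (fun n => (`|t| * M) ^+ n / n`!%:R)); last first.
  by move=> n _; rewrite nc_ecoef exprMn mulrAC.
by apply: sum_exp_le; rewrite mulr_ge0.
Qed.

Lemma kexp_row2 t v : abs_le2 (fun n w => ecoef t n * kpow n v w) (kexpM t).
Proof.
apply: (@abs_le2_bound _ _ _ _ (fun n => nc (ecoef t n) * M ^+ n)); last exact: ecoef_le.
by move=> n; apply: abs_leZ; exact: krow_kpow.
Qed.

Lemma kexp_summable t v w : abs_le (fun n => ecoef t n * kpow n v w) (kexpM t).
Proof. exact: (abs_le2_row w (abs_le2_swap (kexp_row2 t v))). Qed.

Lemma krow_kexp t : krow (kexp t) (kexpM t).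
Proof.
move=> v; have := abs_le2_usum (abs_le2_swap (kexp_row2 t v)).
by congr abs_le; apply/funext => w; rewrite kexpE.
Qed.

Lemma kexp_sym t : ksym (kexp t).
Proof. by move=> v w; rewrite !kexpE; apply: eq_usum => n; rewrite kpow_sym. Qed.

Lemma kexp0 : kexp 0 = @kid R X.
Proof.
apply/funext => v; apply/funext => w; rewrite kexpE (@usum1 _ _ _ 0%N).
  by rewrite /ecoef expr0 fact0 divr1 mul1r.
move=> n n0; have -> : ecoef (0 : R) n = 0.
  apply/eqP; rewrite -eq0_nc nc_ecoef normr0 expr0n (negPf n0) mul0r //.
by rewrite mul0r.
Qed.

Lemma kexp_kpow t m v w :
  kmul (kexp t) (kpow m) v w = usum (fun n => ecoef t n * kpow (n + m) v w).
Proof.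
have sumM : abs_le2 (fun n u => ecoef t n * kpow n v u * kpow m u w) (kexpM t * M ^+ m).
  apply: (@abs_le2_bound _ _ _ _ (fun n => nc (ecoef t n) * M ^+ n * M ^+ m)).
    move=> n; rewrite -mulrA; under eq_fun do rewrite -mulrA.
    apply: abs_leZ; rewrite mulrC; apply: kmul_summable; first exact: krow_kpow.
      by rewrite exprn_ge0.
    exact/krow_bd/krow_kpow.
  by move=> F; rewrite -mulr_suml ler_wpM2r ?exprn_ge0 //; exact: ecoef_le.
transitivity (usum (fun u => usum (fun n => ecoef t n * kpow n v u * kpow m u w))).
  apply: eq_usum => u; rewrite kexpE mulrC -(usumZ_abs (M := kexpM t * M ^+ m)).
    by apply: eq_usum => n; rewrite mulrC.
  by have := abs_le2_row u (abs_le2_swap sumM); under eq_fun do rewrite mulrC.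
rewrite -(usum_exchange sumM); apply: eq_usum => n.
rewrite -kmul_kpow -(usumZ_abs (M := kexpM t * M ^+ m)).
  by apply: eq_usum => u; rewrite mulrA.
by have := abs_le2_row n sumM; under eq_fun do rewrite -mulrA.
Qed.

(** Cauchy product of the two series: the absolutely convergent double series over [(m, n)] is
    regrouped along the antidiagonals, where the binomial identity [ecoefD] applies. *)
Lemma kexpD s t : kmul (kexp s) (kexp t) = kexp (s + t).
Proof.
apply/funext => v; apply/funext => w.
have sum1 : abs_le2 (fun u m => kexp s v u * (ecoef t m * kpow m u w))
    (kexpM s * kexpM t).
  apply: (@abs_le2_bound _ _ _ _ (fun u => nc (kexp s v u) * kexpM t)).
    by move=> u; apply: abs_leZ; exact: kexp_summable.
  by move=> F; rewrite -mulr_suml ler_wpM2r ?kexpM_ge0 //; exact: krow_kexp.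
transitivity (usum (fun m => usum (fun n => ecoef s n * ecoef t m * kpow (n + m) v w))).
  transitivity (usum (fun u => usum (fun m => kexp s v u * (ecoef t m * kpow m u w)))).
    apply: eq_usum => u; rewrite (kexpE t) -(usumZ_abs (M := kexpM s * kexpM t)) //.
    exact: abs_le2_row sum1.
  rewrite (usum_exchange sum1); apply: eq_usum => m.
  transitivity (ecoef t m * kmul (kexp s) (kpow m) v w).
    have sums : abs_le (fun u => kexp s v u * kpow m u w) (M ^+ m * kexpM s).
      apply: kmul_summable; [exact: krow_kexp | by rewrite exprn_ge0 |].
      exact/krow_bd/krow_kpow.
    rewrite -(usumZ _ sums).
    by apply: eq_usum => u; rewrite mulrCA.
  rewrite kexp_kpow -(usumZ_abs (M := nc (ecoef t m) * (kexpM s * M ^+ m))).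
    by apply: eq_usum => n; rewrite mulrCA mulrA.
  apply: abs_leZ => F.
  apply: (@le_trans _ _ (\sum_(n <- F) nc (ecoef s n) * M ^+ n * M ^+ m)).
    apply: ler_sum => n _; rewrite ncM -mulrA -exprD ler_wpM2l ?nc_ge0 //.
    exact: (krow_bd (krow_kpow _)).
  by rewrite -mulr_suml ler_wpM2r ?exprn_ge0 //; exact: ecoef_le.
pose T (p : nat * nat) : R[i] := ecoef s p.2 * ecoef t p.1 * kpow (p.2 + p.1) v w.
(* Each pair is given a row with its single nonzero entry at [k = n + m]; regrouping then becomes an
   exchange of sums. *)
pose F (p : nat * nat) (k : nat) : R[i] := if k == (p.2 + p.1)%N then T p else 0.
have sumT : abs_le2 (fun m n => T (m, n)) (kexpM t * kexpM s).
  apply: (@abs_le2_bound _ _ _ _ (fun m => nc (ecoef t m) * M ^+ m * kexpM s)).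
    move=> m G; apply: (@le_trans _ _ (\sum_(n <- G)
        (nc (ecoef t m) * M ^+ m) * (nc (ecoef s n) * M ^+ n))).
      apply: ler_sum => n _; rewrite /T ncM ncM.
      have := krow_bd (krow_kpow (n + m)) v w; rewrite exprD => le1.
      apply: le_trans (ler_wpM2l _ le1) _; first by rewrite mulr_ge0 ?nc_ge0.
      by rewrite le_eqVlt; apply/orP; left; apply/eqP; ring.
    rewrite -mulr_sumr ler_wpM2l ?mulr_ge0 ?nc_ge0 ?exprn_ge0 //; exact: ecoef_le.
  by move=> G; rewrite -mulr_suml ler_wpM2r ?kexpM_ge0 //; exact: ecoef_le.
have sumF : abs_le2 F (kexpM t * kexpM s).
  apply: (@abs_le2_bound _ _ _ _ (fun p => nc (T p))).
    move=> p.
    have -> : F p = fun k => T p * kid R (p.2 + p.1)%N k.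
      by apply/funext => k; rewrite /F /kid eq_sym; case: eqP; rewrite ?mulr1 ?mulr0.
    rewrite -[nc (T p)]mulr1; exact/abs_leZ/krow_kid.
  exact: sumT.
transitivity (usum (fun p => usum (F p))).
  rewrite -(usum_pair sumT); apply: eq_usum => -[m n].
  by rewrite (@usum1 _ _ _ (n + m)%N) /F /= ?eqxx // => k /negPf ->.
rewrite (usum_exchange sumF) kexpE; apply: eq_usum => k.
rewrite ecoefD mulr_suml; apply: usum_has_sum.
have := @has_sum_finite _ _ (fun p => F p k)
  [fset (nat_of_ord i, (k - i)%N) | i in 'I_k.+1]%fset.
rewrite big_imfset /=; last by move=> i j _ _ [/val_inj].
rewrite big_enum /=.
rewrite (eq_bigr (fun i : 'I_k.+1 => ecoef s (k - i) * ecoef t i * kpow k v w)).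
  apply=> -[m n]; rewrite /F /=; case: eqP => // knm /imfsetP[].
  have lt_mk : (m < k.+1)%N by rewrite knm ltnS leq_addl.
  by exists (Ordinal lt_mk) => //=; rewrite knm addnK.
move=> i _; have le_ik : (i <= k)%N by rewrite -ltnS.
by rewrite /F /T /= (subnK le_ik) eqxx.
Qed.

Lemma kexpK t : kmul (kexp (- t)) (kexp t) = @kid R X.
Proof. by rewrite kexpD addNr kexp0. Qed.

End Powers.

Lemma has_sum_conj (I : choiceType) (f : I -> R[i]) s :
  has_sum f s -> has_sum (fun i => (f i)^*%C) s^*%C.
Proof.
move=> fs e /fs[A hA]; exists A => B /hA.
by rewrite -(nc_conj (_ - _)) rmorphB rmorph_sum.
Qed.

Lemma usum_conj (I : choiceType) (f : I -> R[i]) M : abs_le f M ->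
  usum (fun i => (f i)^*%C) = (usum f)^*%C.
Proof. by move=> /usumP/has_sum_conj/usum_has_sum. Qed.

Lemma kpow_real (X : choiceType) (h : X -> X -> R[i]) M n v w :
  krow h M -> 0 <= M -> (forall v w, (h v w)^*%C = h v w) ->
  (kpow h n v w)^*%C = kpow h n v w.
Proof.
move=> hM M0 hr; elim: n v => [|n IH] v /=; first by rewrite /kid rmorph_nat.
rewrite -(usum_conj (M := M ^+ n * M)).
  by apply: eq_usum => u; rewrite rmorphM /= hr IH.
apply: kmul_summable => //; first by rewrite exprn_ge0.
exact/krow_bd/krow_kpow.
Qed.

Lemma kexp_conj (X : choiceType) (h : X -> X -> R[i]) M t v w :
  krow h M -> 0 <= M -> (forall v w, (h v w)^*%C = h v w) ->
  (kexp h t v w)^*%C = kexp h (- t) v w.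
Proof.
move=> hM M0 hr; rewrite !kexpE -(usum_conj (kexp_summable hM M0 t v w)).
apply: eq_usum => n; rewrite rmorphM /= (kpow_real n v w hM M0 hr); congr (_ * _).
rewrite /ecoef rmorphM rmorphXn fmorphV rmorph_nat; congr (_ ^+ _ / _).
Qed.

End Kernels.

(** * The mean ergodic theorem *)

Section MeanErgodic.
(** The intended kernels carry no bundled Hilbert space: [E] selects the elements of finite norm,
    multiples are by natural numbers only, and the Hilbert geometry enters through the parallelogram
    inequality [Npar]. *)
Variables (R : realType) (V : zmodType) (E : V -> Prop) (N : V -> R) (U : V -> V).
Hypotheses (E0 : E 0) (ED : forall x y, E x -> E y -> E (x + y))
  (EN : forall x, E x -> E (- x)) (N_ge0 : forall x, 0 <= N x)
  (ND : forall x y, E x -> E y -> N (x + y) <= N x + N y)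
  (NN : forall x, N (- x) = N x)
  (NMn : forall x n, E x -> N (x *+ n) = n%:R * N x)
  (Npar : forall x y, E x -> E y ->
    N (x + y) ^+ 2 + N (x - y) ^+ 2 <= 2 * (N x ^+ 2 + N y ^+ 2))
  (EU : forall x, E x -> E (U x))
  (UD : forall x y, E x -> E y -> U (x + y) = U x + U y)
  (NU : forall x, E x -> N (U x) <= N x).
Variable f : V.
Hypothesis Ef : E f.

Let S n := \sum_(m < n) iter m U f.
Let T L x := \sum_(l < L) iter l U x.

Let EMn x n : E x -> E (x *+ n).
Proof. by move=> Ex; elim: n => [|n IH] //; rewrite mulrS; exact: ED. Qed.

Let Esum n (x : nat -> V) : (forall i, E (x i)) -> E (\sum_(i < n) x i).
Proof. by move=> Ex; elim/big_rec: _ => // i y _; exact: ED. Qed.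

Let Nsum n (x : nat -> V) : (forall i, E (x i)) ->
  N (\sum_(i < n) x i) <= \sum_(i < n) N (x i).
Proof.
move=> Ex; elim: n => [|n IH]; first by rewrite !big_ord0 -(mulr0n 0) NMn // mul0r.
rewrite !big_ord_recr /=; apply: le_trans (ND (Esum _ Ex) (Ex n)) _.
by rewrite lerD2r.
Qed.

Let NB x y : E x -> E y -> N (x - y) <= N x + N y.
Proof. by move=> Ex Ey; rewrite -(NN y); apply: ND => //; exact: EN. Qed.

Let U0 : U 0 = 0.
Proof. by have := UD E0 E0; rewrite addr0 => /eqP; rewrite -subr_eq0 opprD addrA subrr sub0r oppr_eq0 => /eqP. Qed.

Let Eiter p x : E x -> E (iter p U x).
Proof. by move=> Ex; elim: p => //= p; exact: EU. Qed.

Let Niter p x : E x -> N (iter p U x) <= N x.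
Proof. by move=> Ex; elim: p => //= p; apply: le_trans; exact/NU/Eiter. Qed.

Let iter_sum p n (x : nat -> V) : (forall i, E (x i)) ->
  iter p U (\sum_(i < n) x i) = \sum_(i < n) iter p U (x i).
Proof.
move=> Ex; elim: n => [|n IH].
  by rewrite !big_ord0; elim: p => //= p ->; exact: U0.
rewrite !big_ord_recr /= -IH; elim: p {IH} => //= p ->.
by rewrite UD //; exact: Eiter (Esum _ _) || exact: Eiter.
Qed.

Let ES n : E (S n).
Proof. by apply: (Esum n (x := fun m => iter m U f)) => i; exact: Eiter. Qed.

Let S_shift p n : iter p U (S n) = \sum_(m < n) iter (p + m) U f.
Proof.
rewrite (iter_sum p n (x := fun m => iter m U f)); last by move=> i; exact: Eiter.
by apply: eq_bigr => i _; rewrite iterD.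
Qed.

Let S_add p n : S (p + n) = S p + iter p U (S n).
Proof. by rewrite S_shift /S big_split_ord. Qed.

Let a n := N (S n).

Let a_add p n : a (p + n) <= a p + a n.
Proof.
rewrite /a S_add; apply: le_trans (ND (ES p) (Eiter _ (ES n))) _.
by rewrite lerD2l; exact: Niter.
Qed.

Let a0 : a 0 = 0.
Proof. by rewrite /a /S big_ord0 -(mulr0n 0) NMn // mul0r. Qed.

Let a_mul q p : a (q * p) <= q%:R * a p.
Proof.
elim: q => [|q IH]; first by rewrite mul0n a0 mul0r.
by rewrite mulSn; apply: le_trans (a_add _ _) _; rewrite mulrSr; lra.
Qed.

Let a_linear n : a n <= n%:R * N f.
Proof. by have := a_mul n 1; rewrite muln1 {2}/a /S big_ord1. Qed.

Let mu := inf [set a n.+1 / n.+1%:R | n in [set: nat]].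

Let has_inf_mu : has_inf [set a n.+1 / n.+1%:R | n in [set: nat]].
Proof.
split; first by exists (a 1 / 1), 0%N.
by exists 0 => _ [n _ <-]; rewrite divr_ge0 // N_ge0.
Qed.

Let mu_ge0 : 0 <= mu.
Proof.
apply: lb_le_inf; first by case: has_inf_mu.
by move=> _ [n _ <-]; rewrite divr_ge0 // N_ge0.
Qed.

Let mu_le n : n%:R * mu <= a n.
Proof.
case: n => [|n]; first by rewrite mul0r a0.
rewrite mulrC -ler_pdivlMr ?ltr0n //; apply: ge_inf; last by exists n.
by case: has_inf_mu.
Qed.

(** Fekete's argument: division of [n] by a period [p.+1] nearly attaining the infimum leaves a
    remainder of bounded cost, which [n0] absorbs into [e / 2] times [n]. *)
Let a_upper e : 0 < e -> exists n0, forall n, (n0 <= n)%N -> a n <= n%:R * (mu + e).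
Proof.
move=> e0; have e2 : 0 < e / 2 by rewrite divr_gt0.
have [_ [p _ <-]] := inf_adherent e2 has_inf_mu; rewrite -/mu.
rewrite ltr_pdivrMr ?ltr0n // => ap.
have [n0 hn0] : exists n0 : nat, p.+1%:R * N f <= n0%:R * (e / 2).
  exists (Num.truncn (p.+1%:R * N f / (e / 2))).+1.
  by rewrite -ler_pdivrMr // ltW // truncnS_gt.
exists n0 => n le_n0n.
rewrite (divn_eq n p.+1); set q := (n %/ _)%N; set r := (n %% _)%N.
have ltr : (r < p.+1)%N by rewrite ltn_pmod.
have h1 := a_add (q * p.+1) r; have h2 := a_mul q p.+1; have h3 := a_linear r.
have h4 : q%:R * a p.+1 <= q%:R * ((mu + e / 2) * p.+1%:R) by rewrite ler_wpM2l // ltW.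
have h5 : r%:R * N f <= p.+1%:R * N f by rewrite ler_wpM2r // ler_nat ltnW.
have h6 : n0%:R * (e / 2) <= (q * p.+1 + r)%:R * (e / 2).
  by rewrite ler_wpM2r ?ler_nat 1?ltW // -divn_eq.
have h7 : 0 <= r%:R * (mu + e / 2) by rewrite mulr_ge0 // addr_ge0 // ltW.
rewrite natrD natrM in h6 *; nra.
Qed.

Let NT L x : E x -> N (T L x) <= L%:R * N x.
Proof.
move=> Ex; apply: le_trans (Nsum L (x := fun l => iter l U x) _) _.
  by move=> i; exact: Eiter.
rewrite mulr_natl -[in leRHS](card_ord L) -sumr_const; apply: ler_sum => l _; exact: Niter.
Qed.

(** The common terms of the two Birkhoff sums cancel, leaving two boundary blocks of length [q]; the
    bound does not involve [L]. *)
Let shift_bound q L : N (iter q U (S L) - S L) <= q%:R * (2 * N f).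
Proof.
have -> : iter q U (S L) - S L = iter L U (S q) - S q.
  by apply/eqP; rewrite subr_eq addrAC eq_sym subr_eq -addrC -S_add addnC S_add addrC.
apply: le_trans (NB (Eiter _ (ES q)) (ES q)) _.
have := Niter L (ES q); have := a_linear q; rewrite /a; lra.
Qed.

(** Exchanging the two sums turns [T L (S n)] into [n] shifts of [S L], each within a distance of
    [S L] that does not involve [L]. *)
Let T_bound L n : N (T L (S n) - S L *+ n) <= n%:R * n%:R * (2 * N f).
Proof.
have -> : T L (S n) - S L *+ n = \sum_(q < n) (iter q U (S L) - S L).
  rewrite sumrB sumr_const card_ord; congr (_ - _); rewrite /T.
  under eq_bigr do rewrite S_shift.
  rewrite exchange_big /=; apply: eq_bigr => q _; rewrite S_shift.
  by apply: eq_bigr => l _; rewrite addnC.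
apply: le_trans (Nsum n (x := fun q => iter q U (S L) - S L) _) _.
  by move=> q; apply: ED; [exact: Eiter | exact: EN].
rewrite -mulrA [leRHS]mulr_natl -[in leRHS](card_ord n) -sumr_const.
apply: ler_sum => q _; apply: le_trans (shift_bound _ _) _.
by rewrite card_ord ler_wpM2r ?mulr_ge0 // ler_nat ltnW.
Qed.

(** Applying [T L] to [W] gives [2 n m] copies of [S L] up to an error of norm at most [K],
    independent of [L]. As [N (S L)] is at least [L mu] and [N (T L W)] at most [L N W], division by
    a large [L] yields the bound. *)
Let lower n m : n%:R * m%:R * (2 * mu) <= N (S n *+ m + S m *+ n).
Proof.
set W := _ + _.
have EW : E W by apply: ED; exact: EMn.
pose K := m%:R * (n%:R * n%:R * (2 * N f)) + n%:R * (m%:R * m%:R * (2 * N f)).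
have step L : L%:R * (n%:R * m%:R * (2 * mu)) - K <= L%:R * N W.
  apply: le_trans (NT L EW).
  have TD x y : E x -> E y -> T L (x + y) = T L x + T L y.
    move=> Ex Ey; rewrite -big_split; apply: eq_bigr => l _ /=.
    elim: (l : nat) => //= l' ->; apply: UD; exact: Eiter.
  have TMn x k : E x -> T L (x *+ k) = T L x *+ k.
    move=> Ex; elim: k => [|k IH].
      rewrite !mulr0n /T big1 // => l _; elim: (l : nat) => //= l' ->; exact: U0.
    by rewrite !mulrS TD ?IH //; exact: EMn.
  have ET x : E x -> E (T L x).
    by move=> Ex; apply: (Esum L (x := fun l => iter l U x)) => i; exact: Eiter.
  have eqW : S L *+ (n * m) *+ 2 = T L W -
      ((T L (S n) - S L *+ n) *+ m + (T L (S m) - S L *+ m) *+ n).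
    rewrite TD ?TMn //; [|exact: EMn..].
    rewrite !mulrnBl -!mulrnA (mulnC m n) mulnC mul2n -addnn mulrnDr.
    set A := T L _ *+ m; set B := T L _ *+ n; set s := _ *+ _.
    by rewrite opprD !opprB addrACA [A + _]addrC [B + _]addrC !subrK.
  have EB x y : E x -> E y -> E (x - y) by move=> Ex Ey; apply: ED => //; exact: EN.
  have h1 : N (S L *+ (n * m) *+ 2) <= N (T L W) + K.
    rewrite eqW; apply: le_trans (NB _ _) _; first exact: ET.
      by apply: ED; apply: EMn; apply: EB; try exact: ET; exact: EMn.
    rewrite lerD2l; apply: le_trans (ND _ _) _.
    - by apply: EMn; apply: EB; [exact: ET | exact: EMn].
    - by apply: EMn; apply: EB; [exact: ET | exact: EMn].
    by rewrite !NMn; try (apply: lerD; rewrite ler_wpM2l //; exact: T_bound);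
      (apply: EB; [exact: ET | exact: EMn]).
  rewrite !NMn // in h1; last exact: EMn.
  have h2 : (n * m)%:R * (L%:R * mu) <= (n * m)%:R * N (S L).
    by rewrite ler_wpM2l //; exact: mu_le.
  rewrite natrM in h1 h2; lra.
(* An [L] larger than [K / d] contradicts [step]. *)
rewrite leNgt; apply/negP => lt1.
pose d := n%:R * m%:R * (2 * mu) - N W; have d0 : 0 < d by rewrite subr_gt0.
have := step (Num.truncn (K / d)).+1; have := truncnS_gt (K / d).
rewrite ltr_pdivrMr // /d; lra.
Qed.

(* [a n / n] tends to its infimum [mu] by subadditivity, and [lower] bounds the norm of the
   sum of two averages below by about [2 mu]; the parallelogram law then makes their
   difference small. *)
Lemma mean_ergodic e : 0 < e -> exists n0, forall n m, (n0 <= n)%N -> (n0 <= m)%N ->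
  N (S n *+ m - S m *+ n) <= e * (n%:R * m%:R).
Proof.
(* The parallelogram law leaves [4 (mu + d)^2 - (2 mu)^2 = 4 d (2 mu + d)], which this [d] keeps
   below [e^2]. *)
move=> e0; pose d := Num.min 1 (e ^+ 2 / (4 * (2 * mu + 1))).
have mu1 : 0 < 4 * (2 * mu + 1) by have := mu_ge0; lra.
have d0 : 0 < d by rewrite lt_min ltr01 divr_gt0 // exprn_gt0.
have d1 : d <= 1 by rewrite ge_min lexx.
have de : 4 * d * (2 * mu + d) <= e ^+ 2.
  have : d <= e ^+ 2 / (4 * (2 * mu + 1)) by rewrite ge_min lexx orbT.
  rewrite ler_pdivlMr // => le1; apply: le_trans le1.
  have -> : d * (4 * (2 * mu + 1)) = 4 * d * (2 * mu + 1) by ring.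
  by rewrite ler_wpM2l ?lerD2l // mulr_ge0 // ltW.
have [n0 hn0] := a_upper d0; exists n0 => n m /hn0 an /hn0 am.
have x0 : 0 <= n%:R * m%:R :> R by rewrite mulr_ge0.
rewrite -ler_sqr ?nnegrE ?mulr_ge0 ?(ltW e0) //.
have par := Npar (EMn m (ES n)) (EMn n (ES m)).
have low : (n%:R * m%:R * (2 * mu)) ^+ 2 <= N (S n *+ m + S m *+ n) ^+ 2.
  by rewrite ler_sqr ?nnegrE ?lower // mulr_ge0 // mulr_ge0.
rewrite !NMn // !exprMn in par.
have an2 : a n ^+ 2 <= (n%:R * (mu + d)) ^+ 2.
  by rewrite ler_sqr ?nnegrE ?N_ge0 // mulr_ge0 // addr_ge0 // ltW.
have am2 : a m ^+ 2 <= (m%:R * (mu + d)) ^+ 2.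
  by rewrite ler_sqr ?nnegrE ?N_ge0 // mulr_ge0 // addr_ge0 // ltW.
have h1 : m%:R ^+ 2 * a n ^+ 2 <= m%:R ^+ 2 * (n%:R * (mu + d)) ^+ 2.
  by rewrite ler_wpM2l // exprn_ge0.
have h2 : n%:R ^+ 2 * a m ^+ 2 <= n%:R ^+ 2 * (m%:R * (mu + d)) ^+ 2.
  by rewrite ler_wpM2l // exprn_ge0.
have h3 : (n%:R * m%:R) ^+ 2 * (4 * d * (2 * mu + d)) <= (n%:R * m%:R) ^+ 2 * e ^+ 2.
  by rewrite ler_wpM2l // exprn_ge0.
rewrite /a in h1 h2.
have e1 : (n%:R * m%:R) ^+ 2 * (4 * d * (2 * mu + d)) =
  2 * (m%:R ^+ 2 * (n%:R * (mu + d)) ^+ 2 + n%:R ^+ 2 * (m%:R * (mu + d)) ^+ 2)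
   - (n%:R * m%:R * (2 * mu)) ^+ 2 by ring.
have e2 : (e * (n%:R * m%:R)) ^+ 2 = (n%:R * m%:R) ^+ 2 * e ^+ 2 by ring.
rewrite e2; lra.
Qed.

End MeanErgodic.

(** * Square summable families *)

HB.lock Definition nrm (R : realType) (I : choiceType) (f : I -> R[i]) : R :=
  Num.sqrt (sup [set \sum_(i <- A) nc (f i) ^+ 2 | A in [set: {fset I}]]).

Section SquareSummable.
Variable R : realType.

(** Lagrange's identity: the double sum of the squares of [a_i b_j - a_j b_i] is twice the
    difference of the two sides. *)
Lemma cauchy_schwarz_sum (I : Type) (s : seq I) (a b : I -> R) :
  (\sum_(i <- s) a i * b i) ^+ 2 <=
  (\sum_(i <- s) a i ^+ 2) * (\sum_(i <- s) b i ^+ 2).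
Proof.
have : 0 <= \sum_(i <- s) \sum_(j <- s) (a i * b j - a j * b i) ^+ 2.
  by apply: sumr_ge0 => i _; apply: sumr_ge0 => j _; exact: sqr_ge0.
have -> : \sum_(i <- s) \sum_(j <- s) (a i * b j - a j * b i) ^+ 2 =
  \sum_(i <- s) \sum_(j <- s) a i ^+ 2 * b j ^+ 2 +
  \sum_(i <- s) \sum_(j <- s) b i ^+ 2 * a j ^+ 2 -
  2 * \sum_(i <- s) \sum_(j <- s) (a i * b i) * (a j * b j).
  rewrite mulr_sumr -big_split -sumrB; apply: eq_bigr => i _ /=.
  rewrite mulr_sumr -big_split -sumrB; apply: eq_bigr => j _ /=.
  ring.
by rewrite -!big_distrlr /= -expr2; lra.
Qed.

Lemma sum_mul_le (I : Type) (s : seq I) (a b : I -> R) p q :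
  0 <= p -> 0 <= q -> \sum_(i <- s) a i ^+ 2 <= p ^+ 2 ->
  \sum_(i <- s) b i ^+ 2 <= q ^+ 2 -> \sum_(i <- s) a i * b i <= p * q.
Proof.
move=> p0 q0 ap bq; apply: le_trans (ler_norm _) _.
rewrite -ler_sqr ?nnegrE ?mulr_ge0 // real_normK ?num_real //.
apply: le_trans (cauchy_schwarz_sum _ _ _) _.
by rewrite exprMn ler_pM // sumr_ge0 // => i _; exact: sqr_ge0.
Qed.

Definition l2le (I : choiceType) (f : I -> R[i]) r :=
  forall A : {fset I}, \sum_(i <- A) nc (f i) ^+ 2 <= r ^+ 2.

Definition l2 (I : choiceType) (f : I -> R[i]) := exists2 r, 0 <= r & l2le f r.

Section OneIndex.
Variable I : choiceType.
Implicit Types (f g : I -> R[i]) (p q r c : R) (A : {fset I}).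

Lemma l2leW f p q : 0 <= p -> p <= q -> l2le f p -> l2le f q.
Proof.
move=> p0 pq fp A; apply: le_trans (fp A) _.
by rewrite ler_sqr ?nnegrE // (le_trans p0).
Qed.

Lemma l2le_bd f r i : 0 <= r -> l2le f r -> nc (f i) <= r.
Proof.
move=> r0 /(_ [fset i]%fset); rewrite big_seq_fset1 ler_sqr ?nnegrE //; exact: nc_ge0.
Qed.

Lemma l2leD f g p q : 0 <= p -> 0 <= q -> l2le f p -> l2le g q ->
  l2le (fun i => f i + g i) (p + q).
Proof.
move=> p0 q0 fp gq A.
apply: (@le_trans _ _ (\sum_(i <- A) (nc (f i) ^+ 2 + nc (g i) ^+ 2 +
    2 * (nc (f i) * nc (g i))))).
  apply: ler_sum => i _; apply: (@le_trans _ _ ((nc (f i) + nc (g i)) ^+ 2)).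
    by rewrite ler_sqr ?nnegrE ?addr_ge0 ?nc_ge0 ?ncD.
  by rewrite le_eqVlt; apply/orP; left; apply/eqP; ring.
rewrite !big_split -mulr_sumr /=.
have := sum_mul_le p0 q0 (fp A) (gq A); have := fp A; have := gq A.
by rewrite sqrrD; lra.
Qed.

Lemma l2leZ f (c : R[i]) r : l2le f r -> l2le (fun i => c * f i) (nc c * r).
Proof.
move=> fr A; under eq_bigr do rewrite ncM exprMn.
by rewrite -mulr_sumr exprMn ler_wpM2l ?exprn_ge0 ?nc_ge0.
Qed.

Lemma l2le_sum (J : choiceType) (B : {fset J}) (f : J -> I -> R[i]) (r : J -> R) :
  (forall j, 0 <= r j) -> (forall j, l2le (f j) (r j)) ->
  l2le (fun i => \sum_(j <- B) f j i) (\sum_(j <- B) r j).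
Proof.
move=> r0 fr; elim: (enum_fset B) => [|j s IH].
  by move=> A; rewrite big_nil big1 ?expr0n // => i _; rewrite big_nil nc0 expr0n.
rewrite big_cons; under eq_fun do rewrite big_cons.
by apply: l2leD => //; exact: sumr_ge0.
Qed.

(** Lower semicontinuity of the norm: a ball is closed under approximation on finite sets, which
    carries bounds from finite sums over to [usum]. *)
Lemma l2le_approx f r : 0 <= r ->
  (forall A e, 0 < e -> exists2 g, l2le g r & forall i, i \in A -> nc (f i - g i) <= e) ->
  l2le f r.
Proof.
move=> r0 appr A; apply/ler_addgt0Pr => e e0.
(* An error [d <= 1] in an entry of modulus at most [r] changes its square by at most
   [d (2 r + 1)]. *)
pose K : R := #|` A|%:R * (2 * r + 1) + 1.
have K0 : 0 < K by rewrite ltr_wpDl // mulr_ge0 //; lra.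
pose d := Num.min 1 (e / K).
have d0 : 0 < d by rewrite lt_min ltr01 divr_gt0.
have d1 : d <= 1 by rewrite ge_min lexx.
have dK : d * K <= e by rewrite -ler_pdivlMr // ge_min lexx orbT.
have [g gr hg] := appr A d d0.
have step i : i \in A -> nc (f i) ^+ 2 <= nc (g i) ^+ 2 + d * (2 * r + 1).
  move=> iA; have h := hg i iA; have gi := l2le_bd i r0 gr.
  have fg : nc (f i) <= nc (g i) + d.
    have := ncD (f i - g i) (g i); rewrite subrK; lra.
  have f0 := nc_ge0 (f i); have g0 := nc_ge0 (g i).
  have : nc (f i) ^+ 2 <= (nc (g i) + d) ^+ 2 by rewrite ler_sqr ?nnegrE ?addr_ge0 // ltW.
  have : d * (2 * nc (g i) + d) <= d * (2 * r + 1) by rewrite ler_wpM2l //; lra.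
  rewrite sqrrD; lra.
apply: (@le_trans _ _ (\sum_(i <- A) (nc (g i) ^+ 2 + d * (2 * r + 1)))).
  by rewrite big_seq [leRHS]big_seq; exact: ler_sum.
rewrite big_split /=; apply: lerD => //.
rewrite big_const_seq count_predT iter_addr_0 -[leLHS]mulr_natl.
rewrite /K in dK; lra.
Qed.

Lemma nrm_ge0 f : 0 <= nrm f.
Proof. by rewrite nrm.unlock sqrtr_ge0. Qed.

Let sumset f := [set \sum_(i <- A) nc (f i) ^+ 2 | A in [set: {fset I}]].

Let sumset_sup f : l2 f -> has_sup (sumset f).
Proof.
move=> [r r0 fr]; split; first by exists (\sum_(i <- fset0) nc (f i) ^+ 2), fset0.
by exists (r ^+ 2) => _ [A _ <-]; exact: fr.
Qed.

Let sup_sumset_ge0 f : l2 f -> 0 <= sup (sumset f).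
Proof.
move=> fl2; apply: (@le_trans _ _ (\sum_(i <- fset0) nc (f i) ^+ 2)).
  by rewrite big_seq_fset0.
by apply: ub_le_sup; [case: (sumset_sup fl2) | exists fset0].
Qed.

Lemma nrmP f : l2 f -> l2le f (nrm f).
Proof.
move=> fl2 A; rewrite nrm.unlock sqr_sqrtr; last exact: sup_sumset_ge0.
by apply: ub_le_sup; [case: (sumset_sup fl2) | exists A].
Qed.

Lemma nrm_le f r : 0 <= r -> l2le f r -> nrm f <= r.
Proof.
move=> r0 fr; rewrite nrm.unlock -(ger0_norm r0) -sqrtr_sqr; apply: ler_wsqrtr.
apply: sup_le_ub; first by exists (\sum_(i <- fset0) nc (f i) ^+ 2), fset0.
by move=> _ [A _ <-]; exact: fr.
Qed.

Lemma l2D f g : l2 f -> l2 g -> l2 (fun i => f i + g i).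
Proof.
by move=> [p p0 fp] [q q0 gq]; exists (p + q); [exact: addr_ge0 | exact: l2leD].
Qed.

Lemma l2Z f (c : R[i]) : l2 f -> l2 (fun i => c * f i).
Proof. by move=> [p p0 fp]; exists (nc c * p); [rewrite mulr_ge0 ?nc_ge0 | exact: l2leZ]. Qed.

Lemma nrmD f g : l2 f -> l2 g -> nrm (fun i => f i + g i) <= nrm f + nrm g.
Proof.
move=> /nrmP fl2 /nrmP gl2; apply: nrm_le; first by rewrite addr_ge0 ?nrm_ge0.
by apply: l2leD => //; exact: nrm_ge0.
Qed.

Lemma nrmN f : nrm (fun i => - f i) = nrm f.
Proof.
rewrite nrm.unlock; congr (Num.sqrt (sup _)); apply/seteqP.
by split=> _ [A _ <-]; exists A => //; apply: eq_bigr => i _; rewrite ncN.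
Qed.

Lemma nrmMn f n : l2 f -> nrm (fun i => f i *+ n) = n%:R * nrm f.
Proof.
move=> fl2; apply/eqP; rewrite eq_le; apply/andP; split.
  have -> : (fun i => f i *+ n) = fun i => n%:R * f i.
    by apply/funext => i; rewrite mulr_natl.
  apply: nrm_le; first by rewrite mulr_ge0 ?nrm_ge0.
  by rewrite -(nc_nat R n); exact/l2leZ/nrmP.
case: n => [|n]; first by rewrite mul0r nrm_ge0.
rewrite mulrC -ler_pdivlMr ?ltr0n //; apply: nrm_le.
  by rewrite divr_ge0 ?nrm_ge0.
have fn : l2 (fun i => f i *+ n.+1).
  have -> : (fun i => f i *+ n.+1) = fun i => n.+1%:R * f i.
    by apply/funext => i; rewrite mulr_natl.
  exact: l2Z.
have := l2leZ (n.+1%:R)^-1 (nrmP fn).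
rewrite nc_inv nc_nat mulrC; congr l2le; apply/funext => i.
by rewrite -[f i *+ _]mulr_natl mulrA mulVf ?mul1r // pnatr_eq0.
Qed.

(** The suprema on the left may be approached along different finite sets; both sums grow when
    passing to the union, where the identity holds termwise. The inequality is all that the ergodic
    theorem asks for. *)
Lemma nrm_par f g : l2 f -> l2 g ->
  nrm (fun i => f i + g i) ^+ 2 + nrm (fun i => f i - g i) ^+ 2 <=
  2 * (nrm f ^+ 2 + nrm g ^+ 2).
Proof.
move=> fl2 gl2.
have l2p : l2 (fun i => f i + g i) by exact: l2D.
have l2m : l2 (fun i => f i - g i).
  have := l2D fl2 (l2Z (-1) gl2); congr l2; apply/funext => i; by rewrite mulN1r.
rewrite nrm.unlock !sqr_sqrtr; [|exact: sup_sumset_ge0..].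
rewrite -lerBrDr; apply: sup_le_ub; first by case: (sumset_sup l2p).
move=> _ [A _ <-]; rewrite lerBrDr -lerBrDl.
apply: sup_le_ub; first by case: (sumset_sup l2m).
move=> _ [B _ <-]; rewrite lerBrDl; set C := (A `|` B)%fset.
have sq0 (h : I -> R[i]) : forall i, 0 <= nc (h i) ^+ 2 by move=> i; exact: sqr_ge0.
have hA := le_fset_sum (fsubsetUl A B) (sq0 (fun i => f i + g i)).
have hB := le_fset_sum (fsubsetUr A B) (sq0 (fun i => f i - g i)).
have par : \sum_(i <- C) nc (f i + g i) ^+ 2 + \sum_(i <- C) nc (f i - g i) ^+ 2 =
    2 * (\sum_(i <- C) nc (f i) ^+ 2 + \sum_(i <- C) nc (g i) ^+ 2).
  rewrite -!big_split mulr_sumr; apply: eq_bigr => i _ /=.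
  case: (f i) => a b; case: (g i) => a' b' /=.
  by rewrite !sqr_sqrtr ?addr_ge0 ?sqr_ge0 //; ring.
have hf := nrmP fl2 C; have hg := nrmP gl2 C.
rewrite nrm.unlock !sqr_sqrtr in hf hg; [|exact: sup_sumset_ge0..].
rewrite -/C in hA hB; lra.
Qed.

Lemma l2le_mul f g p q : 0 <= p -> 0 <= q -> l2le f p -> l2le g q ->
  abs_le (fun i => f i * g i) (p * q).
Proof.
by move=> p0 q0 fp gq A; under eq_bigr do rewrite ncM; exact: sum_mul_le.
Qed.

End OneIndex.

Lemma l2le_inj (I J : choiceType) (p : J -> I) (f : I -> R[i]) r :
  injective p -> l2le f r -> l2le (fun j => f (p j)) r.
Proof.
move=> pinj fr A; have := fr (p @` A)%fset.
by rewrite big_imfset //= => x y _ _; exact: pinj.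
Qed.

Lemma l2_inj (I J : choiceType) (p : J -> I) (f : I -> R[i]) :
  injective p -> l2 f -> l2 (fun j => f (p j)).
Proof. by move=> pinj [r r0 fr]; exists r => //; exact: l2le_inj. Qed.

Lemma nrm_inj (I J : choiceType) (p : J -> I) (f : I -> R[i]) :
  injective p -> l2 f -> nrm (fun j => f (p j)) <= nrm f.
Proof.
by move=> pinj fl2; apply: nrm_le; [exact: nrm_ge0 | exact/l2le_inj/nrmP].
Qed.

Lemma has_sum_unif (I J : choiceType) (f : J -> I -> R[i]) (s : J -> R[i])
    (A : {fset J}) e :
  (forall j, has_sum (f j) (s j)) -> 0 < e ->
  exists B : {fset I}, forall j, j \in A -> nc (\sum_(i <- B) f j i - s j) <= e.
Proof.
move=> fs e0.
have /choice[b hb] : forall j, exists B : {fset I}, forall B' : {fset I},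
    (B `<=` B')%fset -> nc (\sum_(i <- B') f j i - s j) <= e.
  by move=> j; exact: fs.
exists (\bigcup_(j <- A) b j)%fset => j jA; apply: hb; exact: bigfcup_sup.
Qed.

(** Minkowski's inequality for series: it holds for finite sums, and [l2le_approx] takes the
    limit. *)
Lemma l2le_usum (I : choiceType) (f : nat -> I -> R[i]) (r : nat -> R) q :
  (forall n, 0 <= r n) -> (forall n, l2le (f n) (r n)) ->
  (forall A : {fset nat}, \sum_(n <- A) r n <= q) ->
  l2le (fun i => usum (fun n => f n i)) q.
Proof.
move=> r0 fr rq.
have q0 : 0 <= q by have := rq fset0; rewrite big_seq_fset0.
have fq i : abs_le (fun n => f n i) q.
  move=> A; apply: le_trans (rq A); apply: ler_sum => n _; exact: l2le_bd.
apply: l2le_approx => // A e e0.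
have [B hB] := has_sum_unif A (fun i => usumP (fq i)) e0.
exists (fun i => \sum_(n <- B) f n i).
  apply: l2leW (rq B) _; first by rewrite sumr_ge0.
  exact: l2le_sum.
by move=> i /hB; rewrite ncB.
Qed.

(* [K] has operator norm at most [c], tested on finitely supported vectors and finitely many rows. *)
Definition contr (X : choiceType) (K : X -> X -> R[i]) c :=
  forall (B U : {fset X}) (x : X -> R[i]),
    \sum_(v <- B) nc (\sum_(u <- U) K v u * x u) ^+ 2 <=
    c ^+ 2 * \sum_(u <- U) nc (x u) ^+ 2.

Lemma has_sum_ge_fset (I : choiceType) (f : I -> R[i]) s (B : {fset I}) :
  has_sum f s -> (forall i, 0 <= f i) -> \sum_(i <- B) f i <= s.
Proof.
move=> fs f0; rewrite -subr_ge0.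
have fB := @has_sum_finite _ _ (fun i => if i \in B then f i else 0) B.
have {}fB : has_sum (fun i => if i \in B then f i else 0) (\sum_(i <- B) f i).
  have -> : \sum_(i <- B) f i = \sum_(i <- B) if i \in B then f i else 0.
    by rewrite big_seq [RHS]big_seq; apply: eq_bigr => i ->.
  by apply: fB => i /negPf ->.
have := has_sumD fs (has_sumZ (-1) fB); rewrite mulN1r => /has_sum_ge0; apply => i.
by case: ifP => _; rewrite ?mulN1r ?subrr // oppr0 addr0.
Qed.

(** Bessel's inequality: with orthonormal columns, the sum over all rows equals the square norm of
    [x], and [B] keeps only part of it. *)
Lemma contr_unitary (X : choiceType) (K : X -> X -> R[i]) :
  (forall a b, has_sum (fun v => (K v a)^*%C * K v b) (kid R a b)) -> contr K 1.
Proof.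
move=> KK B U x; rewrite expr1n mul1r.
have : has_sum (fun v => ((nc (\sum_(u <- U) K v u * x u)) ^+ 2)%:C)
    (\sum_(u <- U) nc (x u) ^+ 2)%:C.
  have -> : (fun v => ((nc (\sum_(u <- U) K v u * x u)) ^+ 2)%:C) =
      fun v => \sum_(a <- U) \sum_(b <- U) ((x a)^*%C * x b) * ((K v a)^*%C * K v b).
    apply/funext => v; rewrite nc_sqr rmorph_sum mulr_suml; apply: eq_bigr => a _.
    rewrite mulr_sumr; apply: eq_bigr => b _; rewrite rmorphM /=; ring.
  have -> : (\sum_(u <- U) nc (x u) ^+ 2)%:C =
      \sum_(a <- U) \sum_(b <- U) ((x a)^*%C * x b) * kid R a b.
    rewrite rmorph_sum /= big_seq [RHS]big_seq; apply: eq_bigr => a aU.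
    rewrite nc_sqr (big_fsetD1 a) //= /kid eqxx mulr1 big_seq big1 ?addr0 //.
    by move=> b; rewrite !inE eq_sym => /andP[/negPf -> _]; rewrite mulr0.
  by apply: has_sum_sum => a; apply: has_sum_sum => b; exact: has_sumZ.
move=> /has_sum_ge_fset - /(_ B); rewrite -rmorph_sum lecR; apply => v.
by rewrite lecR sqr_ge0.
Qed.

(** Schur's test: Cauchy-Schwarz with each [nc (K v u)] split into two square roots uses the row
    bound once; exchanging the sums uses the column bound. *)
Lemma contr_schur (X : choiceType) (K : X -> X -> R[i]) M :
  krow K M -> kcol K M -> contr K M.
Proof.
move=> Krow Kcol B U x.
have M0 : B != fset0 -> 0 <= M by move=> /fset0Pn[v _]; exact: abs_le_ge0 (Krow v).
have [->|/M0{}M0] := eqVneq B fset0.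
  by rewrite big_seq_fset0 mulr_ge0 ?sqr_ge0 // sumr_ge0 // => u _; exact: sqr_ge0.
apply: (@le_trans _ _ (\sum_(v <- B) M * \sum_(u <- U) nc (K v u) * nc (x u) ^+ 2)).
  apply: ler_sum => v _.
  apply: (@le_trans _ _ ((\sum_(u <- U) nc (K v u) * nc (x u)) ^+ 2)).
    rewrite ler_sqr ?nnegrE ?nc_ge0 //; last first.
      by apply: sumr_ge0 => u _; rewrite mulr_ge0 ?nc_ge0.
    by apply: le_trans (nc_sum _ _ _) _; under eq_bigr do rewrite ncM.
  have := cauchy_schwarz_sum U (fun u => Num.sqrt (nc (K v u)))
    (fun u => Num.sqrt (nc (K v u)) * nc (x u)).
  under eq_bigr do rewrite mulrA -expr2 sqr_sqrtr ?nc_ge0 //.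
  move=> /le_trans; apply.
  under eq_bigr do rewrite sqr_sqrtr ?nc_ge0 //.
  under [X in _ * X]eq_bigr do rewrite exprMn sqr_sqrtr ?nc_ge0 //.
  rewrite ler_wpM2r //; last exact: Krow.
  by apply: sumr_ge0 => u _; rewrite mulr_ge0 ?nc_ge0 ?sqr_ge0.
rewrite -mulr_sumr exchange_big /= expr2 -mulrA ler_wpM2l // mulr_sumr.
apply: ler_sum => u _; rewrite -mulr_suml ler_wpM2r ?sqr_ge0 //; exact: Kcol.
Qed.

(* The index set [P] enumerates the columns of a matrix on which [K] acts from the left. *)
Lemma contr_l2le (P X : choiceType) (K : X -> X -> R[i]) (f : P * X -> R[i]) c a r :
  contr K c -> 0 <= c -> krow K a -> 0 <= r -> l2le f r ->
  l2le (fun p => usum (fun u => K p.2 u * f (p.1, u))) (c * r).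
Proof.
move=> Kc c0 Ka r0 fr; apply: l2le_approx => [|A e e0]; first exact: mulr_ge0.
have sumK p : has_sum (fun u => K p.2 u * f (p.1, u)) (usum (fun u => K p.2 u * f (p.1, u))).
  apply: (@usumP _ _ _ (r * a)); apply: abs_le_bounded_mul => // u; exact: l2le_bd.
have [U hU] := has_sum_unif A sumK e0.
exists (fun p => \sum_(u <- U) K p.2 u * f (p.1, u)); last first.
  by move=> p /hU; rewrite ncB.
move=> D; apply: le_trans (le_fset_sum (sub_fsetX D) _) _; first by move=> p; exact: sqr_ge0.
rewrite (sum_fsetX (fun q v => nc (\sum_(u <- U) K v u * f (q, u)) ^+ 2)).
apply: le_trans (ler_sum _ (fun q _ => Kc _ U (fun u => f (q, u)))) _.
rewrite -mulr_sumr exprMn ler_wpM2l ?sqr_ge0 //.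
rewrite -(sum_fsetX (fun q u => nc (f (q, u)) ^+ 2)).
by apply: le_trans (fr _); rewrite le_eqVlt; apply/orP; left; apply/eqP/eq_bigr => -[].
Qed.

Lemma contr_l2le_vec (X : choiceType) (K : X -> X -> R[i]) (f : X -> R[i]) c a r :
  contr K c -> 0 <= c -> krow K a -> 0 <= r -> l2le f r ->
  l2le (fun v => usum (fun u => K v u * f u)) (c * r).
Proof.
move=> Kc c0 Ka r0 fr.
have := @contr_l2le unit X K (fun p => f p.2) c a r Kc c0 Ka r0.
move=> /(_ (l2le_inj _ fr)) h.
apply: (l2le_inj (p := fun v : X => (tt, v)) _ (h _)) => [v w []//|].
by move=> [[] v] [[] w] /= ->.
Qed.

End SquareSummable.

(** * Periodic kernels *)

Section PeriodicKernels.
Variables (R : realType) (P : finType) (K : zmodType).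
Local Notation X := (P * K)%type.
Implicit Types (A B : X -> X -> R[i]) (a b c r : R) (v w : X) (k : K).

Definition shift k v : X := (v.1, v.2 + k).

Definition periodic B := forall k v w, B (shift k v) (shift k w) = B v w.

Lemma shiftK k : cancel (shift k) (shift (- k)).
Proof. by move=> [p l]; rewrite /shift /= addrK. Qed.

Lemma shiftNK k : cancel (shift (- k)) (shift k).
Proof. by move=> [p l]; rewrite /shift /= subrK. Qed.

Lemma periodic_origin B p q k l :
  periodic B -> B (p, k) (q, l) = B (p, k - l) (q, 0).
Proof. by move=> perB; rewrite -(perB (- l)) /shift /= subrr. Qed.

Lemma periodic_tr B : periodic B -> periodic (ktr B).
Proof. by move=> perB k v w; exact: perB. Qed.

Lemma periodic_kmul A B a b : periodic A -> periodic B ->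
  krow A a -> 0 <= b -> kbd B b -> periodic (kmul A B).
Proof.
move=> perA perB Aa b0 Bb k v w.
rewrite /kmul (usum_reindex (shiftK k) (shiftNK k) (kmul_summable _ _ Aa b0 Bb)).
by apply: eq_usum => u; rewrite perA perB.
Qed.

Lemma periodic_kmul_col A B a b : periodic A -> periodic B ->
  0 <= a -> kbd A a -> kcol B b -> periodic (kmul A B).
Proof.
move=> perA perB a0 Aa Bb.
suff : periodic (ktr (kmul (ktr B) (ktr A))) by rewrite kmul_tr.
apply: periodic_tr; apply: (periodic_kmul (a := b) (b := a)) => //.
- exact: periodic_tr.
- exact: periodic_tr.
- by move=> v w; exact: Aa.
Qed.

Lemma periodic_kid : periodic (@kid R X).
Proof. by move=> k v w; rewrite /kid (can_eq (shiftK k)). Qed.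

(* The columns of a periodic kernel through the vertices of the cell; they determine it. *)
Definition tau B (p : P * X) : R[i] := B p.2 (p.1, 0).

Lemma tau_bd B r : periodic B -> 0 <= r -> l2le (tau B) r -> kbd B r.
Proof.
move=> perB r0 Br [p k] [q l]; rewrite periodic_origin //.
exact: (l2le_bd (q, (p, k - l)) r0 Br).
Qed.

(** Translation by [- k] moves the transposed entry, from [(q, 0)] to [(p, k)], back to a column of
    the cell. Being a bijection, this shows that transposition preserves the square sum over the
    cell. *)
Definition tau_flip (p : P * X) : P * X := (p.2.1, (p.1, - p.2.2)).

Lemma tau_flipK : involutive tau_flip.
Proof. by move=> [q [p k]]; rewrite /tau_flip /= opprK. Qed.

Lemma tau_tr B : periodic B -> tau (ktr B) = fun p => tau B (tau_flip p).
Proof.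
move=> perB; apply/funext => -[q [p k]].
by rewrite /tau /ktr /= periodic_origin // sub0r.
Qed.

Lemma l2le_tau_tr B r : periodic B -> l2le (tau B) r -> l2le (tau (ktr B)) r.
Proof.
by move=> perB Br; rewrite tau_tr //; apply: l2le_inj => //; exact: (can_inj tau_flipK).
Qed.

Lemma l2le_tau_kmul A B a c r : contr A c -> 0 <= c -> krow A a ->
  0 <= r -> l2le (tau B) r -> l2le (tau (kmul A B)) (c * r).
Proof. exact: contr_l2le. Qed.

(** Right multiplication by a symmetric kernel is left multiplication between two transpositions,
    and periodicity makes these isometric. *)
Lemma l2le_tau_kmul_r A B a c r : contr A c -> 0 <= c -> krow A a -> ksym A ->
  periodic A -> periodic B -> 0 <= r -> l2le (tau B) r ->
  l2le (tau (kmul B A)) (c * r).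
Proof.
move=> Ac c0 Aa symA perA perB r0 Br.
have trA : ktr A = A by apply/funext => v; apply/funext => w; exact: symA.
have Bbd := tau_bd perB r0 Br.
rewrite (_ : kmul B A = ktr (kmul A (ktr B))); last by rewrite -{2}trA kmul_tr.
apply: l2le_tau_tr.
  apply: (periodic_kmul (a := a) (b := r)) => //; first exact: periodic_tr.
  by move=> v w; exact: Bbd.
by apply: l2le_tau_kmul Aa _ _ => //; exact: l2le_tau_tr.
Qed.

Lemma l2le_col B q r : l2le (tau B) r -> l2le (fun v => B v (q, 0)) r.
Proof. by move=> Br; apply: (l2le_inj (p := fun v => (q, v)) _ Br) => v w []. Qed.

(** The Fourier coefficient at [k] of the trace of the Floquet symbol of [B]; [k = 0] gives the
    trace per unit cell. *)
Definition trace_at k B : R[i] := \sum_(q : P) B (q, k) (q, 0).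

(** The substitution of [k - m] for [m], followed by translations of both factors, exchanges their
    roles. *)
Lemma trace_at_mulC k A B a b : periodic A -> periodic B ->
  krow A a -> kcol A a -> 0 <= b -> kbd B b ->
  trace_at k (kmul A B) = trace_at k (kmul B A).
Proof.
move=> perA perB Arow Acol b0 Bb.
have split (f : X -> R[i]) M : abs_le (fun u : X => f u) M ->
    usum (fun u : X => f u) = \sum_(p : P) usum (fun m => f (p, m)).
  move=> fM; rewrite -usum_fin -(usum_pair (M := M) (f := fun p m => f (p, m))).
    by apply: eq_usum => -[].
  by move=> F; have := fM F; congr (_ <= _); apply: eq_bigr => -[].
have BA v w : abs_le (fun u => B v u * A u w) (b * a) by exact: kmul_summable_col.
rewrite /trace_at /kmul.
under eq_bigr => q _ do rewrite (split _ _ (kmul_summable (q, k) (q, 0) Arow b0 Bb)).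
under [RHS]eq_bigr => q _ do rewrite (split _ _ (BA (q, k) (q, 0))).
rewrite exchange_big /=; apply: eq_bigr => p _; apply: eq_bigr => q _.
have invK : involutive (fun m => k - m) by move=> m; rewrite subKr.
have sumq : abs_le (fun m => A (q, k) (p, m) * B (p, m) (q, 0)) (b * a).
  apply: (abs_le_inj (p := fun m => (p, m))
    (f := fun u => A (q, k) u * B u (q, 0))) => [m m' []//|].
  exact: kmul_summable.
rewrite (usum_reindex invK invK sumq); apply: eq_usum => m /=.
rewrite mulrC; congr (_ * _).
  by rewrite (periodic_origin _ _ _ _ perB) [RHS](periodic_origin _ _ _ _ perB) subr0.
by rewrite (periodic_origin _ _ _ _ perA) subKr.
Qed.

Lemma trace_atD k A B : trace_at k (fun v w => A v w + B v w) = trace_at k A + trace_at k B.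
Proof. by rewrite /trace_at -big_split. Qed.

Section Derivation.
Variable x : K -> R.
Hypothesis xD : forall k l, x (k + l) = x k + x l.

Definition deriv A v w : R[i] := (x v.2 - x w.2)%:C * A v w.

Let x0 : x 0 = 0.
Proof. by have := xD 0 0; rewrite addr0 => /eqP; rewrite -subr_eq0 opprD addrA subrr sub0r oppr_eq0 => /eqP. Qed.

Lemma periodic_deriv A : periodic A -> periodic (deriv A).
Proof.
move=> perA k v w; rewrite /deriv perA /shift /= !xD; congr (_%:C * _).
by ring.
Qed.

Lemma deriv_kid : deriv (@kid R X) = fun _ _ => 0.
Proof.
apply/funext => v; apply/funext => w; rewrite /deriv /kid.
by case: eqP => [->|_]; rewrite ?subrr ?mul0r ?mulr0.
Qed.

Lemma trace_at_deriv k A : trace_at k (deriv A) = (x k)%:C * trace_at k A.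
Proof.
by rewrite /trace_at mulr_sumr; apply: eq_bigr => q _; rewrite /deriv /= x0 subr0.
Qed.

Lemma deriv_kmul A B a b a' b' : krow A a -> kcol B b ->
  0 <= a' -> kbd (deriv A) a' -> 0 <= b' -> kbd (deriv B) b' ->
  deriv (kmul A B) = fun v w => kmul (deriv A) B v w + kmul A (deriv B) v w.
Proof.
move=> Aa Bb a0 dA b0 dB; apply/funext => v; apply/funext => w.
have s1 := kmul_summable_col v w a0 dA Bb.
have s2 := kmul_summable v w Aa b0 dB.
rewrite -(usumD s1 s2) {1}/deriv -(usumZ_abs (M := a' * b + b' * a)).
  apply: eq_usum => u; rewrite /deriv.
  have -> : (x v.2 - x w.2)%:C = (x v.2 - x u.2)%:C + (x u.2 - x w.2)%:C.
    by rewrite -rmorphD /=; congr _%:C; ring.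
  by ring.
have := abs_leD s1 s2; congr abs_le; apply/funext => u; rewrite /deriv.
have -> : (x v.2 - x w.2)%:C = (x v.2 - x u.2)%:C + (x u.2 - x w.2)%:C.
  by rewrite -rmorphD /=; congr _%:C; ring.
by ring.
Qed.

End Derivation.
End PeriodicKernels.

(** * Coefficients of exponential series and positivity of powers *)

Section PowerFacts.
Variable R : realType.

(** The lowest nonvanishing coefficient would dominate for small [t]: once the earlier ones vanish,
    the terms after the [n]-th are bounded by [t^(n+1) C expR M] in total. *)
Lemma ecoef_series_eq0 (tau : nat -> R[i]) (C M : R) : 0 <= C -> 0 <= M ->
  (forall n, nc (tau n) <= C * M ^+ n) ->
  (forall t : R, 0 < t -> has_sum (fun n => ecoef t n * tau n) 0) ->
  forall n, tau n = 0.
Proof.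
move=> C0 M0 tauC sum0; elim/ltn_ind => n IH.
apply/eqP; rewrite -eq0_nc; apply/ler_addgt0Pr => e e0; rewrite add0r.
(* Dividing that remainder by [t^n / n!] leaves [t L]. *)
pose L := n`!%:R * (C * expR M); have L0 : 0 <= L by rewrite !mulr_ge0 ?expR_ge0.
pose t := Num.min 1 (e / (L + 1)).
have t0 : 0 < t by rewrite lt_min ltr01 divr_gt0 // ltr_wpDl.
have t1 : t <= 1 by rewrite ge_min lexx.
have tL : t * L <= e.
  apply: (@le_trans _ _ (t * (L + 1))); first by rewrite ler_wpM2l ?lerDl // ltW.
  by rewrite -ler_pdivlMr ?ltr_wpDl // ge_min lexx orbT.
pose d m := if m == n then ecoef t n * tau n else 0.
have dsum : has_sum d (ecoef t n * tau n).
  have := @has_sum1 _ _ d n; rewrite /d eqxx; apply => m /negPf -> //.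
have := has_sumD (sum0 t t0) (has_sumZ (-1) dsum); rewrite add0r => gsum.
have gle : abs_le (fun m => ecoef t m * tau m + -1 * d m) (t ^+ n.+1 * C * expR M).
  have expM : abs_le (fun m => (M ^+ m / m`!%:R)%:C) (expR M).
    move=> A; under eq_bigr do rewrite nc_real ger0_norm ?divr_ge0 ?exprn_ge0 //.
    exact: sum_exp_le.
  have c0 : 0 <= t ^+ n.+1 * C by rewrite mulr_ge0 // exprn_ge0 // ltW.
  apply: abs_leM _ c0 expM => m; rewrite nc_real ger0_norm ?divr_ge0 ?exprn_ge0 // /d.
  have rhs0 : 0 <= t ^+ n.+1 * C * (M ^+ m / m`!%:R).
    by apply: mulr_ge0; [rewrite mulr_ge0 // exprn_ge0 // ltW | rewrite divr_ge0 ?exprn_ge0].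
  case: eqP => [->|/eqP mn] in rhs0 *; first by rewrite mulN1r subrr nc0.
  rewrite mulr0 addr0 ncM nc_ecoef gtr0_norm //.
  (* Terms below [n] vanish by induction; above [n], [t <= 1] gives [t^m <= t^(n+1)]. *)
  case: (ltngtP m n) mn => // [/IH -> _|nm _]; first by rewrite nc0 mulr0.
  have -> : t ^+ n.+1 * C * (M ^+ m / m`!%:R) = t ^+ n.+1 / m`!%:R * (C * M ^+ m) by ring.
  apply: ler_pM; rewrite ?nc_ge0 ?divr_ge0 ?exprn_ge0 ?(ltW t0) //.
  rewrite ler_wpM2r // -(subnK nm) exprD ler_piMl ?exprn_ge0 ?(ltW t0) //.
  by rewrite exprn_ile1 // ltW.
have := has_sum_le gsum gle; rewrite mulN1r ncN ncM nc_ecoef gtr0_norm //.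
rewrite exprS -[_ / _ * _]mulrA -!mulrA [t * (_ * _)]mulrCA ler_pM2l ?exprn_gt0 //.
rewrite ler_pdivrMl ?ltr0n ?fact_gt0 // => /le_trans; apply.
by apply: le_trans tL; rewrite /L mulrCA.
Qed.

Lemma kpow_ge0 (X : choiceType) (g : X -> X -> R[i]) M n v w :
  krow g M -> 0 <= M -> (forall v w, 0 <= g v w) -> 0 <= kpow g n v w.
Proof.
move=> gM M0 g0; elim: n v => [|n IH] v; first by rewrite /= /kid ler0n.
have s := kmul_summable v w gM (exprn_ge0 n M0) (krow_bd (krow_kpow gM M0 n)).
by apply: has_sum_ge0 (usumP s) _ => u; rewrite mulr_ge0.
Qed.

(** The product of the entries along the path is one of the nonnegative terms that make up the entry
    of the power. *)
Lemma kpow_path (X : choiceType) (g : X -> X -> R[i]) M v (p : seq X) :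
  krow g M -> 0 <= M -> (forall v w, 0 <= g v w) ->
  path (fun u w => 0 < g u w) v p -> 0 < kpow g (size p) v (last v p).
Proof.
move=> gM M0 g0; elim: p v => [|u p IH] v /=; first by rewrite /kid eqxx ltr01.
move=> /andP[vu /IH up].
have s := kmul_summable v (last u p) gM (exprn_ge0 (size p) M0)
  (krow_bd (krow_kpow gM M0 (size p))).
apply: lt_le_trans (has_sum_ge_term u (usumP s) _); first exact: mulr_gt0.
by move=> i; rewrite mulr_ge0 // (kpow_ge0 _ _ _ gM).
Qed.

Section ScalarShift.
Variables (X : choiceType) (h : X -> X -> R[i]) (M : R) (c : R[i]).
Hypotheses (h_row : krow h M) (M_ge0 : 0 <= M).

Definition kshift v w := h v w + c * kid R v w.

Lemma krow_kshift : krow kshift (M + nc c).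
Proof.
move=> v; apply: abs_leD => //; rewrite -[nc c]mulr1; apply: abs_leZ; exact: krow_kid.
Qed.

Lemma kmul_kshift (B : X -> X -> R[i]) b : 0 <= b -> kbd B b ->
  kmul kshift B = fun v w => kmul h B v w + c * B v w.
Proof.
move=> b0 Bb; apply/funext => v; apply/funext => w.
have s1 := kmul_summable v w h_row b0 Bb.
have s2 := kmul_summable v w (@krow_kid R X) b0 Bb.
have e : usum (fun u => kid R v u * B u w) = B v w.
  exact: (congr1 (fun A => A v w) (kmul1l B)).
apply: usum_has_sum; have := has_sumD (usumP s1) (has_sumZ c (usumP s2)).
by rewrite e; congr has_sum; apply/funext => u; rewrite mulrA -mulrDl.
Qed.

(* The powers of [h + c] are linear combinations of those of [h]. *)
Lemma kpow_kshift_ind (L : (X -> X -> R[i]) -> R[i]) :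
  (forall n, L (kpow h n) = 0) ->
  (forall B C b, 0 <= b -> kbd B b -> kbd C b -> L B = 0 -> L C = 0 ->
    L (fun v w => B v w + c * C v w) = 0) ->
  forall n, L (kpow kshift n) = 0.
Proof.
move=> L0 LD n; rewrite -[kpow _ n]kmul1r -[kid R (X := X)]/(kpow h 0).
have Mc0 : 0 <= M + nc c by rewrite addr_ge0 ?nc_ge0.
have sr m := krow_kpow krow_kshift Mc0 m.
(* The induction runs over the products of [kpow kshift n] and [kpow h m]: each step trades one
   factor [kshift] for [h] or the scalar [c]. *)
elim: n (0%N) => [|n IH] m; first by rewrite kmul1l.
have hb k : kbd (kpow h k) (M ^+ k) by exact/krow_bd/krow_kpow.
have -> : kpow kshift n.+1 = kmul (kpow kshift n) kshift.
  by rewrite -[X in kmul _ X]kmul1r -[kmul kshift _]/(kpow kshift 1)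
    (kmul_kpow krow_kshift Mc0) addn1.
rewrite -(kmul_assoc_rrb (sr n) Mc0 krow_kshift (exprn_ge0 m M_ge0) (hb m)).
rewrite (kmul_kshift (exprn_ge0 m M_ge0) (hb m)) -[kmul h _]/(kpow h m.+1).
pose b := M ^+ m.+1 + nc c * M ^+ m.
have cb : kbd (fun v w => c * kpow h m v w) (nc c * M ^+ m).
  by move=> v w; rewrite ncM ler_wpM2l ?nc_ge0 ?hb.
rewrite (kmulDr (sr n) (exprn_ge0 m.+1 M_ge0) (hb m.+1) _ cb); last first.
  by rewrite mulr_ge0 ?nc_ge0 ?exprn_ge0.
have -> : kmul (kpow kshift n) (fun u w => c * kpow h m u w) =
    fun v w => c * kmul (kpow kshift n) (kpow h m) v w.
  apply/funext => v; apply/funext => w.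
  rewrite -(usumZ _ (kmul_summable v w (sr n) (exprn_ge0 m M_ge0) (hb m))).
  by apply: eq_usum => u; rewrite mulrCA.
have kb k := kmul_bd (sr n) (exprn_ge0 k M_ge0) (hb k).
pose b' := M ^+ m.+1 * (M + nc c) ^+ n + M ^+ m * (M + nc c) ^+ n.
have p0 k : 0 <= M ^+ k * (M + nc c) ^+ n by rewrite mulr_ge0 ?exprn_ge0.
apply: (LD _ _ b'); rewrite ?IH ?addr_ge0 //.
  by move=> v w; apply: le_trans (kb m.+1 v w) _; rewrite lerDl.
by move=> v w; apply: le_trans (kb m v w) _; rewrite lerDr.
Qed.

End ScalarShift.
End PowerFacts.

(** * Linear growth of the drift *)

Section Dynamics.
Variables (R : realType) (P : finType) (K : zmodType).
Local Notation X := (P * K)%type.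
Variables (h : X -> X -> R[i]) (M : R) (x : K -> R) (r0 : R).
Hypotheses (h_row : krow h M) (M_ge1 : 1 <= M) (h_sym : ksym h)
  (h_real : forall v w, (h v w)^*%C = h v w) (h_per : periodic h)
  (xD : forall k l, x (k + l) = x k + x l)
  (r0_ge0 : 0 <= r0) (Dh : l2le (tau (deriv x h)) r0).
Implicit Types (s t e : R) (n m : nat) (q : P) (k : K) (B : X -> X -> R[i]).

Let M_ge0 : 0 <= M. Proof. exact: le_trans ler01 M_ge1. Qed.

Local Notation W := (kexp h).
Local Notation DW t := (deriv x (kexp h t)).

Let W_row t : krow (W t) (kexpM M t). Proof. exact: krow_kexp. Qed.
Let W_sym t : ksym (W t). Proof. exact: (kexp_sym h_row M_ge0 h_sym). Qed.
Let W_col t : kcol (W t) (kexpM M t). Proof. exact: ksym_col. Qed.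
Let kpow_col n : kcol (kpow h n) (M ^+ n).
Proof. by apply: ksym_col; [exact: (kpow_sym h_row M_ge0 h_sym) | exact: krow_kpow]. Qed.

Lemma periodic_kpow n : periodic (kpow h n).
Proof.
elim: n => [|n IH]; first exact: periodic_kid.
apply: (periodic_kmul (a := M) (b := M ^+ n)) => //; first exact: exprn_ge0.
exact/krow_bd/krow_kpow.
Qed.

Lemma periodic_kexp t : periodic (W t).
Proof. by move=> k v w; rewrite !kexpE; apply: eq_usum => n; rewrite periodic_kpow. Qed.

(** As [h] is real and symmetric, the adjoint of [kexp h t] is [kexp h (- t)], its inverse, so the
    columns are orthonormal. *)
Lemma contr_kexp t : contr (W t) 1.
Proof.
apply: contr_unitary => a b.
have -> : (fun v => (W t v a)^*%C * W t v b) = fun v => W (- t) a v * W t v b.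
  by apply/funext => v; rewrite (kexp_conj _ _ _ h_row) // W_sym.
rewrite -(kexpK h_row M_ge0 t); apply: usumP.
exact: (kmul_summable _ _ (W_row (- t)) (kexpM_ge0 M t) (krow_bd (W_row t))).
Qed.

(** Leibniz rule with Schur bounds. Since [M >= 1], doubling [M] absorbs the new term at each step
    and keeps the bound geometric, ready to be summed against the exponential coefficients. *)
Lemma l2le_deriv_kpow n : l2le (tau (deriv x (kpow h n))) ((2 * M) ^+ n * r0).
Proof.
elim: n => [|n IH].
  rewrite /= deriv_kid mul1r => A; rewrite big1 ?sqr_ge0 // => p _.
  by rewrite /tau nc0 expr0n.
have pw m : 0 <= (2 * M) ^+ m * r0 by rewrite mulr_ge0 // exprn_ge0 // mulr_ge0.
have dh : kbd (deriv x h) r0 by apply: tau_bd => //; exact: periodic_deriv.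
have dn : kbd (deriv x (kpow h n)) ((2 * M) ^+ n * r0).
  by apply: tau_bd => //; apply: periodic_deriv => //; exact: periodic_kpow.
rewrite /= (deriv_kmul h_row (kpow_col n) r0_ge0 dh (pw n) dn).
have l1 : l2le (tau (kmul (deriv x h) (kpow h n))) (M ^+ n * r0).
  apply: (l2le_tau_kmul_r (a := M ^+ n)) => //.
  - by apply: contr_schur => //; exact: krow_kpow.
  - exact: exprn_ge0.
  - exact: krow_kpow.
  - exact: (kpow_sym h_row M_ge0 h_sym).
  - exact: periodic_kpow.
  - exact: periodic_deriv.
have l2 : l2le (tau (kmul h (deriv x (kpow h n)))) (M * ((2 * M) ^+ n * r0)).
  by apply: (l2le_tau_kmul (a := M)) => //; apply: contr_schur => //; exact: ksym_col.
have c1 : 0 <= M ^+ n * r0 by rewrite mulr_ge0 // exprn_ge0.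
have c2 : 0 <= M * ((2 * M) ^+ n * r0) by rewrite mulr_ge0.
apply: l2leW _ (l2leD c1 c2 l1 l2); first exact: addr_ge0.
rewrite exprS [M * _]mulrA -mulrDl ler_wpM2r //.
have : M ^+ n <= (2 * M) ^+ n by rewrite lerXn2r ?nnegrE ?mulr_ge0 //; have := M_ge0; lra.
have : 0 <= (2 * M) ^+ n * (M - 1).
  by rewrite mulr_ge0 ?subr_ge0 // exprn_ge0 // mulr_ge0.
lra.
Qed.

Definition kexp_drift t := expR (`|t| * (2 * M)) * r0.

Lemma kexp_drift_ge0 t : 0 <= kexp_drift t.
Proof. by rewrite mulr_ge0 ?expR_ge0. Qed.

Lemma l2le_deriv_kexp t : l2le (tau (DW t)) (kexp_drift t).
Proof.
have -> : tau (DW t) = fun p => usum (fun n => ecoef t n * tau (deriv x (kpow h n)) p).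
  apply/funext => p; rewrite /tau /deriv kexpE -(usumZ _ (kexp_summable h_row M_ge0 t _ _)).
  by apply: eq_usum => n; rewrite mulrCA.
have pw m : 0 <= (2 * M) ^+ m * r0 by rewrite mulr_ge0 // exprn_ge0 // mulr_ge0.
apply: (l2le_usum (r := fun n => nc (ecoef t n) * ((2 * M) ^+ n * r0))).
- by move=> n; rewrite mulr_ge0 ?nc_ge0.
- by move=> n; apply: l2leZ; exact: l2le_deriv_kpow.
move=> A; rewrite (eq_bigr (fun n => (`|t| * (2 * M)) ^+ n / n`!%:R * r0)).
  by rewrite -mulr_suml ler_wpM2r //; apply: sum_exp_le; rewrite !mulr_ge0.
by move=> n _; rewrite nc_ecoef [(`|t| * _) ^+ _]exprMn mulrA; congr (_ * _); exact: mulrAC.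
Qed.

Lemma periodic_deriv_kexp t : periodic (DW t).
Proof. by apply: periodic_deriv => //; exact: periodic_kexp. Qed.

Let DW_bd t : kbd (DW t) (kexp_drift t).
Proof.
apply: tau_bd; [exact: periodic_deriv_kexp | exact: kexp_drift_ge0 | exact: l2le_deriv_kexp].
Qed.

Lemma deriv_kexpD s t :
  DW (s + t) = fun v w => kmul (DW s) (W t) v w + kmul (W s) (DW t) v w.
Proof.
rewrite -(kexpD h_row M_ge0).
exact: (deriv_kmul (W_row s) (W_col t) (kexp_drift_ge0 s) (DW_bd s)
  (kexp_drift_ge0 t) (DW_bd t)).
Qed.

(** Finite Hilbert-Schmidt norm per unit cell, [nrm (tau B)] being that norm. *)
Definition hs B := periodic B /\ l2 (tau B).

Lemma hs_bd B : hs B -> kbd B (nrm (tau B)).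
Proof. by move=> [perB l2B]; apply: tau_bd => //; [exact: nrm_ge0 | exact: nrmP]. Qed.

Lemma hs_deriv_kexp t : hs (DW t).
Proof.
split; first exact: periodic_deriv_kexp.
by exists (kexp_drift t); [exact: kexp_drift_ge0 | exact: l2le_deriv_kexp].
Qed.

Lemma hs_kexp_l t B : hs B -> hs (kmul (W t) B) /\ nrm (tau (kmul (W t) B)) <= nrm (tau B).
Proof.
move=> hsB; have [perB l2B] := hsB.
have le1 : l2le (tau (kmul (W t) B)) (nrm (tau B)).
  rewrite -[nrm _]mul1r; apply: (l2le_tau_kmul (contr_kexp t) ler01 (W_row t)).
    exact: nrm_ge0.
  exact: nrmP.
split; last by apply: nrm_le => //; exact: nrm_ge0.
split; last by exists (nrm (tau B)) => //; exact: nrm_ge0.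
apply: (periodic_kmul _ perB (W_row t) (nrm_ge0 (tau B)) (hs_bd hsB)).
exact: periodic_kexp.
Qed.

Lemma hs_kexp_r t B : hs B -> hs (kmul B (W t)) /\ nrm (tau (kmul B (W t))) <= nrm (tau B).
Proof.
move=> hsB; have [perB l2B] := hsB.
have le1 : l2le (tau (kmul B (W t))) (nrm (tau B)).
  rewrite -[nrm _]mul1r.
  apply: (l2le_tau_kmul_r (contr_kexp t) ler01 (W_row t) (W_sym t) (@periodic_kexp t) perB).
    exact: nrm_ge0.
  exact: nrmP.
split; last by apply: nrm_le => //; exact: nrm_ge0.
split; last by exists (nrm (tau B)) => //; exact: nrm_ge0.
apply: (periodic_kmul_col perB _ (nrm_ge0 (tau B)) (hs_bd hsB) (W_col t)).
exact: periodic_kexp.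
Qed.

Lemma kexp_kmulA s t B c : 0 <= c -> kbd B c ->
  kmul (W s) (kmul (W t) B) = kmul (W (s + t)) B.
Proof.
move=> c0 Bc; rewrite -(kexpD h_row M_ge0).
exact: (kmul_assoc_rrb (W_row s) (kexpM_ge0 M t) (W_row t) c0 Bc).
Qed.

(** Both [kexp h t] and its inverse [kexp h (- t)] are contractions, whence equality. *)
Lemma nrm_col_kexp t B q : hs B ->
  nrm (fun v => kmul (W t) B v (q, 0)) = nrm (fun v => B v (q, 0)).
Proof.
have le1 s C : hs C -> nrm (fun v => kmul (W s) C v (q, 0)) <= nrm (fun v => C v (q, 0)).
  move=> [_ l2C]; apply: nrm_le; first exact: nrm_ge0.
  rewrite -[nrm _]mul1r.
  apply: (contr_l2le_vec (contr_kexp s) ler01 (W_row s)); first exact: nrm_ge0.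
  apply: nrmP; have [r r_0 Cr] := l2C; exists r => //; exact: l2le_col.
move=> hsB; apply/eqP; rewrite eq_le le1 //=.
have := le1 (- t) _ (hs_kexp_l t hsB).1.
by rewrite (kexp_kmulA _ _ (nrm_ge0 _) (hs_bd hsB)) (addNr t) kexp0 kmul1l.
Qed.

Lemma tauMn B n : tau (B *+ n) = fun p => tau B p *+ n.
Proof.
apply/funext => p; elim: n => [|n IH]; first by rewrite !mulr0n.
by rewrite !mulrS -IH.
Qed.

Definition conjugate B := kmul (W (-1)) (kmul B (W 1)).

(** The left factor leaves column norms unchanged, so the columns have norm [drift], while the
    Leibniz rule turns the family into a Birkhoff sum. *)
Definition cocycle n := kmul (W (- n%:R)) (DW n%:R).

Lemma hs_conjugate B : hs B -> hs (conjugate B).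
Proof. by move=> hsB; apply: (hs_kexp_l _ _).1; exact: (hs_kexp_r _ _).1. Qed.

Lemma nrm_conjugate B : hs B -> nrm (tau (conjugate B)) <= nrm (tau B).
Proof.
move=> hsB; have [hsB1 le1] := hs_kexp_r 1 hsB.
exact: le_trans (hs_kexp_l _ hsB1).2 le1.
Qed.

Lemma conjugateD B C : hs B -> hs C -> conjugate (B + C) = conjugate B + conjugate C.
Proof.
move=> hsB hsC; rewrite /conjugate.
have -> : kmul (B + C) (W 1) = kmul B (W 1) + kmul C (W 1).
  apply/funext => v; apply/funext => w.
  rewrite -[RHS](usumD (kmul_summable_col v w (nrm_ge0 _) (hs_bd hsB) (W_col 1))
    (kmul_summable_col v w (nrm_ge0 _) (hs_bd hsC) (W_col 1))).
  by apply: eq_usum => u; rewrite -mulrDl.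
exact: (kmulDr (W_row (-1)) (nrm_ge0 _) (hs_bd (hs_kexp_r 1 hsB).1)
  (nrm_ge0 _) (hs_bd (hs_kexp_r 1 hsC).1)).
Qed.

Lemma hs0 : hs 0.
Proof.
split=> //; exists 0 => // A; rewrite big1 ?sqr_ge0 // => p _.
by rewrite -[tau 0 p]/(0 : R[i]) nc0 expr0n.
Qed.

Lemma hsD B C : hs B -> hs C -> hs (B + C).
Proof.
move=> [perB l2B] [perC l2C]; split; last exact: l2D.
by move=> k v w; rewrite /= -[LHS]/(B _ _ + C _ _) perB perC.
Qed.

Lemma hsN B : hs B -> hs (- B).
Proof.
move=> [perB [r r_0 l2B]]; split; first by move=> k v w; rewrite -[LHS]/(- B _ _) perB.
exists r => // A; have := l2B A; congr (_ <= _); apply: eq_bigr => p _.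
by rewrite -[tau (- B) p]/(- tau B p) ncN.
Qed.

(** The Leibniz rule for [n + 1] gives [cocycle (n + 1) = cocycle 1 + conjugate (cocycle n)]. *)
Lemma cocycle_sum n : cocycle n = \sum_(m < n) iter m conjugate (cocycle 1).
Proof.
have hs1 : hs (cocycle 1) by apply: (hs_kexp_l _ _).1; exact: hs_deriv_kexp.
have hs_it m : hs (iter m conjugate (cocycle 1)).
  by elim: m => [//|m IHm]; rewrite iterS; exact: hs_conjugate.
have conj0 : conjugate 0 = 0.
  have := conjugateD hs0 hs0; rewrite addr0 => /eqP.
  by rewrite -subr_eq0 opprD addrA subrr sub0r oppr_eq0 => /eqP.
elim: n => [|n IH].
  rewrite big_ord0 /cocycle oppr0 kexp0 kmul1l deriv_kid //.
rewrite big_ord_recl /=.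
have -> : \sum_(i < n) iter (bump 0 i) conjugate (cocycle 1) = conjugate (cocycle n).
  rewrite IH; apply/esym; elim: (n) => [|m IHm]; first by rewrite !big_ord0 conj0.
  rewrite !big_ord_recr /= conjugateD ?IHm //.
  by elim/big_rec: _ => [|i B _]; [exact: hs0 | exact: hsD].
have hsDn := hs_deriv_kexp n%:R.
have hsD1 := hs_deriv_kexp 1.
rewrite {1}/cocycle -natr1 deriv_kexpD.
have [hsl _] := hs_kexp_r 1 hsDn; have [hsr _] := hs_kexp_l n%:R hsD1.
rewrite (kmulDr (W_row _) (nrm_ge0 _) (hs_bd hsl) (nrm_ge0 _) (hs_bd hsr)).
rewrite (kexp_kmulA _ _ (nrm_ge0 _) (hs_bd hsD1)).
have -> : - (n%:R + 1) + n%:R = -1 :> R by ring.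
have -> : - (n%:R + 1) = -1 + - n%:R :> R by ring.
rewrite -(kexp_kmulA _ _ (nrm_ge0 _) (hs_bd hsl)).
rewrite (kmul_assoc_rbc (W_row _) (nrm_ge0 _) (hs_bd hsDn) (W_col 1)).
by apply/funext => v; apply/funext => w; exact: addrC.
Qed.

(* [drift q t] is the l2 norm of [(x - x(w)) e^{-itH} delta_w] for [w = (q, 0)]. *)
Definition drift q t := nrm (fun v => DW t v (q, 0)).

Lemma drift_ge0 q t : 0 <= drift q t. Proof. exact: nrm_ge0. Qed.

Let col_l2 B q : hs B -> l2 (fun v => B v (q, 0)).
Proof. by move=> [_ [r r_0 Br]]; exists r => //; exact: l2le_col. Qed.

(** A single column of a kernel is dominated by its norm over the cell, so the ergodic estimate
    passes to each layer by the reverse triangle inequality. *)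
Lemma drift_cauchy q e : 0 < e -> exists n0, forall n m, (n0 <= n)%N -> (n0 <= m)%N ->
  `|m%:R * drift q n%:R - n%:R * drift q m%:R| <= e * (n%:R * m%:R).
Proof.
move=> e0.
have hs1 : hs (cocycle 1) by apply: (hs_kexp_l _ _).1; exact: hs_deriv_kexp.
have NMn B n : hs B -> nrm (tau (B *+ n)) = n%:R * nrm (tau B).
  by move=> [_ l2B]; rewrite tauMn nrmMn.
have [n0 hn0] := @mean_ergodic R _ hs (fun B => nrm (tau B)) conjugate hs0 hsD hsN
  (fun B => nrm_ge0 _) (fun B C hB hC => nrmD hB.2 hC.2)
  (fun B => nrmN _) NMn
  (fun B C hB hC => nrm_par hB.2 hC.2) hs_conjugate conjugateD nrm_conjugate
  (cocycle 1) hs1 e e0.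
have hsc n : hs (cocycle n) by apply: (hs_kexp_l _ _).1; exact: hs_deriv_kexp.
have dE n : drift q n%:R = nrm (fun v => cocycle n v (q, 0)).
  by rewrite /cocycle nrm_col_kexp //; exact: hs_deriv_kexp.
have tri (f g : X -> R[i]) : l2 f -> l2 g ->
    nrm f <= nrm g + nrm (fun v => f v - g v).
  move=> f2 g2; have fg2 : l2 (fun v => f v - g v).
    have := l2D f2 (l2Z (-1) g2); congr l2; apply/funext => v; by rewrite mulN1r.
  have := nrmD g2 fg2; congr (nrm _ <= _); apply/funext => v; ring.
exists n0 => n m /hn0 /[apply]; rewrite -!cocycle_sum => le1.
have colM a (k : nat) : hs a -> nrm (fun v => (a *+ k) v (q, 0)) = k%:R * nrm (fun v => a v (q, 0)).
  move=> hsa; rewrite -nrmMn; last exact: col_l2.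
  congr nrm; apply/funext => v; elim: k => [|k IH]; first by rewrite !mulr0n.
  by rewrite !mulrS -IH.
have hsM a (k : nat) : hs a -> hs (a *+ k).
  by move=> hsa; elim: k => [|k IH]; [exact: hs0 | rewrite mulrS; exact: hsD].
have col_le a : hs a -> nrm (fun v => a v (q, 0)) <= nrm (tau a).
  move=> [_ l2a]; apply: nrm_le; first exact: nrm_ge0.
  exact: l2le_col (nrmP l2a).
rewrite !dE -!colM //.
have h1 := tri _ _ (col_l2 q (hsM _ m (hsc n))) (col_l2 q (hsM _ n (hsc m))).
have h2 := tri _ _ (col_l2 q (hsM _ n (hsc m))) (col_l2 q (hsM _ m (hsc n))).
have h3 := le_trans (col_le _ (hsD (hsM _ m (hsc n)) (hsN (hsM _ n (hsc m))))) le1.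
have h4 : nrm (fun v => (cocycle m *+ n) v (q, 0) - (cocycle n *+ m) v (q, 0)) =
    nrm (fun v => (cocycle n *+ m) v (q, 0) - (cocycle m *+ n) v (q, 0)).
  rewrite -[LHS]nrmN; congr nrm; apply/funext => v; ring.
rewrite h4 in h2; rewrite ler_norml.
move: h3; rewrite -[X in nrm X <= _]/(fun v => (cocycle n *+ m) v (q, 0) - (cocycle m *+ n) v (q, 0)).
move: h1 h2; set a := nrm _; set b := nrm _; set c := nrm _.
by move=> h1 h2 h3; apply/andP; split; lra.
Qed.

(** Of the two Leibniz terms, one has exactly the norm [drift q n%:R] and the other is bounded by
    the derivation of [kexp h s], uniformly for [s] in the unit interval. *)
Lemma drift_near_nat q n s : 0 <= s -> s <= 1 ->
  `|drift q (s + n%:R) - drift q n%:R| <= kexp_drift 1.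
Proof.
move=> s0 s1; rewrite {1}/drift deriv_kexpD.
have hsDs := hs_deriv_kexp s; have hsDn := hs_deriv_kexp n%:R.
have [hsr ler] := hs_kexp_r n%:R hsDs; have [hsl _] := hs_kexp_l s hsDn.
have <- : nrm (fun v => kmul (W s) (DW n%:R) v (q, 0)) = drift q n%:R by exact: nrm_col_kexp.
have small : nrm (fun v => kmul (DW s) (W n%:R) v (q, 0)) <= kexp_drift 1.
  apply: (@le_trans _ _ (nrm (tau (DW s)))); last first.
    apply: (@le_trans _ _ (kexp_drift s)).
      by apply: nrm_le; [exact: kexp_drift_ge0 | exact: l2le_deriv_kexp].
    rewrite ler_wpM2r // ler_expR ler_wpM2r ?mulr_ge0 //.
    by rewrite normr1 ger0_norm.
  apply: le_trans ler; apply: nrm_le; first exact: nrm_ge0.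
  exact: l2le_col (nrmP hsr.2).
have h1 := nrmD (col_l2 q hsr) (col_l2 q hsl).
have h2 := nrmD (l2D (col_l2 q hsr) (col_l2 q hsl)) (l2Z (-1) (col_l2 q hsr)).
have e1 : (fun v => kmul (DW s) (W n%:R) v (q, 0) + kmul (W s) (DW n%:R) v (q, 0) +
    -1 * kmul (DW s) (W n%:R) v (q, 0)) = fun v => kmul (W s) (DW n%:R) v (q, 0).
  by apply/funext => v; ring.
have e2 : nrm (fun v => -1 * kmul (DW s) (W n%:R) v (q, 0)) =
    nrm (fun v => kmul (DW s) (W n%:R) v (q, 0)).
  by rewrite -[RHS]nrmN; congr nrm; apply/funext => v; rewrite mulN1r.
rewrite e1 e2 in h2; rewrite ler_norml; apply/andP; split; lra.
Qed.

Lemma drift_limit q : exists2 l, 0 <= l & forall e, 0 < e ->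
  exists2 t0, 0 < t0 & forall t, t0 <= t -> `|drift q t - l * t| <= e * t.
Proof.
pose u n := drift q n.+1%:R / n.+1%:R.
have frac (a b c d : R) : 0 < c -> 0 < d -> (d * a - c * b) / (c * d) = a / c - b / d.
  by move=> c0 d0; field; rewrite !gt_eqF.
have uc e : 0 < e -> exists n0, forall n m, (n0 <= n)%N -> (n0 <= m)%N -> `|u n - u m| <= e.
  move=> /(drift_cauchy q)[n0 hn0]; exists n0 => n m le_n le_m.
  have := hn0 n.+1 m.+1 (leqW le_n) (leqW le_m).
  have n0' : 0 < n.+1%:R * m.+1%:R :> R by rewrite mulr_gt0.
  rewrite -ler_pdivrMr // -{1}(gtr0_norm n0') -normfV -normrM.
  by rewrite frac ?ltr0n.
have : cvgn u.
  apply/cauchy_cvgP/cauchy_exP => e e0.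
  have [n0 hn0] := uc _ (divr_gt0 e0 (ltr0Sn R 1)).
  exists (u n0); exists n0 => // n /= le_n; rewrite -ball_normE /=.
  apply: le_lt_trans (hn0 n0 n (leqnn _) le_n) _.
  by rewrite ltr_pdivrMr // ltr_pMr // ltr1n.
move=> /cvg_ex[/= l ul].
have ule e : 0 < e -> exists n0, forall n, (n0 <= n)%N -> `|u n - l| <= e.
  move=> e0; have /cvgrPdist_le/(_ e e0)[n0 _ hn0] := ul.
  by exists n0 => n le_n; rewrite distrC; exact: hn0.
have l0 : 0 <= l.
  apply/ler_addgt0Pl => e /ule[n0 /(_ n0 (leqnn _))].
  have : 0 <= u n0 by rewrite divr_ge0 ?drift_ge0.
  by rewrite ler_norml => ? /andP[]; lra.
exists l => // e e0; have e2 : 0 < e / 2 by rewrite divr_gt0.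
have [n0 hn0] := ule _ e2.
have C0 := kexp_drift_ge0 1.
(* The first summand makes the integer part of [t] a successor [n.+1] with [n0 <= n]; the second
   lets [e / 2] times [t] absorb the interpolation errors [kexp_drift 1] and [l]. *)
exists (n0.+2%:R + (kexp_drift 1 + l) / (e / 2)) => [|t].
  by rewrite ltr_pwDl // divr_ge0 ?addr_ge0 // ltW.
move=> le_t; have t0 : 0 <= t.
  by apply: le_trans le_t; rewrite addr_ge0 // divr_ge0 ?addr_ge0 // ltW.
have le_n0 : n0.+2%:R <= t.
  by apply: le_trans le_t; rewrite lerDl divr_ge0 ?addr_ge0 // ltW.
have : (kexp_drift 1 + l) / (e / 2) <= t by apply: le_trans le_t; rewrite lerDr.
rewrite ler_pdivrMr // => le_C.
have /andP[n_le n_gt] := truncn_itv t0; set n := Num.truncn t in n_le n_gt.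
have n_ge : (n0.+1 < n.+1)%N by rewrite -(ltr_nat R); apply: le_lt_trans n_gt; rewrite (le_trans _ le_n0) // ler_nat.
have s0 : 0 <= t - n%:R by rewrite subr_ge0.
have s1 : t - n%:R <= 1 by rewrite -natr1 in n_gt; lra.
have h1 := drift_near_nat q n s0 s1; rewrite subrK in h1.
case: n => [//|n] in n_le n_gt n_ge s0 s1 h1 *.
have h2 := hn0 n n_ge.
have n1 : 0 < n.+1%:R :> R by rewrite ltr0n.
have h3 : `|drift q n.+1%:R - l * n.+1%:R| <= e / 2 * n.+1%:R.
  have -> : drift q n.+1%:R - l * n.+1%:R = (u n - l) * n.+1%:R.
    by rewrite /u mulrBl divfK // lt0r_neq0.
  by rewrite normrM (gtr0_norm n1) ler_wpM2r // ltW.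
have h4 : l * (t - n.+1%:R) <= l by rewrite ler_piMr.
have h5 : 0 <= l * (t - n.+1%:R) by rewrite mulr_ge0.
have h6 : e / 2 * n.+1%:R <= e / 2 * t by rewrite ler_wpM2l // ltW.
move: h1 h3; rewrite !ler_norml => /andP[? ?] /andP[? ?]; apply/andP; split; lra.
Qed.

Lemma trace_kmul0 k t : trace_at k (kmul (W t) (fun _ _ => 0)) = 0.
Proof.
rewrite /trace_at big1 // => q _; rewrite /kmul.
by under eq_fun do rewrite mulr0; exact: usum0.
Qed.

Lemma kmul_kexpK_r t B : hs B -> kmul (kmul B (W t)) (W (- t)) = B.
Proof.
move=> hsB; have trW s : ktr (W s) = W s.
  by apply/funext => v; apply/funext => w; exact: W_sym.
have trbd : kbd (ktr B) (nrm (tau B)) by move=> v w; exact: (hs_bd hsB).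
have flip s (C : X -> X -> R[i]) : kmul C (W s) = ktr (kmul (W s) (ktr C)).
  by rewrite -[RHS]kmul_tr trW.
rewrite (flip t) (flip (- t)) -[X in kmul _ X]/(kmul (W t) (ktr B)).
by rewrite (kexp_kmulA _ _ (nrm_ge0 _) trbd) addNr kexp0 kmul1l.
Qed.

(** Each step splits off [t] by the Leibniz rule. In one term cyclicity brings [kexp h s] next to
    its inverse and leaves [trace_at k (DW t)]; the other term is the induction hypothesis. *)
Lemma trace_cocycle k t n :
  trace_at k (kmul (W (t - n%:R * t)) (DW (n%:R * t))) = n%:R * trace_at k (DW t).
Proof.
elim: n => [|n IH]; first by rewrite !mul0r kexp0 deriv_kid trace_kmul0.
have -> : n.+1%:R * t = t + n%:R * t by rewrite -natr1; ring.
have -> : t - (t + n%:R * t) = - (n%:R * t) by ring.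
set s := n%:R * t in IH *.
have hst := hs_deriv_kexp t; have hss := hs_deriv_kexp s.
have [hsl _] := hs_kexp_r s hst; have [hsr _] := hs_kexp_l t hss.
rewrite deriv_kexpD (kmulDr (W_row _) (nrm_ge0 _) (hs_bd hsl) (nrm_ge0 _) (hs_bd hsr)).
rewrite trace_atD (trace_at_mulC k (@periodic_kexp (- s)) hsl.1 (W_row _) (W_col _)
  (nrm_ge0 _) (hs_bd hsl)).
rewrite (kmul_kexpK_r s hst) (kexp_kmulA _ _ (nrm_ge0 _) (hs_bd hss)).
by rewrite [- s + t]addrC IH -natr1 mulrDl mul1r addrC.
Qed.

Lemma l2le_kexp_row t v : l2le (fun u => W t v u) 1.
Proof.
have h1 : l2le (fun u => kid R u v) 1.
  move=> A; rewrite expr1n (eq_bigr (fun u => nc (kid R v u))); first exact: krow_kid.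
  by move=> u _; rewrite /kid eq_sym; case: eqP; rewrite ?nc0 ?nc1 ?expr0n ?expr1n.
have := contr_l2le_vec (contr_kexp t) ler01 (W_row t) ler01 h1.
rewrite mulr1; congr l2le; apply/funext => u; rewrite W_sym.
exact: (congr1 (fun A => A u v) (kmul1r (W t))).
Qed.

(** Cauchy-Schwarz between a row of [kexp h s], of norm at most 1, and the column whose norm is
    [drift]. *)
Lemma trace_bound k s t :
  nc (trace_at k (kmul (W s) (DW t))) <= \sum_q drift q t.
Proof.
apply: le_trans (nc_sum _ _ _) _; apply: ler_sum => q _.
rewrite -[drift q t]mul1r; apply: usum_le.
apply: l2le_mul => //; [exact: drift_ge0 | exact: l2le_kexp_row |].
exact/nrmP/col_l2/hs_deriv_kexp.
Qed.

(** * Consequences of the absence of drift in one direction *)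

Section NoDrift.
Hypothesis sublinear : forall q e, 0 < e -> exists2 t0, 0 < t0 &
  forall t, t0 <= t -> drift q t <= e * t.
Variable k : K.
Hypothesis xk : x k != 0.

Lemma trace_kexp_eq0 t : 0 < t -> trace_at k (W t) = 0.
Proof.
move=> t0; suff : (x k)%:C * trace_at k (W t) = 0.
  by move/eqP; rewrite mulf_eq0 => /orP[|/eqP //]; rewrite eq_complex /= (negPf xk).
rewrite -trace_at_deriv // ; apply/eqP; rewrite -eq0_nc.
apply/ler_addgt0Pr => e e0; rewrite add0r.
(* With this slope the drifts of all layers at time [n t] add up to at most [n e]. *)
pose d := e / (#|P|%:R + 1) / t.
have P0 : 0 < #|P|%:R + 1 :> R by rewrite ltr_wpDl.
have d0 : 0 < d by rewrite !divr_gt0.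
have /choice[T hT] : forall q, exists T : R, 0 < T /\ forall s, T <= s -> drift q s <= d * s.
  by move=> q; have [T T0 hT] := sublinear q d0; exists T.
(* The sum of the thresholds [T q] dominates each of them, so [n t] lies beyond all thresholds at
   once. *)
pose n := (Num.truncn ((\sum_q T q) / t)).+1.
have nT q : T q <= n%:R * t.
  apply: (@le_trans _ _ (\sum_q T q)).
    rewrite (bigD1 q) //= lerDl sumr_ge0 // => q' _; exact: ltW (hT q').1.
  by rewrite -ler_pdivrMr // ltW // truncnS_gt.
have := trace_bound k (t - n%:R * t) (n%:R * t); rewrite trace_cocycle ncM nc_nat.
have sumle : \sum_q drift q (n%:R * t) <= n%:R * e.
  apply: (@le_trans _ _ (\sum_(q : P) d * (n%:R * t))).
    by apply: ler_sum => q _; apply: (hT q).2.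
  rewrite sumr_const -[leLHS]mulr_natr /d.
  have -> : e / (#|P|%:R + 1) / t * (n%:R * t) * #|P|%:R =
      n%:R * (e * (#|P|%:R / (#|P|%:R + 1))).
    by field; rewrite (gt_eqF t0) (gt_eqF P0).
  rewrite ler_wpM2l //; apply: ler_piMr; first exact: ltW.
  by rewrite ler_pdivrMr // mul1r lerDl.
by move=> /le_trans - /(_ _ sumle); rewrite ler_pM2l // ltr0n.
Qed.

Lemma trace_kpow_eq0 n : trace_at k (kpow h n) = 0.
Proof.
move: n; apply: (@ecoef_series_eq0 _ _ #|P|%:R M) => //.
  move=> n; apply: le_trans (nc_sum _ _ _) _.
  rewrite mulr_natl -sumr_const; apply: ler_sum => q _; exact: krow_bd (krow_kpow h_row M_ge0 n) _ _.
move=> t /trace_kexp_eq0 <-.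
have -> : (fun n => ecoef t n * trace_at k (kpow h n)) =
    fun n => \sum_q ecoef t n * kpow h n (q, k) (q, 0).
  by apply/funext => n; rewrite /trace_at mulr_sumr.
apply: has_sum_sum => q; rewrite kexpE; apply: usumP.
exact: kexp_summable.
Qed.

(** The diagonal entries at displacement [k] are nonnegative and sum to zero, so none can be
    positive, as a path would require. *)
Lemma no_closed_path (c : R[i]) q (p : seq X) : (forall v w, 0 <= kshift h c v w) ->
  path (fun v w => 0 < kshift h c v w) (q, k) p -> last (q, k) p <> (q, 0).
Proof.
move=> g0 kp; have Mc0 : 0 <= M + nc c by rewrite addr_ge0 ?nc_ge0.
have grow := krow_kshift c h_row.
have := kpow_path grow Mc0 g0 kp; set n := size p => pos last_p; rewrite last_p in pos.
have : trace_at k (kpow (kshift h c) n) = 0.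
  apply: (kpow_kshift_ind h_row M_ge0); first exact: trace_kpow_eq0.
  move=> B C b b0 _ _ B0 C0; rewrite trace_atD B0 add0r.
  by rewrite /trace_at -mulr_sumr -[\sum_q _]/(trace_at k C) C0 mulr0.
rewrite /trace_at (bigD1 q) //= => /eqP; rewrite addrC addr_eq0 => /eqP e.
have : 0 <= - kpow (kshift h c) n (q, k) (q, 0).
  by rewrite -e sumr_ge0 // => q' _; exact: kpow_ge0 grow Mc0 g0.
by rewrite oppr_ge0 => /(lt_le_trans pos); rewrite ltxx.
Qed.

End NoDrift.

End Dynamics.

(** * Fourier coefficients of Lipschitz functions *)

Section FourierLipschitz.
Variable R : realType.
Implicit Types (s t y : R).

Lemma cisD s t : cis (s + t) = cis s * cis t.
Proof.
by apply/eqP; rewrite eq_complex /= cosD sinD; apply/andP; split; apply/eqP; ring.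
Qed.

Lemma cis0 : cis (0 : R) = 1.
Proof. by rewrite /cis cos0 sin0. Qed.

Lemma cisN s : cis (- s) = (cis s)^*%C.
Proof. by rewrite /cis cosN sinN. Qed.

Lemma nc_cis s : nc (cis s) = 1.
Proof. by rewrite /= cos2Dsin2 sqrtr1. Qed.

Lemma cisMn s n : cis (s *+ n) = cis s ^+ n.
Proof. by elim: n => [|n IH]; rewrite ?cis0 // mulrS cisD IH exprS. Qed.

Lemma cis_2piM (m : int) : cis (2 * pi * m%:~R) = 1 :> R[i].
Proof.
have nat_case (n : nat) : cis (2 * pi * n%:R) = 1 :> R[i].
  rewrite mulr_natr cisMn (_ : cis _ = 1) ?expr1n //.
  by rewrite /cis mulr_natl cos2pi sin2pi.
case: m => n; first exact: nat_case.
by rewrite NegzE mulrNz mulrN cisN nat_case rmorph1.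
Qed.

Lemma nc_cisB1 y : nc (cis (y *+ 2) - 1) ^+ 2 = 4 * sin y ^+ 2.
Proof.
rewrite /= sqr_sqrtr ?addr_ge0 ?sqr_ge0 // oppr0 addr0 cos_mulr2n sin_mulr2n.
have := cos2Dsin2 y; move: (cos y) (sin y) => c z e.
have -> : z ^+ 2 = 1 - c ^+ 2 by lra.
have -> : ((c * z) *+ 2) ^+ 2 = 4 * c ^+ 2 * z ^+ 2 by ring.
have -> : z ^+ 2 = 1 - c ^+ 2 by lra.
ring.
Qed.

Lemma cis_sum_eq0 (N : nat) (m : int) : m != 0 -> (`|m| < N)%N ->
  \sum_(n < N) cis (2 * pi * (n%:R / N%:R * m%:~R)) = 0 :> R[i].
Proof.
move=> m0 mN; have N0 : 0 < N%:R :> R by rewrite ltr0n; case: N mN.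
set z : R[i] := cis (2 * pi * (m%:~R / N%:R)).
rewrite (eq_bigr (fun n : 'I_N => z ^+ n)); last first.
  by move=> n _; rewrite -cisMn -mulr_natr; congr cis; ring.
have zN : z ^+ N = 1.
  rewrite -cisMn -mulr_natr -[RHS](cis_2piM m); congr cis.
  by field; rewrite gt_eqF.
(* As [0 < |m| < N], the angle [pi |m| / N] lies strictly between 0 and [pi], where the sine is
   positive. *)
have z1 : z - 1 != 0.
  apply/eqP => z1; suff : 0 < nc (z - 1) ^+ 2 by rewrite z1 nc0 expr0n ltxx.
  have {z1}-> : z = cis ((pi * (m%:~R / N%:R)) *+ 2) by congr cis; rewrite -mulr_natr; ring.
  rewrite nc_cisB1 mulr_gt0 // exprn_even_gt0 //=.
  have pos : 0 < sin (pi * (`|m|%N%:R / N%:R)) :> R.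
    apply: sin_gt0_pi; rewrite mulr_gt0 ?pi_gt0 ?divr_gt0 ?ltr0n ?absz_gt0 ?(leq_trans _ mN) //=.
    by rewrite gtr_pMr ?pi_gt0 // ltr_pdivrMr // mul1r ltr_nat.
  case: (intP m) m0 pos => [//|n _|n _]; rewrite ?mulrNz ?mulNr ?mulrN ?sinN ?oppr_eq0;
    by move=> /gt_eqF ->.
apply/eqP; have := subrX1 z N; rewrite zN subrr => /esym/eqP.
by rewrite mulf_eq0 (negPf z1).
Qed.

(** By the mean value theorem the slope is a cosine at a point between 0 and 1. Only the positivity
    of [cos 1] matters later. *)
Lemma sin_ge_cos1 y : `|y| <= 1 -> cos 1 * `|y| <= `|sin y|.
Proof.
have pos t : 0 < t -> t <= 1 -> cos 1 * t <= sin t.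
  move=> t0 t1.
  have [c] : exists2 c, c \in `]0, t[ & sin t - sin 0 = cos c * (t - 0).
    apply: (MVT t0).
    by apply: continuous_subspaceT => c; exact: continuous_sin.
  rewrite in_itv /= => /andP[c0 ct]; rewrite sin0 !subr0 => ->.
  have pi1 : 1 <= pi :> R by apply: le_trans (pi_ge2 R); rewrite ler1n.
  have c_lt1 := lt_le_trans ct t1.
  have ic : c \in `[0, pi] by rewrite in_itv /= (ltW c0) (le_trans (ltW c_lt1)).
  have i1 : 1 \in `[0, pi :> R] by rewrite in_itv /= ler01.
  by rewrite ler_wpM2r ?(ltW t0) // ltW // ltr_cos.
case: (ltrgt0P y) => [y0|y0|->]; last by rewrite sin0 normr0 mulr0.
  by move=> /(pos _ y0) /le_trans; apply; exact: ler_norm.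
move=> y1; have ny : 0 < - y by rewrite oppr_gt0.
apply: le_trans (pos _ ny y1) _; rewrite sinN -normrN; exact: ler_norm.
Qed.

Lemma has_sum_tail (I : choiceType) (f : I -> R[i]) (s : R[i]) (A : {fset I}) e :
  has_sum f s ->
  (forall B : {fset I}, [disjoint A & B]%fset -> \sum_(i <- B) nc (f i) <= e) ->
  nc (s - \sum_(i <- A) f i) <= e.
Proof.
move=> fs tail; apply/ler_addgt0Pr => d /fs[B /(_ _ (fsubsetUl B A))].
rewrite (fsetU_sum f (fsubsetUr B A)); set D := (_ `\` _)%fset => le_d.
have dAD : [disjoint A & D]%fset.
  by rewrite /fdisjoint fsetIDA fsetIC -fsetIDA fsetDv fsetI0.
have -> : s - \sum_(i <- A) f i =
    \sum_(i <- D) f i - (\sum_(i <- A) f i + \sum_(i <- D) f i - s) by ring.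
apply: le_trans (ncD _ _) _; rewrite ncN; apply: lerD => //.
exact: le_trans (nc_sum _ _ _) (tail _ dAD).
Qed.

(** * Parseval's identity on a finite grid *)

Section Parseval.
Variables (K : choiceType) (kappa : K -> int).

(* Only frequencies with equal [kappa] interact; non-negative interactions can be dropped. *)
Lemma parseval_le (A : {fset K}) (c : K -> R[i]) (r : R) :
  (forall k l, kappa k = kappa l -> 0 <= (c k)^*%C * c l) -> 0 <= r ->
  (forall s, nc (\sum_(k <- A) c k * cis (2 * pi * (s * (kappa k)%:~R))) <= r) ->
  \sum_(k <- A) nc (c k) ^+ 2 <= r ^+ 2.
Proof.
move=> cpos r0 Pr.
(* With more than [2 |kappa k|] grid points for every [k], differences of frequencies stay below [N]
   in absolute value, so that distinct frequencies are exactly orthogonal on the grid. *)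
pose N := (\sum_(k <- A) 2 * `|kappa k|).+1.
have N0 : 0 < N%:R :> R by rewrite ltr0n.
have lt_kN k : k \in A -> (2 * `|kappa k| < N)%N.
  by move=> kA; rewrite ltnS (big_fsetD1 k) //= leq_addr.
have chars k l : k \in A -> l \in A ->
    \sum_(n < N) cis (2 * pi * (n%:R / N%:R * (kappa l - kappa k)%:~R)) =
    if kappa k == kappa l then N%:R else 0 :> R[i].
  move=> kA lA; case: eqP => [->|kl].
    under eq_bigr do rewrite subrr !mulr0 cis0.
    by rewrite sumr_const card_ord.
  apply: cis_sum_eq0; first by rewrite subr_eq0 eq_sym; apply/eqP.
  have := lt_kN k kA; have := lt_kN l lA.
  have := leqD_dist (kappa l) 0 (kappa k); rewrite subr0 sub0r abszN.
  lia.
pose P s := \sum_(k <- A) c k * cis (2 * pi * (s * (kappa k)%:~R)).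
have lower : (N%:R * \sum_(k <- A) nc (c k) ^+ 2)%:C <=
    (\sum_(n < N) nc (P (n%:R / N%:R)) ^+ 2)%:C.
  have -> : (\sum_(n < N) nc (P (n%:R / N%:R)) ^+ 2)%:C =
      \sum_(k <- A) \sum_(l <- A) ((c k)^*%C * c l) *
        \sum_(n < N) cis (2 * pi * (n%:R / N%:R * (kappa l - kappa k)%:~R)).
    rewrite rmorph_sum /=.
    under eq_bigr => n _ do rewrite nc_sqr rmorph_sum big_distrlr /=.
    rewrite exchange_big /=; apply: eq_bigr => k _.
    rewrite exchange_big /=; apply: eq_bigr => l _.
    rewrite mulr_sumr; apply: eq_bigr => n _.
    by rewrite conjcM -cisN intrB !mulrBr cisD; ring.
  rewrite rmorphM /= rmorph_nat rmorph_sum mulr_sumr big_seq [leRHS]big_seq.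
  apply: ler_sum => k kA; rewrite (big_fsetD1 k) //= chars // eqxx nc_sqr mulrC lerDl.
  rewrite big_seq; apply: sumr_ge0 => l; rewrite !inE => /andP[_ lA].
  by rewrite chars //; case: eqP => [/cpos cc|_]; rewrite ?mulr0 // mulr_ge0.
rewrite lecR in lower; rewrite -(ler_pM2l N0); apply: le_trans lower _.
rewrite mulr_natl -[in leRHS](card_ord N) -sumr_const; apply: ler_sum => n _.
by rewrite ler_sqr ?nnegrE ?nc_ge0 ?Pr.
Qed.

(** Parseval is applied to the increment [f (s + h) - f s], of modulus at most [L h], whose
    coefficients are [w k] times a factor depending on [kappa k] alone; [w >= 0] makes the
    interactions of equal frequencies nonnegative. *)
Lemma lipschitz_sum_sqr (w : K -> R) (M L : R) :
  (forall k, 0 <= w k) -> (forall A : {fset K}, \sum_(k <- A) w k <= M) -> 0 <= L ->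
  (forall s t, nc (usum (fun k => (w k)%:C * cis (2 * pi * (s * (kappa k)%:~R))) -
                   usum (fun k => (w k)%:C * cis (2 * pi * (t * (kappa k)%:~R))))
     <= L * `|s - t|) ->
  forall A : {fset K}, \sum_(k <- A) ((kappa k)%:~R * w k) ^+ 2 <= (L / cos 1) ^+ 2.
Proof.
move=> w0 wM L0 lip A.
have c1 := cos1_gt0 R; have pi2 := pi_ge2 R; have pi0 := pi_gt0 R.
pose S : R := \sum_(k <- A) `|(kappa k)%:~R|.
have S0 : 0 <= S by rewrite sumr_ge0.
(* The step is small enough that [pi h |kappa k| <= 1] for all [k] in [A], the range of
   [sin_ge_cos1]. *)
pose h : R := (pi * (S + 1))^-1.
have h0 : 0 < h by rewrite invr_gt0 mulr_gt0 // ltr_wpDl.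
pose f s := usum (fun k => (w k)%:C * cis (2 * pi * (s * (kappa k)%:~R))).
have fM s : abs_le (fun k => (w k)%:C * cis (2 * pi * (s * (kappa k)%:~R))) M.
  move=> B; apply: le_trans (wM B); apply: ler_sum => k _.
  by rewrite ncM nc_cis mulr1 nc_real ger0_norm.
pose c k : R[i] := (w k)%:C * (cis (2 * pi * (h * (kappa k)%:~R)) - 1).
have c2w k : nc (c k) <= 2 * w k.
  rewrite ncM nc_real ger0_norm // mulrC ler_wpM2r //.
  by apply: le_trans (ncD _ _) _; rewrite ncN nc_cis nc1.
(* Replacing the series by its finite part over [A'] costs [2 e], since coefficients of the
   increment are at most [2 w k]. *)
have main (A' : {fset K}) e : 0 < e -> (A `<=` A')%fset ->
    (forall B : {fset K}, [disjoint A' & B]%fset -> \sum_(k <- B) w k <= e) ->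
    \sum_(k <- A') nc (c k) ^+ 2 <= (L * h + 2 * e) ^+ 2.
  move=> e0 AA' tail; apply: parseval_le.
  - move=> k l kl; rewrite /c kl conjcM conjc_real.
    set z : R[i] := cis _ - 1.
    have -> : (w k)%:C * z^*%C * ((w l)%:C * z) = (w k * w l * nc z ^+ 2)%:C.
      have realM (a b : R) : (a * b)%:C = a%:C * b%:C :> R[i] by rewrite rmorphM.
      by rewrite realM nc_sqr realM; ring.
    by rewrite lecR mulr_ge0 ?sqr_ge0 // mulr_ge0.
  - by rewrite addr_ge0 ?mulr_ge0 // ltW.
  move=> s; set p := \sum_(k <- A') _.
  have gsum : has_sum (fun k => c k * cis (2 * pi * (s * (kappa k)%:~R))) (f (s + h) - f s).
    have := has_sumD (usumP (fM (s + h))) (has_sumZ (-1) (usumP (fM s))).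
    rewrite mulN1r; congr has_sum; apply/funext => k.
    rewrite [(s + h) * _]mulrDl [2 * pi * (_ + _)]mulrDr cisD /c; ring.
  have := has_sum_tail (A := A') (e := 2 * e) gsum; rewrite -/p => tail_p.
  have {}tail_p : nc (f (s + h) - f s - p) <= 2 * e.
    apply: tail_p => B dB; apply: (@le_trans _ _ (\sum_(k <- B) 2 * w k)).
      by apply: ler_sum => k _; rewrite ncM nc_cis mulr1.
    by rewrite -mulr_sumr ler_wpM2l // tail.
  have -> : p = (f (s + h) - f s) - (f (s + h) - f s - p) by ring.
  apply: le_trans (ncD _ _) _; rewrite ncN; apply: lerD => //.
  have := lip (s + h) s; have -> : s + h - s = h by ring.
  by rewrite (gtr0_norm h0).
have bound e : 0 < e -> \sum_(k <- A) nc (c k) ^+ 2 <= (L * h + 2 * e) ^+ 2.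
  move=> e0; have wM' : abs_le (fun k => (w k)%:C) M.
    by move=> B; apply: le_trans (wM B); apply: ler_sum => k _; rewrite nc_real ger0_norm.
  have [A1 tail] := abs_le_tail wM' e0.
  apply: le_trans (main (A `|` A1)%fset e e0 (fsubsetUl _ _) _).
    by apply: le_fset_sum; [exact: fsubsetUl | move=> k; exact: sqr_ge0].
  move=> B dB; have := tail B; rewrite (eq_bigr w) => [|k _]; last by rewrite nc_real ger0_norm.
  by apply; apply: fdisjointWl dB; exact: fsubsetUr.
have bound0 : \sum_(k <- A) nc (c k) ^+ 2 <= (L * h) ^+ 2.
  apply/ler_addgt0Pr => e e0.
  have Lh : 0 <= L * h by rewrite mulr_ge0 // ltW.
  pose d := Num.min 1 (e / (4 * (L * h) + 4)).
  have d0 : 0 < d by rewrite lt_min ltr01 divr_gt0 //; lra.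
  have d1 : d <= 1 by rewrite ge_min lexx.
  have de : d * (4 * (L * h) + 4) <= e by rewrite -ler_pdivlMr ?ge_min ?lexx ?orbT //; lra.
  apply: le_trans (bound d d0) _.
  have : d * d <= d * 1 by rewrite ler_wpM2l // ltW.
  by rewrite sqrrD; lra.
have term k : k \in A -> ((kappa k)%:~R * w k) ^+ 2 * (cos 1 * h) ^+ 2 <= nc (c k) ^+ 2.
  move=> kA; pose y : R := pi * (h * (kappa k)%:~R).
  have hk : `|h * (kappa k)%:~R| * pi <= 1.
    have S1 : 0 < S + 1 by rewrite ltr_wpDl.
    rewrite normrM (gtr0_norm h0) /h.
    rewrite invfM mulrAC [X in X * _]mulrAC mulVf ?gt_eqF // mul1r mulrC.
    rewrite ler_pdivrMr // mul1r.
    apply: le_trans (_ : S <= S + 1); last by rewrite lerDl.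
    exact: (le_fset_sum1 (f := fun k => `|(kappa k)%:~R| : R)).
  have y1 : `|y| <= 1 by rewrite normrM (gtr0_norm pi0) mulrC.
  have -> : c k = (w k)%:C * (cis (y *+ 2) - 1).
    by rewrite /c; congr (_ * (cis _ - 1)); rewrite /y -mulr_natr; ring.
  rewrite ncM nc_real [(`|_| * _) ^+ 2]exprMn nc_cisB1 real_normK ?num_real //.
  have := sin_ge_cos1 y1; rewrite -ler_sqr ?nnegrE ?mulr_ge0 ?(ltW c1) //.
  rewrite exprMn !real_normK ?num_real // => sy.
  have -> : ((kappa k)%:~R * w k) ^+ 2 * (cos 1 * h) ^+ 2 =
    w k ^+ 2 * (cos 1 ^+ 2 * (h * (kappa k)%:~R) ^+ 2) by ring.
  rewrite ler_wpM2l ?sqr_ge0 //; apply: le_trans (_ : 4 * (cos 1 ^+ 2 * y ^+ 2) <= _); last first.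
    by rewrite ler_wpM2l.
  have -> : 4 * (cos 1 ^+ 2 * y ^+ 2) =
    (cos 1 ^+ 2 * (h * (kappa k)%:~R) ^+ 2) * (4 * pi ^+ 2) by rewrite /y; ring.
  apply: ler_peMr; first by apply: mulr_ge0; exact: sqr_ge0.
  (* The factor [4 pi^2 >= 1] is discarded. *)
  have : 2 * 2 <= pi * pi :> R by apply: ler_pM.
  by rewrite expr2; lra.
have ch0 : 0 < (cos 1 * h) ^+ 2 by rewrite exprn_gt0 // mulr_gt0.
rewrite -(ler_pM2r ch0) mulr_suml.
apply: le_trans (_ : \sum_(k <- A) nc (c k) ^+ 2 <= _).
  by rewrite big_seq [leRHS]big_seq; exact: ler_sum.
apply: le_trans bound0 _; rewrite -exprMn le_eqVlt; apply/orP; left; apply/eqP; congr (_ ^+ 2).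
by field; rewrite gt_eqF.
Qed.

End Parseval.
End FourierLipschitz.

(** * Transport on crystals *)

Section NormSums.
Variables (R : realType) (I : choiceType).

Lemma nrm_has_sum (f : I -> R[i]) : l2 f ->
  has_sum (fun i => (nc (f i) ^+ 2)%:C) (nrm f ^+ 2)%:C.
Proof.
move=> fl2.
have fM : abs_le (fun i => (nc (f i) ^+ 2)%:C) (nrm f ^+ 2).
  move=> A; rewrite (eq_bigr (fun i => nc (f i) ^+ 2)); first exact: nrmP.
  by move=> i _; rewrite nc_real ger0_norm ?sqr_ge0.
have [s fs] := abs_le_has_sum fM.
have s0 : 0 <= s by apply: has_sum_ge0 fs _ => i; rewrite lecR sqr_ge0.
have sE : s = (complex.Re s)%:C by rewrite RRe_real // ger0_real.
have r0 : 0 <= complex.Re s by move: s0; rewrite sE lecR.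
suff <- : s = (nrm f ^+ 2)%:C by [].
apply/eqP; rewrite eq_le; apply/andP; split.
  have := has_sum_le fs fM; rewrite sE nc_real ger0_norm // lecR //.
rewrite sE lecR -(sqr_sqrtr r0) ler_sqr ?nnegrE ?sqrtr_ge0 ?nrm_ge0 //.
apply: nrm_le; first exact: sqrtr_ge0.
move=> A; rewrite sqr_sqrtr // -lecR -sE rmorph_sum.
by apply: has_sum_ge_fset fs _ => i; rewrite lecR sqr_ge0.
Qed.

Lemma nrm_bij (J : choiceType) (p : J -> I) (q : I -> J) (f : I -> R[i]) :
  cancel p q -> cancel q p -> l2 f -> nrm (fun j => f (p j)) = nrm f.
Proof.
move=> pK qK fl2; apply/eqP; rewrite eq_le nrm_inj //=; last exact: can_inj pK.
have := nrm_inj (f := fun j => f (p j)) (can_inj qK) (l2_inj (can_inj pK) fl2).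
by under eq_fun do rewrite qK.
Qed.

End NormSums.

Section PositionNorm.
Variables (R : realType) (P : finType) (d : nat).
Local Notation K := 'rV[int]_d.

(** Separates the coordinates, so that transport can be studied one direction at a time. *)
Lemma esum_position (psi : P * K -> R[i]) :
  (forall j, l2 (fun v : P * K => ((v.2 ord0 j)%:~R : R)%:C * psi v)) ->
  (\esum_(k in [set: K]) (\sum_(p : P) (\sum_(j < d) ((k ord0 j)%:~R : R) ^+ 2) *
      nc (psi (p, k)) ^+ 2)%:E)%E =
  (\sum_(j < d) nrm (fun v : P * K => ((v.2 ord0 j)%:~R : R)%:C * psi v) ^+ 2)%:E.
Proof.
move=> psi2; apply: esum_has_sum.
  move=> k; apply: sumr_ge0 => p _; rewrite mulr_ge0 ?sqr_ge0 //.
  by apply: sumr_ge0 => j _; exact: sqr_ge0.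
pose g (j : 'I_d) (v : P * K) : R := nc (((v.2 ord0 j)%:~R : R)%:C * psi v) ^+ 2.
have sumg : has_sum (fun v : P * K => \sum_(j < d) (g j v)%:C)
    (\sum_(j < d) nrm (fun v : P * K => ((v.2 ord0 j)%:~R : R)%:C * psi v) ^+ 2)%:C.
  rewrite rmorph_sum; apply: has_sum_sum => j; exact: nrm_has_sum.
have {}sumg := has_sum_reindex (p := fun v : K * P => (v.2, v.1))
  (q := fun v => (v.2, v.1)) (fun v => esym (surjective_pairing v))
  (fun v => esym (surjective_pairing v)) sumg.
have := has_sum_fubini (f := fun k p => \sum_(j < d) (g j (p, k))%:C) sumg
  (fun k => has_sum_fin _).
congr has_sum; apply/funext => k; rewrite rmorph_sum; apply: eq_bigr => p _.
rewrite -rmorph_sum mulr_suml; congr _%:C; apply: eq_bigr => j _.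
by rewrite /g ncM exprMn nc_real real_normK ?num_real.
Qed.

End PositionNorm.

(** * The Hamiltonian of a crystal as a periodic kernel *)

Section Crystal.
Variables (R : realType) (d : nat) (G : crystal R d).
Local Notation P := 'I_(nu G).
Local Notation K := 'rV[int]_d.
Local Notation X := (P * K)%type.

Definition site (v : X) : vertices G := vertex v.1 v.2.

Lemma val_site v : \val (site v) = cell v.1 + lattice_vec (period G) v.2.
Proof. by []. Qed.

Lemma lattice_vecD (k l : K) :
  lattice_vec (period G) (k + l) = lattice_vec (period G) k + lattice_vec (period G) l.
Proof.
rewrite /lattice_vec -big_split; apply: eq_bigr => i _ /=.
by rewrite mxE intrD scalerDl.
Qed.

Lemma site_bij : exists2 q : vertices G -> X, cancel site q & cancel q site.
Proof.
have : forall v : vertices G, exists p : X, site p = v.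
  move=> v; have /set_mem/cell_vertices[i [k vE]] := valP v.
  by exists (i, k); apply: val_inj.
move=> /choice[q qK]; exists q => // -[p k].
have := congr1 val (qK (site (p, k))); rewrite !val_site.
by case: (q _) => p' k' /cell_unique[/= -> ->].
Qed.

Lemma val_site_shift k v :
  \val (site (shift k v)) = \val (site v) + lattice_vec (period G) k.
Proof. by rewrite !val_site /= lattice_vecD addrA. Qed.

Lemma potential_site v : potential (site v) = potential (vertex v.1 0).
Proof.
apply: (@potential_periodic _ _ G v.2); rewrite val_site /=.
by rewrite -addrA -lattice_vecD add0r.
Qed.

Definition kham (v u : X) : R[i] :=
  (weight (site v) (site u))%:C + (v == u)%:R * (potential (site v))%:C.

Lemma kham_real v w : (kham v w)^*%C = kham v w.
Proof. by rewrite /kham rmorphD rmorphM /= rmorph_nat !oppr0. Qed.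

Lemma kham_sym : ksym kham.
Proof. by move=> v w; rewrite /kham weight_sym eq_sym; case: eqP => [->|]; rewrite ?mul0r. Qed.

Lemma kham_periodic : periodic kham.
Proof.
move=> k v w; rewrite /kham (can_eq (shiftK k)); congr (_%:C + _ * _%:C).
  by apply: weight_periodic; exact: val_site_shift.
by apply: potential_periodic; exact: val_site_shift.
Qed.

(** Summability is assumed at each vertex separately; periodicity leaves only the finitely many rows
    of the cell, whose sums add up to a uniform bound. *)
Lemma weight_row : exists2 M : R, 0 <= M &
  forall v (A : {fset X}), \sum_(u <- A) weight (site v) (site u) <= M.
Proof.
have [q sK qK] := site_bij.
pose b (p : P) := fine (\esum_(u in [set: vertices G]) (weight (vertex p 0) u)%:E)%E.
have b_fin p : ((b p)%:E = \esum_(u in [set: vertices G]) (weight (vertex p 0) u)%:E)%E.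
  rewrite fineK // ge0_fin_numE; first exact: weight_summable.
  by apply: esum_ge0 => u _; rewrite lee_fin weight_ge0.
have row p (A : {fset X}) : \sum_(u <- A) weight (site (p, 0)) (site u) <= b p.
  rewrite -lee_fin b_fin; apply: le_trans (le_esum_fset _ (site @` A)%fset).
  by rewrite big_imfset //= => u u' _ _; exact: (can_inj sK).
have b0 p : 0 <= b p by have := row p fset0; rewrite big_seq_fset0.
exists (\sum_p b p) => [|[p k] A]; first by rewrite sumr_ge0.
apply: (@le_trans _ _ (b p)); last first.
  by rewrite (bigD1 p) //= lerDl sumr_ge0.
apply: le_trans (row p (shift (- k) @` A)%fset).
rewrite big_imfset /=; last by move=> u u' _ _; exact: (can_inj (shiftNK k)).
apply: ler_sum => u _; rewrite le_eqVlt; apply/orP; left; apply/eqP.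
have -> : site (p, k) = site (shift k (p, 0)) by rewrite /shift /= add0r.
by rewrite -{1}(shiftNK k u); apply: weight_periodic; exact: val_site_shift.
Qed.

Lemma kham_row : exists2 M : R, 1 <= M & krow kham M.
Proof.
have [Mw Mw0 wM] := weight_row.
pose c := \sum_(p : P) `|potential (vertex p 0) : R|.
have pot v : `|potential (site v)| <= c.
  by rewrite potential_site /c (bigD1 v.1) //= lerDl sumr_ge0.
(* The leading 1 secures [1 <= M]. *)
exists (1 + (Mw + c)) => [|v].
  by rewrite lerDl addr_ge0 // sumr_ge0.
apply: (@abs_leW _ _ _ (Mw + c)); first by rewrite lerDr.
apply: abs_leD.
  move=> A; rewrite (eq_bigr (fun u => weight (site v) (site u))) ?wM // => u _.
  by rewrite nc_real ger0_norm ?weight_ge0.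
apply: (@abs_leW _ _ _ (nc (potential (site v))%:C * 1)); first by rewrite mulr1 nc_real.
by under eq_fun do rewrite mulrC; apply: abs_leZ; exact: krow_kid.
Qed.

Section Operator.
Variable M : R.
Hypotheses (M_ge1 : 1 <= M) (hM : krow kham M).

Let M_ge0 : 0 <= M. Proof. exact: le_trans ler01 M_ge1. Qed.

Lemma iter_hamiltonian n v w :
  iter n (@hamiltonian R d G) (delta (site w)) (site v) = kpow kham n v w.
Proof.
have [q sK qK] := site_bij.
elim: n v => [|n IH] v; first by rewrite /= /delta /kid (can_eq sK).
rewrite iterS /hamiltonian.
have s1 : abs_le (fun u => kham v u * kpow kham n u w) (M ^+ n * M).
  exact: (kmul_summable _ _ hM (exprn_ge0 n M_ge0) (krow_bd (krow_kpow hM M_ge0 n))).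
(* The operator keeps the potential outside the sum while [kham] has it on the diagonal; subtracting
   this one-term family reconciles the two. *)
pose diag u : R[i] := kid R v u * ((potential (site v))%:C * kpow kham n v w).
have dsum : has_sum diag ((potential (site v))%:C * kpow kham n v w).
  have e : diag v = (potential (site v))%:C * kpow kham n v w.
    by rewrite /diag /kid eqxx mul1r.
  rewrite -e; apply: has_sum1 => u.
  by rewrite /diag /kid eq_sym => /negPf ->; rewrite mul0r.
have wsum : has_sum (fun u => (weight (site v) (site u))%:C * kpow kham n u w)
    (usum (fun u => kham v u * kpow kham n u w) - (potential (site v))%:C * kpow kham n v w).
  have := has_sumD (usumP s1) (has_sumZ (-1) dsum); rewrite mulN1r; congr has_sum.
  apply/funext => u; rewrite /kham /diag /kid.
  by case: eqP => [<-|_]; rewrite ?mul1r ?mul0r; ring.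
have := has_sum_reindex qK sK wsum => {}wsum.
have -> : csum (fun u => (weight (site v) u)%:C * iter n (@hamiltonian R d G) (delta (site w)) u)
    = usum (fun u => kham v u * kpow kham n u w) - (potential (site v))%:C * kpow kham n v w.
  have := usum_has_sum wsum; rewrite usum.unlock => <-; congr csum; apply/funext => u.
  by rewrite -IH qK.
by rewrite IH subrK.
Qed.

Lemma propagator_site t v w :
  propagator t (delta (site w)) (site v) = kexp kham t v w.
Proof.
rewrite kexpE -(has_sum_series (usumP (kexp_summable hM M_ge0 t v w))) /propagator.
rewrite (_ : (fun N : nat => (\sum_(0 <= n < N) (0 -i* t) ^+ n / n`!%:R *
    iter n (@hamiltonian R d G) (delta (site w)) (site v) : R[i]^o)) =
  fun N : nat => (\sum_(0 <= n < N) ecoef t n * kpow kham n v w : R[i]^o)) //.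
by apply/funext => N; apply: eq_bigr => n _; rewrite iter_hamiltonian.
Qed.

End Operator.

Section Drift.
Variable j : 'I_d.

Definition coord (k : K) : R := (k ord0 j)%:~R.

Lemma coordD k l : coord (k + l) = coord k + coord l.
Proof. by rewrite /coord mxE intrD. Qed.

(** On the axis spanned by [delta_mx ord0 j] the phase reduces to [u k_j], and the constant
    potential cancels in differences. Distinct [k] may share a frequency, which nonnegative weights
    allow. *)
Lemma weight_deriv_sqr (p q : P) :
  torus_lipschitz (fun theta => floquet G theta q p) ->
  exists2 r : R, 0 <= r & forall A : {fset K},
    \sum_(k <- A) (coord k * weight (site (q, 0)) (site (p, k))) ^+ 2 <= r ^+ 2.
Proof.
move=> [L lip].
have [M M0 wM] := weight_row.
pose D : R := `|(delta_mx ord0 j : 'rV[R]_d)|.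
have D0 : 0 <= D by exact: normr_ge0.
pose w (k : K) := weight (site (q, 0)) (site (p, k)).
have c1 := cos1_gt0 R.
(* No sign is known for the Lipschitz constant, hence the absolute value; [D] is the norm of the
   axis vector. *)
exists (`|L| * D / cos 1); first by rewrite divr_ge0 ?mulr_ge0 // ltW.
apply: (lipschitz_sum_sqr (M := M)).
- by move=> k; exact: weight_ge0.
- move=> A; have := wM (q, 0) (pair p @` A)%fset.
  by rewrite big_imfset //= => k k' _ _ [].
- by rewrite mulr_ge0.
move=> s t.
have fE u : usum (fun k => (w k)%:C * cis (2 * pi * (u * (k ord0 j)%:~R))) =
    floquet G (u *: delta_mx ord0 j) q p - (q == p)%:R * (potential (vertex q 0))%:C.
  rewrite mxE addrK usum.unlock; congr csum; apply/funext => k.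
  congr (_ * cis (_ * _)); rewrite (bigD1 j) //= big1 => [|l lj].
    by rewrite !mxE !eqxx mulr1 addr0.
  by rewrite !mxE eqxx (negPf lj) mulr0 mul0r.
rewrite !fE; set c := _ * _%:C.
have -> : forall a b : R[i], a - c - (b - c) = a - b by move=> a b; ring.
apply: le_trans (lip _ _) _.
set x := s *: _; set y := t *: _.
have lb : lbound [set `|x - y + map_mx intr k| | k in [set: K]] 0 by move=> _ [k _ <-].
have d0 : 0 <= torus_dist x y.
  by apply: lb_le_inf => //; exists `|x - y + map_mx intr (0 : K)|, 0.
have dle : torus_dist x y <= `|s - t| * D.
  apply: ge_inf; first by exists 0.
  exists 0 => //; rewrite map_mx0 addr0 -scalerBl normrZ //.
apply: (@le_trans _ _ (`|L| * torus_dist x y)).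
  by rewrite ler_wpM2r // ler_norm.
by rewrite -mulrA [D * _]mulrC ler_wpM2l.
Qed.

Lemma kham_drift : (forall i j : P, torus_lipschitz (fun theta => floquet G theta i j)) ->
  exists2 r : R, 0 <= r & l2le (tau (deriv coord kham)) r.
Proof.
move=> lip.
have /choice[r hr] : forall qp : P * P, exists r : R, forall A : {fset K},
    \sum_(k <- A) (coord k * weight (site (qp.1, 0)) (site (qp.2, k))) ^+ 2 <= r ^+ 2.
  by move=> [q p]; have [r _ hr] := weight_deriv_sqr (lip q p); exists r.
pose S := \sum_(q : P) \sum_(p : P) r (q, p) ^+ 2.
have S0 : 0 <= S by do 2!apply: sumr_ge0 => ? _; exact: sqr_ge0.
exists (Num.sqrt S) => [|A]; first exact: sqrtr_ge0.
rewrite sqr_sqrtr //.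
pose B := (snd @` (snd @` A))%fset.
pose F (q p : P) (k : K) := nc (tau (deriv coord kham) (q, (p, k))) ^+ 2.
have F0 q p k : 0 <= F q p k by exact: sqr_ge0.
apply: (@le_trans _ _ (\sum_q \sum_p \sum_(k <- B) F q p k)).
  apply: le_trans (le_fset_sum (sub_fsetX A) (fun v => sqr_ge0 _)) _.
  rewrite (sum_fsetX (fun q v => nc (tau (deriv coord kham) (q, v)) ^+ 2)).
  apply: le_trans (le_sum_fin _ _) _.
    by move=> q; apply: sumr_ge0 => v _; exact: sqr_ge0.
  apply: ler_sum => q _; apply: le_trans (le_fset_sum (sub_fsetX _) (fun v => sqr_ge0 _)) _.
  have -> : forall C D : {fset _},
      \sum_(v <- (C `*` D)%fset) nc (tau (deriv coord kham) (q, v)) ^+ 2 =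
      \sum_(p <- C) \sum_(k <- D) F q p k.
    by move=> C D; rewrite -(sum_fsetX (F q)); apply: eq_bigr => -[].
  by apply: le_sum_fin => p; exact: sumr_ge0.
apply: ler_sum => q _; apply: ler_sum => p _; apply: le_trans (hr (q, p) B).
apply: ler_sum => k _; rewrite /F /tau /deriv /kham /=.
have coord0 : coord 0 = 0 by rewrite /coord mxE.
(* The potential sits on the diagonal, where the commutator with [coord] vanishes; elsewhere only
   the weight remains. *)
rewrite coord0 subr0; case: eqP => [[-> ->]|_].
  by rewrite coord0 mul0r mul0r nc0.
by rewrite mul0r addr0 ncM !nc_real -normrM real_normK ?num_real // weight_sym.
Qed.

End Drift.

(** * Drift of the crystal along coordinate directions *)

Section Transport.
Hypothesis lip : forall i j : P, torus_lipschitz (fun theta => floquet G theta i j).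

Lemma drift_coord_limit j i : exists2 l : R, 0 <= l & forall e : R, 0 < e ->
  exists2 t0 : R, 0 < t0 & forall t, t0 <= t ->
    `|drift kham (coord j) i t - l * t| <= e * t.
Proof.
have [M M1 hM] := kham_row; have [r r0 hr] := kham_drift j lip.
exact: (drift_limit hM M1 kham_sym kham_real kham_periodic (@coordD j) r0 hr i).
Qed.

Lemma drift_coord_not_sublinear j : ~ forall q (e : R), 0 < e ->
  exists2 t0 : R, 0 < t0 & forall t, t0 <= t -> drift kham (coord j) q t <= e * t.
Proof.
move=> sub; have [M M1 hM] := kham_row; have [r r0 hr] := kham_drift j lip.
(* A translation with nonzero [j]-th coordinate; connectedness will join a vertex to its
   translate. *)
pose k : K := delta_mx ord0 j.
have xk : coord j k != 0 by rewrite /coord mxE !eqxx oner_eq0.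
have [q qK Kq] := site_bij.
pose q0 := Ordinal (nu_gt0 G).
have [p [+ last_p]] := crystal_connected (site (q0, k)) (site (q0, 0)).
pose s := map q p; have -> : p = map site s.
  by rewrite -map_comp -[LHS]map_id; apply: eq_map => u; rewrite /= Kq.
rewrite path_map => ks.
(* This scalar makes every diagonal entry [potential + c] nonnegative. *)
pose c := \sum_(q : P) `|potential (vertex q 0) : R|.
have c0 : 0 <= c by exact: sumr_ge0.
have pot (v : P * K) : 0 <= potential (site v) + c.
  rewrite potential_site /c (bigD1 v.1) //=; have := ler_norm (- potential (vertex v.1 0)).
  rewrite normrN => h; have h2 : 0 <= \sum_(q | q != v.1) `|potential (vertex q 0) : R|.
    by rewrite sumr_ge0.
  by move: h h2; lra.
have shiftE v w : kshift kham c%:C v w =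
    (weight (site v) (site w) + (v == w)%:R * (potential (site v) + c))%:C.
  rewrite /kshift /kham /kid rmorphD rmorphM rmorphD /= rmorph_nat; ring.
apply: (no_closed_path hM M1 kham_sym kham_real
  kham_periodic (@coordD j) r0 hr sub xk (c := c%:C) (q := q0) (p := s)).
- by move=> v w; rewrite shiftE lecR addr_ge0 ?weight_ge0 // mulr_ge0.
- apply: sub_path ks => v w /= vw; rewrite shiftE ltcR ltr_pwDl //.
  by rewrite mulr_ge0.
have := last_p; rewrite -[p](mapK Kq) -/s last_map.
by move/(can_inj qK).
Qed.

(* [x_j e^{-itH} delta_w] and [(x_j - x_j(w)) e^{-itH} delta_w] differ by a vector of norm
   [|x_j(w)|], as [e^{-itH}] is unitary. *)
Lemma position_drift j i (m : K) t :
  l2 (fun v : X => (coord j v.2)%:C * kexp kham t v (i, m)) /\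
  `|nrm (fun v : X => (coord j v.2)%:C * kexp kham t v (i, m)) -
    drift kham (coord j) i t| <= `|coord j m|.
Proof.
have [M M1 hM] := kham_row; have [r r0 hr] := kham_drift j lip.
have M0 : 0 <= M := le_trans ler01 M1.
pose D := deriv (coord j) (kexp kham t).
have hsD : hs D.
  exact: hs_deriv_kexp hM M1 kham_sym kham_periodic (@coordD j) r0 hr t.
have col2 : l2 (fun v => D v (i, 0)).
  have [_ [b b0 Db]] := hsD; exists b => //; exact: l2le_col.
have DE : (fun v => D v (i, m)) = fun v => D (shift (- m) v) (i, 0).
  by apply/funext => -[p k]; exact: periodic_origin hsD.1.
have f2 : l2 (fun v => D v (i, m)).
  by rewrite DE; apply: (l2_inj (p := shift (- m))) col2; exact: can_inj (shiftNK m).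
have fn : nrm (fun v => D v (i, m)) = drift kham (coord j) i t.
  by rewrite DE; exact: (nrm_bij (shiftNK m) (shiftK m) col2).
pose g (v : P * K) := (coord j m)%:C * kexp kham t v (i, m).
have gle : l2le g `|coord j m|.
  have -> : g = fun v => (coord j m)%:C * kexp kham t (i, m) v.
    by apply/funext => v; rewrite /g (kexp_sym hM M0 kham_sym).
  have := l2leZ (coord j m)%:C (l2le_kexp_row hM M1 kham_sym
    kham_real t (i, m)).
  by rewrite mulr1 nc_real.
have g2 : l2 g by exists `|coord j m|.
have gn : nrm g <= `|coord j m| by apply: nrm_le.
have yE : (fun v : P * K => (coord j v.2)%:C *
    kexp kham t v (i, m)) = fun v => D v (i, m) + g v.
  apply/funext => v; rewrite /D /deriv /g -mulrDl; congr (_ * _).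
  by rewrite -rmorphD /= subrK.
have y2 : l2 (fun v => D v (i, m) + g v) by exact: l2D.
split; first by rewrite yE.
rewrite yE -fn; have h1 := nrmD f2 g2.
have h2 := nrmD y2 (l2Z (-1) g2).
have e1 : (fun v => D v (i, m) + g v + -1 * g v) = fun v => D v (i, m).
  by apply/funext => v; ring.
have e2 : nrm (fun v => -1 * g v) = nrm g.
  by rewrite -[RHS]nrmN; congr nrm; apply/funext => v; rewrite mulN1r.
rewrite e1 e2 in h2.
rewrite ler_norml; apply/andP; split; lra.
Qed.

End Transport.
End Crystal.

(** * Ballistic transport along a layer *)

Theorem corollary7p6 (R : realType) (d : nat) (d_gt0 : (0 < d)%N)
    (G : crystal R d)
    (h_lipschitz : forall i j : 'I_(nu G),
      torus_lipschitz (fun theta => floquet G theta i j))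
    (J_null : lebesgue_outer (closure (discontinuities G)) = 0%E) :
  exists i : 'I_(nu G), forall w : vertices G, layer i w ->
    exists2 l : R, l != 0 &
      (position_norm2 (propagator t (delta w)) * ((t ^+ 2)^-1)%:E)%E
        @[t --> +oo%R] --> l%:E.
Proof.
have /choice[l hl] : forall ji : 'I_d * 'I_(nu G), exists l : R, forall e : R, 0 < e ->
    exists2 t0 : R, 0 < t0 & forall t, t0 <= t ->
      `|drift (kham (G := G)) (coord R ji.1) ji.2 t - l * t| <= e * t.
  by move=> [j i]; have [l] := drift_coord_limit h_lipschitz j i; exists l.
pose j0 := Ordinal d_gt0.
(* If every layer had zero speed along [j0], all drifts in that direction would be sublinear. *)
have [i li] : exists i, l (j0, i) != 0.
  apply: contrapT => /forallNP none.
  apply: (drift_coord_not_sublinear h_lipschitz (j := j0)) => q e e0.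
  have [t0 t0p ht0] := hl (j0, q) e e0; exists t0 => // t /ht0 /=.
  have -> : l (j0, q) = 0 by apply/eqP/negP => /negP; exact: none.
  by rewrite mul0r subr0; apply: le_trans; exact: ler_norm.
exists i => w [m _ <-]; rewrite -[vertex i m]/(site (i, m)).
pose y j t := nrm (fun v : 'I_(nu G) * 'rV[int]_d => (coord R j v.2)%:C *
  kexp (kham (G := G)) t v (i, m)).
have main j t := position_drift h_lipschitz j i m t.
have [M M1 hM] := kham_row G.
(* The limit depends on the layer [i] but not on the translate [m]; the term of [j0] makes it
   positive. *)
exists (\sum_(j < d) l (j, i) ^+ 2).
  rewrite gt_eqF // (bigD1 j0) //= ltr_pwDl ?exprn_even_gt0 //.
  by apply: sumr_ge0 => j _; exact: sqr_ge0.
have posE t : position_norm2 (propagator t (delta (site (i, m)))) =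
    (\sum_(j < d) y j t ^+ 2)%:E.
  rewrite -(@esum_position R _ d (fun v => kexp (kham (G := G)) t v (i, m))).
    rewrite /position_norm2; congr esum; apply/funext => k; congr _%:E.
    apply: eq_bigr => p _.
    by rewrite -[vertex p k]/(site (p, k)) (propagator_site M1 hM).
  by move=> j; have [] := main j t.
have ylim j : y j t / t @[t --> +oo] --> l (j, i).
  apply/cvgrPdist_le => e e0; have hlim := hl (j, i).
  have e2 : 0 < e / 2 by rewrite divr_gt0.
  have [t0 t0p ht0] := hlim _ e2.
  (* The offset of the translate [m] is a bounded error, absorbed by [e / 2] times [t] for large
     [t]. *)
  exists (t0 + `|coord R j m| / (e / 2)); split; first exact: num_real.
  move=> t /ltW le_t.
  have c0 : 0 <= `|coord R j m| / (e / 2) by rewrite divr_ge0 // ltW.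
  have le_t0 : t0 <= t by apply: le_trans le_t; rewrite lerDl.
  have le_c : `|coord R j m| <= t * (e / 2).
    by rewrite -ler_pdivrMr //; apply: le_trans le_t; rewrite lerDr ltW.
  have tp := lt_le_trans t0p le_t0.
  have -> : l (j, i) - y j t / t = (l (j, i) * t - y j t) / t.
    by rewrite mulrBl mulfK // gt_eqF.
  rewrite normrM normfV (gtr0_norm tp) ler_pdivrMr //.
  have := (main j t).2; rewrite -/(y j t) => h1; have := ht0 t le_t0 => /= h2.
  move: h1 h2; rewrite !ler_norml => /andP[? ?] /andP[? ?]; apply/andP; split; lra.
have -> : (fun t => position_norm2 (propagator t (delta (site (i, m)))) * ((t ^+ 2)^-1)%:E)%E =
    fun t => (\sum_(j < d) (y j t / t) * (y j t / t))%:E.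
  apply/funext => t; rewrite posE -EFinM; congr _%:E; rewrite mulr_suml.
  by apply: eq_bigr => j _; rewrite -expr2 expr_div_n.
apply: cvg_EFin; first by apply: nearW.
change (((fun t => \sum_(j < d) y j t / t * (y j t / t)) : R -> R) @ +oo --> \sum_(j < d) l (j, i) ^+ 2).
elim: (index_enum 'I_d) => [|j js IH].
  under eq_fun do rewrite big_nil.
  by rewrite big_nil; exact: cvg_cst.
under eq_fun do rewrite big_cons.
by rewrite big_cons expr2; apply: cvgD IH; apply: cvgM; exact: ylim.
Qed.
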